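(* Let $\mathcal I=\{f_i\}_{i=1}^m$ be an IFS of contracting orientation-preserving similarities on $\mathbb R^d$ with dense rotations and satisfying the open set condition, and let $K$ be its attractor. Suppose $s=\dim_H K>1$ and that the orthogonal projection of $K$ onto every 1-dimensional subspace equals the projection of the convex hull of $K$. Then for every 1-dimensional subspace $V$ of $\mathbb R^d$ and every $\epsilon\in(0,s-1)$, $$\dim_H\big\{x\in V:\ \underline{\dim}_B\big(K\cap\pi_V^{-1}(x)\big)>\dim_H K-1-\epsilon\big\}=1.$$
   Context: An IFS of orientation-preserving similarities is $\{f_i=r_iR_i\cdot+a_i\}_{i=1}^m$ with $m\ge2$, $0<r_i<1$, $R_i\in SO(d,\mathbb R)$, $a_i\in\mathbb R^d$; its attractor is the unique nonempty compact $K$ with $K=\bigcup_i f_i(K)$. It has dense rotations if the group generated by $R_1,\dots,R_m$ is dense in $SO(d,\mathbb R)$. The open set condition holds if there is a nonempty open $U$ with $\bigcup_i f_i(U)\subset U$, the union disjoint. $\pi_V$ is orthogonal projection onto $V$; $\underline{\dim}_B$ is lower box-counting dimension; $\dim_H\emptyset=-\infty$. *)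

(* Defs.v *)
From Stdlib Require Import Reals.
From mathcomp Require Import all_boot all_fingroup.
Open Scope R_scope.

Definition Point (d : nat) := 'I_d -> R.
Definition Mat (d : nat) := 'I_d -> 'I_d -> R.

Definition dot {d} (x y : Point d) : R := \big[Rplus/0]_(i < d) (x i * y i).
Definition dist {d} (x y : Point d) : R :=
  sqrt (\big[Rplus/0]_(i < d) ((x i - y i) * (x i - y i))).
Definition scal {d} (t : R) (v : Point d) : Point d := fun i => t * v i.
Definition unit_vec {d} (v : Point d) : Prop := dot v v = 1.

(* Orthogonal projection onto the line V = span v (v a unit vector). *)
Definition proj {d} (v x : Point d) : Point d := scal (dot x v) v.

Definition mat_apply {d} (M : Mat d) (x : Point d) : Point d :=
  fun i => \big[Rplus/0]_(j < d) (M i j * x j).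
Definition mat_mul {d} (A B : Mat d) : Mat d :=
  fun i j => \big[Rplus/0]_(k < d) (A i k * B k j).
Definition mat_tr {d} (A : Mat d) : Mat d := fun i j => A j i.
Definition mat_id {d} : Mat d := fun i j => if i == j then 1 else 0.
Definition det {d} (A : Mat d) : R :=
  \big[Rplus/0]_(s : {perm 'I_d})
     ((if odd_perm s then -1 else 1) * \big[Rmult/1]_(i < d) A i (s i)).
Definition SOd {d} (A : Mat d) : Prop :=
  mat_mul (mat_tr A) A = mat_id /\ det A = 1.

(* The subgroup of SO(d) generated by Rot 0, ..., Rot (m-1)
   (inverses of rotations are their transposes). *)
Inductive gen_group {d} (m : nat) (Rot : nat -> Mat d) : Mat d -> Prop :=
| gen_id : gen_group m Rot mat_id
| gen_mul : forall i g, (i < m)%nat -> gen_group m Rot g ->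
    gen_group m Rot (mat_mul (Rot i) g)
| gen_mulinv : forall i g, (i < m)%nat -> gen_group m Rot g ->
    gen_group m Rot (mat_mul (mat_tr (Rot i)) g).

Definition dense_rotations {d} (m : nat) (Rot : nat -> Mat d) : Prop :=
  forall Q : Mat d, SOd Q -> forall e, 0 < e ->
    exists g, gen_group m Rot g /\ forall i j, Rabs (g i j - Q i j) < e.

Definition sim {d} (r : nat -> R) (Rot : nat -> Mat d) (a : nat -> Point d)
  (i : nat) (x : Point d) : Point d :=
  fun j => r i * mat_apply (Rot i) x j + a i j.

Definition is_open {d} (U : Point d -> Prop) : Prop :=
  forall x, U x -> exists e, 0 < e /\ forall y, dist x y < e -> U y.
Definition is_closed {d} (A : Point d -> Prop) : Prop :=
  is_open (fun x => ~ A x).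
Definition is_bounded {d} (A : Point d -> Prop) : Prop :=
  exists M, forall x y, A x -> A y -> dist x y <= M.
(* compact subsets of R^d = closed and bounded (Heine-Borel) *)
Definition is_compact {d} (A : Point d -> Prop) : Prop :=
  is_closed A /\ is_bounded A.

Definition is_attractor {d} (m : nat) (f : nat -> Point d -> Point d)
  (K : Point d -> Prop) : Prop :=
  (exists x, K x) /\ is_compact K /\
  forall y, K y <-> exists i, (i < m)%nat /\ exists x, K x /\ y = f i x.

Definition OSC {d} (m : nat) (f : nat -> Point d -> Point d) : Prop :=
  exists U : Point d -> Prop, (exists x, U x) /\ is_open U /\
    (forall i x, (i < m)%nat -> U x -> U (f i x)) /\
    (forall i j x y, (i < m)%nat -> (j < m)%nat -> i <> j ->
        U x -> U y -> f i x <> f j y).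

Definition conv_hull {d} (A : Point d -> Prop) (y : Point d) : Prop :=
  exists (n : nat) (p : nat -> Point d) (w : nat -> R),
    (forall k, (k <= n)%nat -> A (p k) /\ 0 <= w k) /\
    sum_f_R0 w n = 1 /\
    forall j, y j = sum_f_R0 (fun k => w k * p k j) n.

Definition is_glb (E : R -> Prop) (t : R) : Prop :=
  (forall x, E x -> t <= x) /\ (forall b, (forall x, E x -> b <= x) -> b <= t).

(* Hausdorff dimension.  Hnull s A : H^s(A) = 0, i.e. for every eps > 0 there
   is a countable cover of A by sets U_k of diameter <= r_k with
   sum_k r_k^s <= eps. *)
Definition Hnull {d} (s : R) (A : Point d -> Prop) : Prop :=
  forall eps, 0 < eps ->
    exists (U : nat -> Point d -> Prop) (r : nat -> R),
      (forall k, 0 < r k) /\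
      (forall k x y, U k x -> U k y -> dist x y <= r k) /\
      (forall x, A x -> exists k, U k x) /\
      (forall n, sum_f_R0 (fun k => Rpower (r k) s) n <= eps).

(* hdim A t : A is nonempty and dim_H A = t = inf { s >= 0 : H^s(A) = 0 }.
   (dim_H of the empty set is -infinity, never a real number.) *)
Definition hdim {d} (A : Point d -> Prop) (t : R) : Prop :=
  (exists x, A x) /\ is_glb (fun s => 0 <= s /\ Hnull s A) t.

(* lbdim_gt F t : lower box dimension of F is > t, i.e.
   liminf_{delta -> 0} log N_delta(F) / (- log delta) > t, where N_delta(F)
   is the least number of sets of diameter <= delta covering F; unfolded:
   there are t' > t and delta0 > 0 such that for all delta in (0, delta0),
   every cover of F by n sets of diameter <= delta has n >= delta^(-t'). *)
Definition lbdim_gt {d} (F : Point d -> Prop) (t : R) : Prop :=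
  exists t' delta0, t < t' /\ 0 < delta0 /\
    forall delta, 0 < delta < delta0 ->
      forall (n : nat) (U : nat -> Point d -> Prop),
        (forall k x y, (k < n)%nat -> U k x -> U k y -> dist x y <= delta) ->
        (forall x, F x -> exists k, (k < n)%nat /\ U k x) ->
        Rpower delta (- t') <= INR n.

(* Main.v *)
(** Fix a direction [v] and put on cylinders the weights [p_i <= r_i ^ s].  Let
    [N_k x] be the number of [k]-th generation cylinders (of size about
    [rho = exp (- k X)]) whose projection contains [x].

    Few cylinders lie over points of low multiplicity: projections of cylinders
    are intervals of length at least a multiple of [rho], so over an interval of
    length [rho] only [O(m)] cylinders can meet [{N_k < m}].  Hence cylinders over
    [{N_k < rho ^ - (s - 1 - eps / 2)}] have total weight
    [O (rho ^ (eps / 2))], which is summable in [k].  By the open set condition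
    [N_k x] bounds from below the covering number of the fibre over [x].

    What remains is a probability on [K] which is almost bounded by the natural
    weights and whose projection to [v] has Frostman exponent almost 1.  At a
    scale [delta] the pair correlation of the projected natural measure, averaged
    over a grid of directions, is [O (delta log (1 / delta))] because [s > 1].
    Dense rotations make time averages along the random walk
    [u -> R_i^T u] on directions uniformly small in the starting direction.  So
    for typical sequences of cylinders of size [delta] only a small proportion
    of the steps is crowded, and discarding the other sequences yields, at the
    single scale [exp (- X)] and in every direction, weights with projection
    exponent almost 1.  Multiplying these along the tree gives the probability.

    Instead of measures on the infinite tree, the exceptional sets are finite
    level events, and a point of [K] avoiding all of them (and a given economical
    cover) is found by the method of conditional expectations. *)

Require Import Defs.
From Stdlib Require Import ZArith Reals Lra FunctionalExtensionality.
From mathcomp Require Import all_boot all_fingroup.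
From mathcomp Require Import boolp Rstruct zify.
From mathcomp Require ssralg matrix.
Import Defs.
Open Scope R_scope.
Set Implicit Arguments.
Unset Strict Implicit.
Unset Printing Implicit Defensive.

(** * Sums and vectors *)

(** The one-scale estimate is applied again inside every chosen cylinder, in the direction to which
    the rotations have turned [v]. It must therefore hold in every direction, the weights [q u]
    depend on the direction [u], and the constant in it must be exactly 1, because a constant would
    be raised to the power of the generation. All losses go into the exponent, which drops from 1 to
    [1 - eps], and into a large [X]. The weights may double relative to the natural ones in each
    generation, which costs only [ln 2 / X] in the exponent. The condition s > 1 enters the
    correlation estimate as [p i <= ratio i]: a ball of radius t then has natural mass O(t), which
    is borderline for projections to lines and produces the logarithm. The projection hypothesis is
    applied in all the turned directions; it makes the projection of every cylinder an interval. The
    dimension of [K] enters through sum r_i^s >= 1, so that the normalised weights r_i^s / (sum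
    r_j^s) are at most r_i^s. *)

Lemma sumR_ge0 (I : eqType) (s : seq I) (P : pred I) (F : I -> R) :
  (forall i, i \in s -> P i -> 0 <= F i) -> 0 <= \big[Rplus/0]_(i <- s | P i) F i.
Proof.
move=> h; rewrite big_seq_cond.
elim/big_ind: _ => [|x y hx hy|i /andP[hi hP]]; [lra | lra | exact: h].
Qed.

Lemma sumR_le (I : eqType) (s : seq I) (P : pred I) (F G : I -> R) :
  (forall i, i \in s -> P i -> F i <= G i) ->
  \big[Rplus/0]_(i <- s | P i) F i <= \big[Rplus/0]_(i <- s | P i) G i.
Proof.
move=> h; rewrite 2!(big_seq_cond P).
elim/big_ind2: _ => [|x y z t hx hy|i /andP[hi hP]]; [lra | lra | exact: h].
Qed.

Lemma sumR_le_pred (I : eqType) (s : seq I) (P Q : pred I) (F : I -> R) :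
  (forall i, i \in s -> P i -> Q i) ->
  (forall i, i \in s -> Q i -> 0 <= F i) ->
  \big[Rplus/0]_(i <- s | P i) F i <= \big[Rplus/0]_(i <- s | Q i) F i.
Proof.
move=> hPQ h0; rewrite (big_mkcond P) (big_mkcond Q) /=; apply: sumR_le => i hi _.
case: ifP => hp; first by rewrite (hPQ _ hi hp); lra.
by case: ifP => // hq; [exact: h0 | lra].
Qed.

Lemma sumR_const (I : Type) (s : seq I) (c : R) :
  \big[Rplus/0]_(i <- s) c = INR (size s) * c.
Proof.
elim: s => [|x s IH]; first by rewrite big_nil /=; lra.
rewrite big_cons IH -[size (x :: s)]/(size s).+1 S_INR; lra.
Qed.

Lemma sumR_opp (I : Type) (s : seq I) (P : pred I) (F : I -> R) :
  \big[Rplus/0]_(i <- s | P i) - F i = - \big[Rplus/0]_(i <- s | P i) F i.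
Proof.
elim: s => [|x s IH]; first by rewrite !big_nil; lra.
by rewrite !big_cons IH; case: (P x); lra.
Qed.

Lemma sumR_ge_term (I : eqType) (s : seq I) (F : I -> R) j :
  j \in s -> (forall i, i \in s -> 0 <= F i) -> F j <= \big[Rplus/0]_(i <- s) F i.
Proof.
elim: s => [//|x s IH]; rewrite inE => hj h0; rewrite big_cons.
have hx : 0 <= F x by apply: h0; rewrite inE eqxx.
have hs : forall i, i \in s -> 0 <= F i by move=> i hi; apply: h0; rewrite inE hi orbT.
case/orP: hj => [/eqP ->|hj].
- suff : 0 <= \big[Rplus/0]_(i <- s) F i by lra.
  by apply: sumR_ge0 => i hi _; apply: hs.
- have := IH hj hs; lra.
Qed.

Lemma sumR_abs (I : Type) (s : seq I) (F : I -> R) :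
  Rabs (\big[Rplus/0]_(i <- s) F i) <= \big[Rplus/0]_(i <- s) Rabs (F i).
Proof.
elim: s => [|x s IH]; first by rewrite !big_nil Rabs_R0; lra.
by rewrite !big_cons; apply: Rle_trans (Rabs_triang _ _) _; lra.
Qed.

Lemma sumR_pos (I : eqType) (s : seq I) (F : I -> R) j :
  j \in s -> (forall i, i \in s -> 0 < F i) -> 0 < \big[Rplus/0]_(i <- s) F i.
Proof.
move=> hj h; have := sumR_ge_term hj (fun i hi => Rlt_le _ _ (h i hi)).
have := h _ hj; lra.
Qed.

Section Vectors.
Variable d : nat.
Implicit Types (x y z u v : Point d) (A B M : Mat d).

Definition vsub x y : Point d := fun i => x i - y i.
Definition nrm x : R := sqrt (dot x x).

Lemma dotC x y : dot x y = dot y x.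
Proof. by apply: eq_bigr => i _; rewrite Rmult_comm. Qed.

Lemma dot_vsubr u x y : dot u (vsub x y) = dot u x - dot u y.
Proof.
rewrite /dot /Rminus -sumR_opp -big_split; apply: eq_bigr => i _ /=.
by rewrite /vsub; lra.
Qed.

Lemma dot_vsubl u x y : dot (vsub x y) u = dot x u - dot y u.
Proof. by rewrite dotC dot_vsubr !(dotC u). Qed.

Lemma dot_scalr t u x : dot u (scal t x) = t * dot u x.
Proof. by rewrite /dot big_distrr; apply: eq_bigr => i _ /=; rewrite /scal; lra. Qed.

Lemma dot_scall t u x : dot (scal t x) u = t * dot x u.
Proof. by rewrite dotC dot_scalr dotC. Qed.

Lemma dot_ge0 x : 0 <= dot x x.
Proof. by apply: sumR_ge0 => i _ _; nra. Qed.

Lemma nrm_ge0 x : 0 <= nrm x. Proof. exact: sqrt_pos. Qed.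
Lemma nrm_sq x : nrm x * nrm x = dot x x.
Proof. exact: sqrt_sqrt (dot_ge0 x). Qed.

Lemma nrm_unit u : unit_vec u -> nrm u = 1.
Proof. by rewrite /unit_vec /nrm => ->; exact: sqrt_1. Qed.

Lemma dist_nrm x y : dist x y = nrm (vsub x y).
Proof. by []. Qed.

Lemma coord_le x i : Rabs (x i) <= nrm x.
Proof.
rewrite -(sqrt_Rsqr_abs (x i)); apply: sqrt_le_1_alt.
apply: (sumR_ge_term (F := fun i => x i * x i)); first by rewrite mem_index_enum.
move=> j _; nra.
Qed.

Lemma nrm0_coord x i : nrm x = 0 -> x i = 0.
Proof. by have := coord_le x i; have := Rabs_pos (x i); split_Rabs; lra. Qed.

Lemma cauchy x y : Rabs (dot x y) <= nrm x * nrm y.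
Proof.
set B := dot y y; set C := dot x y; set A := dot x x.
(* This is the squared norm of [B x - C y]. *)
have h : 0 <= B * (A * B - C * C).
  have := dot_ge0 (vsub (scal B x) (scal C y)).
  rewrite dot_vsubr !dot_vsubl !dot_scalr !dot_scall (dotC y x) -/A -/B -/C; nra.
have hB : 0 <= B := dot_ge0 y.
have hC : C * C <= A * B.
  case: (Rle_lt_or_eq_dec _ _ hB) => hB0; first by nra.
  have hy : nrm y = 0 by rewrite /nrm -/B -hB0 sqrt_0.
  have -> : C = 0.
    by rewrite /C /dot big1 // => i _; rewrite (nrm0_coord i hy); lra.
  rewrite -hB0; lra.
have hx := nrm_ge0 x; have hy := nrm_ge0 y.
have e1 := nrm_sq x; have e2 := nrm_sq y.
apply: Rsqr_incr_0_var; last by nra.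
rewrite -Rsqr_abs /Rsqr -/C.
have -> : nrm x * nrm y * (nrm x * nrm y) = (nrm x * nrm x) * (nrm y * nrm y) by lra.
by rewrite e1 e2.
Qed.

Lemma nrm_vsub_triangle x y z : nrm (vsub x z) <= nrm (vsub x y) + nrm (vsub y z).
Proof.
have h1 := nrm_ge0 (vsub x y); have h2 := nrm_ge0 (vsub y z).
apply: Rsqr_incr_0_var; last by lra.
rewrite /Rsqr nrm_sq.
have -> : vsub x z = vsub (vsub x y) (vsub z y).
  by apply: functional_extensionality => i; rewrite /vsub; lra.
have hc := cauchy (vsub x y) (vsub z y).
have -> : forall p q : Point d,
    dot (vsub p q) (vsub p q) = dot p p - 2 * dot p q + dot q q.
  by move=> p q; rewrite dot_vsubr !dot_vsubl (dotC q p); lra.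
have e : nrm (vsub z y) = nrm (vsub y z).
  by rewrite /nrm; congr sqrt; apply: eq_bigr => i _; rewrite /vsub; lra.
have e1 := nrm_sq (vsub x y); have e2 := nrm_sq (vsub z y).
rewrite e in hc e2; rewrite -e1 -e2; move: hc; split_Rabs; nra.
Qed.

Lemma dist_triangle x y z : dist x z <= dist x y + dist y z.
Proof. exact: nrm_vsub_triangle. Qed.

Lemma distC x y : dist x y = dist y x.
Proof. by rewrite /dist; congr sqrt; apply: eq_bigr => i _; lra. Qed.

Lemma dist_ge0 x y : 0 <= dist x y. Proof. exact: sqrt_pos. Qed.

Lemma dist_xx x : dist x x = 0.
Proof. by rewrite /dist big1 ?sqrt_0 // => i _; lra. Qed.

Lemma nrm_le_sum x : nrm x <= \big[Rplus/0]_(i < d) Rabs (x i).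
Proof.
set S := \big[Rplus/0]_(i < d) _.
have hS : 0 <= S by apply: sumR_ge0 => i _ _; exact: Rabs_pos.
apply: Rsqr_incr_0_var => //; rewrite /Rsqr nrm_sq.
rewrite {1}/S big_distrl; apply: sumR_le => i _ _.
have : Rabs (x i) <= S.
  apply: (sumR_ge_term (F := fun i => Rabs (x i))) => [|j _]; last exact: Rabs_pos.
  by rewrite mem_index_enum.
move: (S) hS => T hT hx /=; have := Rabs_pos (x i); split_Rabs; nra.
Qed.

Lemma dist_le_sum x y e : (forall i, Rabs (x i - y i) <= e) -> dist x y <= INR d * e.
Proof.
move=> h; apply: Rle_trans (nrm_le_sum _) _.
rewrite -[in INR d](size_enum_ord d) -sumR_const big_enum.
apply: sumR_le => i _ _; exact: h.
Qed.

Lemma dot_dist u x y : Rabs (dot u x - dot u y) <= nrm u * dist x y.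
Proof. by rewrite -dot_vsubr; exact: cauchy. Qed.

Definition orth M := mat_mul (mat_tr M) M = mat_id.

Lemma mat_apply_mul A B x : mat_apply (mat_mul A B) x = mat_apply A (mat_apply B x).
Proof.
apply: functional_extensionality => i; rewrite /mat_apply /mat_mul.
under eq_bigr => j _ do rewrite big_distrl.
rewrite exchange_big /=; apply: eq_bigr => k _; rewrite big_distrr /=.
by apply: eq_bigr => j _; lra.
Qed.

Lemma mat_apply_id x : mat_apply mat_id x = x.
Proof.
apply: functional_extensionality => i; rewrite /mat_apply /mat_id.
rewrite (bigD1 i) //= eqxx big1 => [|j /negbTE hj]; first by lra.
by rewrite eq_sym hj; lra.
Qed.

Lemma dot_mat_apply A x y : dot (mat_apply A x) y = dot x (mat_apply (mat_tr A) y).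
Proof.
rewrite /dot /mat_apply /mat_tr.
under eq_bigr => i _ do rewrite big_distrl.
rewrite exchange_big /=; apply: eq_bigr => k _; rewrite big_distrr /=.
by apply: eq_bigr => j _; lra.
Qed.

Lemma mat_apply_vsub A x y : mat_apply A (vsub x y) = vsub (mat_apply A x) (mat_apply A y).
Proof.
apply: functional_extensionality => i; rewrite /mat_apply /vsub /Rminus -sumR_opp -big_split.
by apply: eq_bigr => j _ /=; lra.
Qed.

Lemma mat_apply_scal A t x : mat_apply A (scal t x) = scal t (mat_apply A x).
Proof.
apply: functional_extensionality => i; rewrite /mat_apply /scal big_distrr.
by apply: eq_bigr => j _ /=; lra.
Qed.

End Vectors.

(** * Inverses and determinants through MathComp matrices *)

Section MatrixFacts.
Import ssralg.GRing matrix.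
Variable d : nat.
Implicit Types A B M : Mat d.

Definition mx_of A : 'M[R]_d := (\matrix_(i, j) A i j)%R.

Lemma mx_of_inj A B : mx_of A = mx_of B -> A = B.
Proof.
move=> h; apply: functional_extensionality => i; apply: functional_extensionality => j.
by have := congr1 (fun M : 'M_d => M i j) h; rewrite !mxE.
Qed.

Lemma mx_of_mul A B : mx_of (mat_mul A B) = (mx_of A *m mx_of B)%R.
Proof.
apply/matrixP => i j; rewrite !mxE /mat_mul.
by apply: eq_bigr => k _; rewrite !mxE.
Qed.

Lemma mx_of_id : mx_of mat_id = scalar_mx (one R).
Proof. by apply/matrixP => i j; rewrite !mxE /mat_id; case: (i == j). Qed.

Lemma mx_of_tr A : mx_of (mat_tr A) = (mx_of A)^T%R.
Proof. by apply/matrixP => i j; rewrite !mxE. Qed.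

Lemma det_mx_of A : det A = (\det (mx_of A))%R.
Proof.
rewrite /det /determinant; apply: eq_bigr => s _; congr Rmult.
  by case: (odd_perm s) => //=; rewrite ?expr0 ?expr1.
by apply: eq_bigr => i _; rewrite mxE.
Qed.

Lemma orth_mat_tr M : orth M -> orth (mat_tr M).
Proof.
move=> h; apply: mx_of_inj.
have : (mx_of (mat_tr M) *m mx_of M)%R = scalar_mx (one R) by rewrite -mx_of_mul h mx_of_id.
by move/mulmx1C; rewrite -mx_of_id -mx_of_mul.
Qed.

(** The determinant of [M] may be -1, but det (M M) = det (M^T M) = 1. *)
Lemma SOd_sq M : orth M -> SOd (mat_mul M M).
Proof.
move=> h.
have e : ((mx_of M)^T *m mx_of M)%R = scalar_mx (one R).
  by rewrite -mx_of_tr -mx_of_mul h mx_of_id.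
split.
  apply: mx_of_inj; rewrite mx_of_mul mx_of_tr mx_of_mul mx_of_id.
  by rewrite trmx_mul mulmxA -(mulmxA (mx_of M)^T%R) e mulmx1.
rewrite det_mx_of mx_of_mul det_mulmx -{1}(det_tr (mx_of M)) -det_mulmx e.
exact: det1.
Qed.

End MatrixFacts.

(** * Rotations and recurrence *)

(** A finite substitute for compactness: bounded vectors are rounded to a grid of step [e]. It
    serves the recurrence of powers of a rotation, the packing of separated points and the division
    of unit vectors into finitely many classes. *)
Lemma cell_map (I : finType) (B e : R) : 0 <= B -> 0 < e ->
  exists (M : nat) (cell : (I -> R) -> {ffun I -> 'I_M}),
    forall x y, (forall i, Rabs (x i) <= B) -> (forall i, Rabs (y i) <= B) ->
      cell x = cell y -> forall i, Rabs (x i - y i) <= e.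
Proof.
move=> hB he.
pose k (t : R) := Z.to_nat (up ((t + B) / e)).
pose N := Z.to_nat (up (2 * B / e)).
exists N.+2, (fun x => [ffun i => inord (k (x i))]).
have hk : forall t, Rabs t <= B ->
    [/\ (k t < N.+2)%nat, (t + B) / e < INR (k t) & INR (k t) <= (t + B) / e + 1].
  move=> t ht.
  have hz : 0 <= (t + B) / e <= 2 * B / e.
    split; first by apply: Rle_mult_inv_pos => //; split_Rabs; lra.
    apply: Rmult_le_compat_r; first by apply: Rlt_le; exact: Rinv_0_lt_compat.
    by split_Rabs; lra.
  have [h1 h2] := archimed ((t + B) / e).
  have [h3 h4] := archimed (2 * B / e).
  have hp : (0 < up ((t + B) / e))%Z by apply: lt_IZR; lra.
  have hp2 : (0 < up (2 * B / e))%Z by apply: lt_IZR; lra.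
  have hle : (up ((t + B) / e) <= up (2 * B / e))%Z.
    apply/Z.lt_succ_r; apply: lt_IZR; rewrite succ_IZR; lra.
  have e1 : INR (k t) = IZR (up ((t + B) / e)) by rewrite INR_IZR_INZ Z2Nat.id //; lia.
  rewrite e1; split; [by rewrite /k /N; lia | lra | lra].
move=> x y hx hy /ffunP hc i.
have [a1 a2 a3] := hk _ (hx i); have [b1 b2 b3] := hk _ (hy i).
have := hc i; rewrite !ffunE => /(congr1 val); rewrite /= !inordK // => ek.
rewrite ek in a2 a3.
have hh : Rabs ((x i + B) / e - (y i + B) / e) <= 1 by split_Rabs; lra.
have -> : x i - y i = ((x i + B) / e - (y i + B) / e) * e by field; lra.
rewrite Rabs_mult (Rabs_pos_eq e); last by lra.
have := Rabs_pos ((x i + B) / e - (y i + B) / e); nra.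
Qed.

Lemma bounded_recurrence (I : finType) (F : nat -> I -> R) (B e : R) : 0 <= B -> 0 < e ->
  (forall n i, Rabs (F n i) <= B) ->
  exists a b : nat, (a < b)%nat /\ forall i, Rabs (F a i - F b i) <= e.
Proof.
move=> hB he hF; have [M [cell hcell]] := @cell_map I B e hB he.
have [a [b [hab hc]]] : exists a b : nat, (a < b)%nat /\ cell (F a) = cell (F b).
  pose N := #|{ffun I -> 'I_M}|.
  pose g (j : 'I_N.+1) := cell (F j).
  have /injectivePn [a [b hab e1]] : ~~ injectiveb g.
    by apply/negP => /injectiveP /leq_card; rewrite card_ord ltnn.
  by case: (ltngtP a b) => h; [exists a, b | exists b, a | case/eqP: hab; exact: val_inj].
by exists a, b; split => // i; apply: hcell.
Qed.

Section Rotations.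
Variable d : nat.
Implicit Types (x y z u v w : Point d) (A B M : Mat d).

Definition vadd x y : Point d := fun i => x i + y i.

Lemma mat_ext A B : (forall x, mat_apply A x = mat_apply B x) -> A = B.
Proof.
move=> h; apply: functional_extensionality => i; apply: functional_extensionality => j.
have e : forall C : Mat d, mat_apply C (fun k => if k == j then 1 else 0) i = C i j.
  move=> C; rewrite /mat_apply (bigD1 j) //= eqxx big1 => [|k /negbTE ->]; first by lra.
  by lra.
by rewrite -e h e.
Qed.

Lemma orth_apply M x : orth M -> mat_apply (mat_tr M) (mat_apply M x) = x.
Proof. by move=> h; rewrite -mat_apply_mul h mat_apply_id. Qed.

Lemma mat_trK M : mat_tr (mat_tr M) = M. Proof. by []. Qed.

Lemma orth_apply_tr M x : orth M -> mat_apply M (mat_apply (mat_tr M) x) = x.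
Proof. by move=> /orth_mat_tr /(orth_apply x). Qed.

Lemma orth_dot M x y : orth M -> dot (mat_apply M x) (mat_apply M y) = dot x y.
Proof. by move=> h; rewrite dot_mat_apply orth_apply. Qed.

Lemma orth_nrm M x : orth M -> nrm (mat_apply M x) = nrm x.
Proof. by move=> h; rewrite /nrm orth_dot. Qed.

Lemma orth_dist M x y : orth M -> dist (mat_apply M x) (mat_apply M y) = dist x y.
Proof. by move=> h; rewrite !dist_nrm -mat_apply_vsub orth_nrm. Qed.

Lemma orth_mul A B : orth A -> orth B -> orth (mat_mul A B).
Proof.
move=> hA hB; apply: mat_ext => x; rewrite mat_apply_id.
have -> : mat_tr (mat_mul A B) = mat_mul (mat_tr B) (mat_tr A).
  apply: functional_extensionality => i; apply: functional_extensionality => j.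
  by rewrite /mat_tr /mat_mul; apply: eq_bigr => k _; lra.
by rewrite !mat_apply_mul orth_apply // orth_apply.
Qed.

Definition reflection (c : R) w : Mat d := fun i j => mat_id i j - c * w i * w j.

Lemma reflection_apply c w x i :
  mat_apply (reflection c w) x i = x i - c * dot w x * w i.
Proof.
have -> : x i = mat_apply mat_id x i by rewrite mat_apply_id.
rewrite /mat_apply [dot w x]/dot big_distrr big_distrl /=.
rewrite /Rminus -sumR_opp -big_split; apply: eq_bigr => j _ /=.
by rewrite /reflection; lra.
Qed.

Lemma dot_vaddr u x y : dot u (vadd x y) = dot u x + dot u y.
Proof. by rewrite /dot -big_split; apply: eq_bigr => i _ /=; rewrite /vadd; lra. Qed.

Lemma dot_vaddl u x y : dot (vadd x y) u = dot x u + dot y u.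
Proof. by rewrite dotC dot_vaddr !(dotC u). Qed.

Lemma reflection_orth c w : c * dot w w = 2 -> orth (reflection c w).
Proof.
move=> hc; apply: mat_ext => x; rewrite mat_apply_id mat_apply_mul.
have -> : mat_tr (reflection c w) = reflection c w.
  apply: functional_extensionality => i; apply: functional_extensionality => j.
  by rewrite /mat_tr /reflection /mat_id eq_sym; lra.
apply: functional_extensionality => i; rewrite !reflection_apply.
have -> : mat_apply (reflection c w) x = vsub x (scal (c * dot w x) w).
  by apply: functional_extensionality => k; rewrite reflection_apply.
rewrite dot_vsubr dot_scalr.
have -> : c * (dot w x - c * dot w x * dot w w) = c * dot w x - c * dot w x * (c * dot w w) by lra.
by rewrite hc; lra.
Qed.

(* [S] is the rotation by half the angle from [v] to [u] in their plane,
   a product of two reflections; squaring it gets rid of the sign of its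
   determinant. *)
Lemma SOd_transitive u v : unit_vec u -> unit_vec v -> 0 <= dot u v ->
  exists Q, SOd Q /\ mat_apply Q v = u.
Proof.
rewrite /unit_vec => hu hv h0.
pose k := sqrt ((1 + dot u v) / 2).
have hk2 : k * k = (1 + dot u v) / 2 by apply: sqrt_sqrt; lra.
have hk : 0 < k by apply: sqrt_lt_R0; lra.
pose w := scal (/ (2 * k)) (vadd v u).
have euv : dot u v = 2 * (k * k) - 1 by lra.
have hvw : dot v w = k.
  by rewrite dot_scalr dot_vaddr hv (dotC v u) euv; field; lra.
have hww : dot w w = 1.
  rewrite dot_scalr dot_scall dot_vaddr !dot_vaddl hu hv (dotC v u) euv; field; lra.
pose c := / (1 + k).
pose S := mat_mul (reflection c (vadd v w)) (reflection 2 v).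
have hS : orth S.
  apply: orth_mul; apply: reflection_orth; last by lra.
  rewrite dot_vaddr !dot_vaddl hv hww (dotC w v) hvw /c; field; lra.
have eS : forall x i, mat_apply S x i =
    x i - 2 * dot v x * v i - c * (dot v x + dot w x - 2 * dot v x * (1 + k)) * (v i + w i).
  move=> x i; rewrite mat_apply_mul reflection_apply reflection_apply.
  have -> : mat_apply (reflection 2 v) x = vsub x (scal (2 * dot v x) v).
    by apply: functional_extensionality => j; rewrite reflection_apply.
  rewrite dot_vsubr dot_scalr !dot_vaddl hv (dotC w v) hvw /vadd; ring.
have eSv : mat_apply S v = w.
  apply: functional_extensionality => i; rewrite eS hv (dotC w v) hvw /c; field; lra.
exists (mat_mul S S); split; first exact: SOd_sq.
rewrite mat_apply_mul eSv; apply: functional_extensionality => i.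
rewrite eS hww hvw /c /w /scal /vadd; field; lra.
Qed.

Definition near_maps (e : R) (F G : Point d -> Point d) :=
  forall x, dist (F x) (G x) <= e * nrm x.

Lemma iter_orth_dist M n x y : orth M ->
  dist (iter n (mat_apply M) x) (iter n (mat_apply M) y) = dist x y.
Proof. by move=> h; elim: n => //= n IH; rewrite orth_dist. Qed.

Lemma iter_orth_nrm M n x : orth M -> nrm (iter n (mat_apply M) x) = nrm x.
Proof. by move=> h; elim: n => //= n IH; rewrite orth_nrm. Qed.

Lemma iter_linear M n x i :
  iter n (mat_apply M) x i =
  \big[Rplus/0]_(j < d) (x j * iter n (mat_apply M) (fun k => if k == j then 1 else 0) i).
Proof.
elim: n i => [|n IH] i /=.
  rewrite (bigD1 i) //= eqxx big1 => [|j]; first by lra.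
  by rewrite eq_sym => /negbTE ->; lra.
have e : forall y i, mat_apply M y i = \big[Rplus/0]_(j < d) (M i j * y j) by [].
rewrite e.
transitivity (\big[Rplus/0]_(j < d) \big[Rplus/0]_(k < d) (M i j * (x k *
    iter n (mat_apply M) (fun k0 => if k0 == k then 1 else 0) j))).
  by apply: eq_bigr => j _; rewrite -big_distrr /= -IH.
rewrite exchange_big /=; apply: eq_bigr => j _; rewrite e big_distrr /=.
by apply: eq_bigr => k _; lra.
Qed.

(** By recurrence two powers M^a and M^b with a < b almost agree, so M^(b-a) is close to the
    identity and M^(b-a-1) to the inverse of M. Words only provide positive products, and this is
    how inverses are recovered. *)
Lemma orth_power_near_tr M e : orth M -> 0 < e ->
  exists n : nat, near_maps e (iter n (mat_apply M)) (mat_apply (mat_tr M)).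
Proof.
move=> hM he.
pose F (n : nat) (ij : 'I_d * 'I_d) :=
  iter n (mat_apply M) (fun k => if k == ij.2 then 1 else 0) ij.1.
have hB : forall n ij, Rabs (F n ij) <= 1.
  move=> n [i j]; apply: Rle_trans (coord_le _ _) _; rewrite iter_orth_nrm //=.
  rewrite /nrm /dot (bigD1 j) //= eqxx big1 => [|k /negbTE ->]; last by lra.
  rewrite Rmult_1_r Rplus_0_r sqrt_1; lra.
(* One factor [d] comes from the expansion in the standard basis, the other from [dist_le_sum]; the
   1 keeps [c] positive. *)
pose c := INR d * INR d + 1.
have hd := pos_INR d.
have hc : 0 < c by rewrite /c; nra.
have [a [b [hab hF]]] := bounded_recurrence (e := e / c) Rle_0_1 (Rdiv_lt_0_compat _ _ he hc) hB.
exists (b - a).-1 => x.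
have h1 : dist (iter a (mat_apply M) x) (iter b (mat_apply M) x) <= e * nrm x.
  have hx := nrm_ge0 x.
  apply: Rle_trans (dist_le_sum (e := INR d * (e / c * nrm x)) _) _; last first.
    have -> : INR d * (INR d * (e / c * nrm x)) = e * nrm x * ((INR d * INR d) / c).
      by field; lra.
    have : INR d * INR d / c <= 1.
      by apply: (Rmult_le_reg_r c) => //; rewrite /Rdiv Rmult_assoc Rinv_l /c; nra.
    have : 0 <= e * nrm x by nra.
    move: (e * nrm x) (INR d * INR d / c) => s t hs ht; nra.
  move=> i; rewrite (iter_linear M a) (iter_linear M b) /Rminus -sumR_opp -big_split /=.
  apply: (Rle_trans _ (\big[Rplus/0]_(j < d) (e / c * nrm x))); last first.
    by rewrite -big_enum sumR_const size_enum_ord; lra.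
  apply: (Rle_trans _ (\big[Rplus/0]_(j < d) Rabs (x j * F a (i, j) + - (x j * F b (i, j))))).
    exact: sumR_abs.
  apply: sumR_le => j _ _.
  have -> : x j * F a (i, j) + - (x j * F b (i, j)) = x j * (F a (i, j) - F b (i, j)) by lra.
  rewrite Rabs_mult Rmult_comm; apply: Rmult_le_compat; try exact: Rabs_pos.
    exact: hF.
  exact: coord_le.
have e1 : b = (a + (b - a).-1.+1)%nat by lia.
move: (b - a).-1 e1 => k e1.
move: h1; rewrite e1 iterD iter_orth_dist // iterS => h1.
by rewrite -(orth_dist _ _ hM) orth_apply_tr // distC.
Qed.

End Rotations.

(** * Cylinders and the open set condition *)

(* [rmin], [rmax] and [diam] are arbitrary bounds, not necessarily attained. *)
Record self_similar (d : nat) := SelfSimilar {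
  alpha : nat;
  ratio : 'I_alpha -> R;
  rota : 'I_alpha -> Mat d;
  shift : 'I_alpha -> Point d;
  att : Point d -> Prop;
  rmin : R;
  rmax : R;
  diam : R;
  rmin_gt0 : 0 < rmin;
  rmin_le : forall i, rmin <= ratio i;
  le_rmax : forall i, ratio i <= rmax;
  rmax_lt1 : rmax < 1;
  rota_orth : forall i, orth (rota i);
  diam_ge1 : 1 <= diam;
  att_nonempty : exists x, att x;
  att_closed : is_closed att;
  att_diam : forall x y, att x -> att y -> dist x y <= diam;
  att_fixed : forall y, att y <-> exists i, exists x, att x /\
    y = (fun j => ratio i * mat_apply (rota i) x j + shift i j)
}.

Definition wprod (T : Type) (g : T -> R) (w : seq T) : R := foldr (fun i t => g i * t) 1 w.

Lemma wprod_cat (T : Type) (g : T -> R) w1 w2 :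
  wprod g (w1 ++ w2) = wprod g w1 * wprod g w2.
Proof. elim: w1 => [|i w1 IH] /=; [lra | rewrite IH; lra]. Qed.

Lemma wprod_gt0 (T : Type) (g : T -> R) w : (forall i, 0 < g i) -> 0 < wprod g w.
Proof. move=> h; elim: w => [|i w IH] /=; [lra | have := h i; nra]. Qed.

Lemma wprod_le (T : Type) (g h : T -> R) w :
  (forall i, 0 <= g i <= h i) -> 0 <= wprod g w <= wprod h w.
Proof. move=> hg; elim: w => [|i w IH] /=; [lra | have := hg i; nra]. Qed.

Lemma wprod_le_pow (T : Type) (g : T -> R) c w :
  (forall i, 0 <= g i <= c) -> 0 <= wprod g w <= c ^ size w.
Proof. move=> hg; elim: w => [|i w IH] /=; [lra | have := hg i; nra]. Qed.

Lemma pow_wprod_le (T : Type) (g : T -> R) c w : 0 <= c ->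
  (forall i, c <= g i) -> 0 <= c ^ size w <= wprod g w.
Proof. move=> hc hg; elim: w => [|i w IH] /=; [lra | have := hg i; nra]. Qed.

Section Cylinders.
Variables (d : nat) (S : self_similar d).
Notation letter := 'I_(alpha S).
Notation word := (seq letter).
Implicit Types (x y z u v : Point d) (i : letter) (w : word).

Lemma ratio_bounds i : 0 < ratio i < 1.
Proof. have := rmin_gt0 S; have := rmin_le i; have := le_rmax i; have := rmax_lt1 S; lra. Qed.

Definition smap i x : Point d := fun j => ratio i * mat_apply (rota i) x j + shift i j.
Definition wratio w := wprod (@ratio d S) w.
Definition wmap w x := foldr smap x w.
Definition wrot w x := foldr (fun i => mat_apply (rota i)) x w.
(** The direction seen from inside the cylinder [w]: [dot v (wmap w x)] equals
    [wratio w * dot (wdir v w) x] up to a constant. *)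
Definition wdir v w := foldl (fun u i => mat_apply (mat_tr (rota i)) u) v w.

Lemma wratio_cat w1 w2 : wratio (w1 ++ w2) = wratio w1 * wratio w2.
Proof. exact: wprod_cat. Qed.
Lemma wratio_gt0 w : 0 < wratio w.
Proof. by apply: wprod_gt0 => i; case: (ratio_bounds i). Qed.
Lemma wratio_le_rmax w : wratio w <= rmax S ^ size w.
Proof.
have [] // := @wprod_le_pow _ (@ratio d S) (rmax S) w.
by move=> i; have := ratio_bounds i; have := le_rmax i; lra.
Qed.

Lemma rmax_gt0 : 0 < rmax S.
Proof.
have [y /att_fixed [i _]] := att_nonempty S.
have := ratio_bounds i; have := le_rmax i; lra.
Qed.

Lemma rmin_lt1 : rmin S < 1.
Proof.
have [y /att_fixed [i _]] := att_nonempty S.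
have := ratio_bounds i; have := rmin_le i; lra.
Qed.

Lemma wmap_cat w1 w2 x : wmap (w1 ++ w2) x = wmap w1 (wmap w2 x).
Proof. exact: foldr_cat. Qed.
Lemma wdir_cat v w1 w2 : wdir v (w1 ++ w2) = wdir (wdir v w1) w2.
Proof. exact: foldl_cat. Qed.

Lemma dot_smap v i x y : dot v (smap i x) - dot v (smap i y) =
  ratio i * (dot (mat_apply (mat_tr (rota i)) v) x - dot (mat_apply (mat_tr (rota i)) v) y).
Proof.
rewrite -!dot_vsubr.
have -> : vsub (smap i x) (smap i y) = scal (ratio i) (mat_apply (rota i) (vsub x y)).
  rewrite mat_apply_vsub; apply: functional_extensionality => j.
  by rewrite /vsub /scal /smap; lra.
by rewrite dot_scalr dot_mat_apply mat_trK.
Qed.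

Lemma dot_wmap v w x y : dot v (wmap w x) - dot v (wmap w y) =
  wratio w * (dot (wdir v w) x - dot (wdir v w) y).
Proof.
elim: w v => [|i w IH] v /=; first by rewrite /wratio /=; lra.
by rewrite dot_smap IH /wratio /=; lra.
Qed.

Lemma smap_dist i x y : dist (smap i x) (smap i y) = ratio i * dist x y.
Proof.
rewrite !dist_nrm.
have -> : vsub (smap i x) (smap i y) = scal (ratio i) (mat_apply (rota i) (vsub x y)).
  rewrite mat_apply_vsub; apply: functional_extensionality => j.
  by rewrite /vsub /scal /smap; lra.
have [h _] := ratio_bounds i.
rewrite /nrm dot_scalr dot_scall (orth_dot _ _ (rota_orth i)) -Rmult_assoc.
by rewrite sqrt_mult ?sqrt_square; try lra; [nra | exact: dot_ge0].
Qed.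

Lemma wmap_dist w x y : dist (wmap w x) (wmap w y) = wratio w * dist x y.
Proof.
elim: w => [|i w IH] /=; first by rewrite /wratio /=; lra.
by rewrite smap_dist IH /wratio /=; lra.
Qed.

Lemma dist0 x y : dist x y = 0 -> x = y.
Proof.
move=> h; apply: functional_extensionality => j.
have := nrm0_coord j h; rewrite /vsub; lra.
Qed.

Lemma smap_inj i x y : smap i x = smap i y -> x = y.
Proof.
move=> h; apply: dist0; have := smap_dist i x y; rewrite h dist_xx.
have := ratio_bounds i; have := dist_ge0 x y; nra.
Qed.

Lemma smap_onto i y : exists x, smap i x = y.
Proof.
have [h _] := ratio_bounds i.
exists (mat_apply (mat_tr (rota i)) (scal (/ ratio i) (vsub y (shift i)))).
apply: functional_extensionality => j.
rewrite /smap orth_apply_tr; last exact: rota_orth.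
by rewrite /scal /vsub; field; lra.
Qed.

Lemma wmap_onto w y : exists x, wmap w x = y.
Proof.
elim: w y => [|i w IH] y; first by exists y.
have [z <-] := smap_onto i y; have [x <-] := IH z; by exists x.
Qed.

Lemma att_smap i x : att S x -> att S (smap i x).
Proof. by move=> h; apply/att_fixed; exists i, x. Qed.

Lemma att_wmap w x : att S x -> att S (wmap w x).
Proof. by move=> h; elim: w => //= i w IH; exact: att_smap. Qed.

Lemma wdir_dist u v w : dist (wdir u w) (wdir v w) = dist u v.
Proof.
elim: w u v => //= i w IH u v; rewrite IH orth_dist //.
exact: orth_mat_tr (rota_orth i).
Qed.

Lemma wdir_unit v w : unit_vec v -> unit_vec (wdir v w).
Proof.
elim: w v => //= i w IH v h; apply: IH.
by rewrite /unit_vec orth_dot //; exact: orth_mat_tr (rota_orth i).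
Qed.

Lemma wdir_wrot w u : wdir (wrot w u) w = u.
Proof. by elim: w u => //= i w IH u; rewrite (orth_apply _ (rota_orth i)) IH. Qed.

Lemma dot_wdir w u y : dot (wdir u w) y = dot u (wrot w y).
Proof. by elim: w u => //= i w IH u; rewrite IH dot_mat_apply mat_trK. Qed.

Lemma nrm_wrot w y : nrm (wrot w y) = nrm y.
Proof. by elim: w => //= i w IH; rewrite (orth_nrm _ (rota_orth i)). Qed.

Definition hits v w (a b : R) := exists x, att S x /\ a <= dot v (wmap w x) <= b.

Lemma hits_prefix v w1 w2 a b : hits v (w1 ++ w2) a b -> hits v w1 a b.
Proof.
by case=> x [hx h]; exists (wmap w2 x); rewrite -wmap_cat; split => //; exact: att_wmap.
Qed.

(** The interval is pulled back by the affine map that [w] induces on projections. Spread estimates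
    depend on an interval only through its length, so its position stays existential. *)
Lemma hits_rescale v w a b : exists a' b', b' - a' = (b - a) / wratio w /\
  forall w2, hits v (w ++ w2) a b <-> hits (wdir v w) w2 a' b'.
Proof.
have [x0 hx0] := att_nonempty S.
have h := wratio_gt0 w.
pose c := dot v (wmap w x0) - wratio w * dot (wdir v w) x0.
have hc : forall y, dot v (wmap w y) = wratio w * dot (wdir v w) y + c.
  by move=> y; have := dot_wmap v w y x0; rewrite /c; lra.
exists ((a - c) / wratio w), ((b - c) / wratio w); split; first by field; lra.
have hl : forall s t, s <= wratio w * t <-> s / wratio w <= t.
  move=> s t; split => hs.
    apply: (Rmult_le_reg_l (wratio w)) => //.
    have -> : wratio w * (s / wratio w) = s by field; lra.
    by [].
  have -> : s = wratio w * (s / wratio w) by field; lra.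
  by apply: Rmult_le_compat_l; lra.
have hr : forall s t, wratio w * t <= s <-> t <= s / wratio w.
  move=> s t; split => hs.
    apply: (Rmult_le_reg_l (wratio w)) => //.
    have -> : wratio w * (s / wratio w) = s by field; lra.
    by [].
  have -> : s = wratio w * (s / wratio w) by field; lra.
  by apply: Rmult_le_compat_l; lra.
move=> w2; split=> -[x [hx [h1 h2]]]; exists x; split => //.
  move: h1 h2; rewrite wmap_cat !hc => h1 h2.
  by split; [apply/hl; lra | apply/hr; lra].
rewrite wmap_cat !hc; move/hl: h1 => h1; move/hr: h2 => h2; lra.
Qed.

Lemma cylinder_near v w x y : unit_vec v -> att S x -> att S y ->
  Rabs (dot v (wmap w x) - dot v (wmap w y)) <= wratio w * diam S.
Proof.
move=> hv hx hy; apply: Rle_trans (dot_dist _ _ _) _.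
rewrite (nrm_unit hv) wmap_dist Rmult_1_l.
by apply: Rmult_le_compat_l; [exact: Rlt_le (wratio_gt0 w) | exact: att_diam].
Qed.

(** The coding of [y] is followed until the ratio first drops to [rho] or below; the last letter
    overshoots by a factor of at least [rmin S]. *)
Lemma att_refine rho w y : 0 < rho -> rho <= wratio w ->
  (exists x, att S x /\ y = wmap w x) ->
  exists w2, [/\ rmin S * rho <= wratio (w ++ w2), wratio (w ++ w2) <= rho &
    exists x, att S x /\ y = wmap (w ++ w2) x].
Proof.
move=> hrho; have h0 := rmin_gt0 S; have h1 := rmin_lt1.
have [n hn] : exists n : nat, rmax S ^ n < rho.
  have [|N hN] := @pow_lt_1_zero (rmax S) _ rho hrho.
    by rewrite Rabs_pos_eq; [exact: rmax_lt1 | exact: Rlt_le rmax_gt0].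
  exists N; have := hN N (le_n N); rewrite Rabs_pos_eq //.
  exact: pow_le (Rlt_le _ _ rmax_gt0).
(* [k] bounds the number of letters still to be added: a word of length [n] has ratio below
   [rho]. *)
have [k hk] : exists k, (n <= size w + k)%nat by exists n; lia.
elim: k w hk => [|k IH] w hk hw [x [hx ey]].
  have := wratio_le_rmax w.
  have : rmax S ^ size w <= rmax S ^ n.
    have -> : size w = (n + (size w - n))%nat by lia.
    rewrite pow_add; have := pow_lt _ n rmax_gt0.
    have : rmax S ^ (size w - n) <= 1.
      rewrite -(pow1 (size w - n)); apply: pow_incr; have := rmax_lt1 S; have := rmax_gt0; lra.
    by move: (rmax S ^ (size w - n)) (rmax S ^ n) => p q; nra.
  lra.
have /att_fixed [i [z [hz ez]]] := hx.
have e : y = wmap (rcons w i) z by rewrite -cats1 wmap_cat ey ez.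
have er : wratio (rcons w i) = wratio w * ratio i by rewrite -cats1 wratio_cat /wratio /=; lra.
case: (Rle_lt_dec rho (wratio (rcons w i))) => hle.
  have [||w2 [a1 a2 a3]] := IH (rcons w i) _ hle; first by rewrite size_rcons; lia.
    by exists z.
  by exists (i :: w2); rewrite -cat_rcons.
exists [:: i]; rewrite cats1; split; last by exists z.
  rewrite er; have := rmin_le i; have := ratio_bounds i; nra.
lra.
Qed.

End Cylinders.

(** After division by [rho], two points in a common cell of side [e / (INR d + 1)] are closer than
    [e], so rounding is injective on a separated family. The bound is the number of cells, the same
    for all [rho]. *)
Lemma packing (d : nat) (B e : R) : 0 <= B -> 0 < e -> exists C : nat,
  forall (rho : R) (T : eqType) (L : seq T) (c : T -> Point d), 0 < rho -> uniq L ->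
  {in L &, forall s t, dist (c s) (c t) < e * rho -> s = t} ->
  {in L &, forall s t, dist (c s) (c t) <= B * rho} -> (size L <= C)%nat.
Proof.
move=> hB he.
have hd := pos_INR d.
have he' : 0 < e / (INR d + 1) by apply: Rdiv_lt_0_compat; lra.
have [M [cell hcell]] := @cell_map 'I_d B _ hB he'.
exists #|{ffun 'I_d -> 'I_M}| => rho T L c hrho.
case: L => [//|t0 L]; move: (t0 :: L) (mem_head t0 L) => {}L ht0 hu hsep hbd.
pose x t := (fun i => (c t i - c t0 i) / rho).
have hx : forall t, t \in L -> forall i, Rabs (x t i) <= B.
  move=> t ht i; rewrite /x /Rdiv Rabs_mult (Rabs_pos_eq (/ rho)); last first.
    exact: Rlt_le (Rinv_0_lt_compat _ hrho).
  apply: (Rmult_le_reg_r rho) => //; rewrite Rmult_assoc Rinv_l; last by lra.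
  rewrite Rmult_1_r; apply: Rle_trans (hbd t t0 ht ht0).
  exact: (coord_le (vsub (c t) (c t0)) i).
rewrite -(size_map (fun t => cell (x t))).
have hu' : uniq [seq cell (x t) | t <- L].
  rewrite map_inj_in_uniq // => s t hs ht /(hcell _ _ (hx s hs) (hx t ht)) h.
  apply: hsep => //.
  apply: Rle_lt_trans (dist_le_sum (e := e / (INR d + 1) * rho) _) _ => [i|].
    have -> : c s i - c t i = (x s i - x t i) * rho by rewrite /x; field; lra.
    rewrite Rabs_mult (Rabs_pos_eq rho); last by lra.
    by apply: Rmult_le_compat_r; [lra | exact: h].
  have : INR d * (e / (INR d + 1)) < e.
    have {2}-> : e = (INR d + 1) * (e / (INR d + 1)) by field; lra.
    nra.
  nra.
by rewrite -(card_uniqP hu') max_card.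
Qed.

Lemma prefix_comparable (T : eqType) (a b c : seq T) :
  prefix a c -> prefix b c -> prefix a b || prefix b a.
Proof.
wlog h : a b / (size a <= size b)%nat.
  move=> H ha hb; case: (leqP (size a) (size b)) => h; first exact: H.
  by rewrite orbC; apply: H => //; exact: ltnW.
rewrite !prefixE => /eqP ha /eqP hb; apply/orP; left.
by rewrite -hb take_takel // ha.
Qed.

(** * Bounded overlap from the open set condition *)

Section Separation.
Variables (d : nat) (S : self_similar d).
Notation letter := 'I_(alpha S).
Notation word := (seq letter).

Definition open_set_condition := exists U : Point d -> Prop,
  (exists x, U x) /\ is_open U /\
  (forall (i : letter) x, U x -> U (smap i x)) /\
  (forall (i j : letter) x y, i <> j -> U x -> U y -> smap i x <> smap j y).

Definition antichain (L : seq word) := {in L &, forall w1 w2, prefix w1 w2 -> w1 = w2}.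

(** Each word is prolonged to size about [rho] without losing its marked point. The images of the
    open set under incomparable words are disjoint, so the images of the centre [u0] of a ball in it
    are [e * rmin S * rho] apart, while they stay within [D * rho] of the marked points; [packing]
    applies. *)
Lemma osc_antichain_bound (H : R) : open_set_condition -> 0 <= H ->
  exists C : nat, forall (rho : R) (L : seq word) (y : word -> Point d),
    0 < rho -> uniq L -> antichain L ->
    {in L, forall w, rho <= wratio w /\ exists x, att S x /\ y w = wmap w x} ->
    {in L &, forall w1 w2, dist (y w1) (y w2) <= H * rho} ->
    (size L <= C)%nat.
Proof.
move=> [U [[u0 hu0] [hopen [hU hdisj]]]] hH.
have [e [he hball]] := hopen u0 hu0.
have hmapU : forall (w : word) x, U x -> U (wmap w x).
  by move=> w x hx; elim: w => //= i w IH; exact: hU.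
have hdis : forall (w1 w2 : word) x y, ~~ prefix w1 w2 -> ~~ prefix w2 w1 ->
    U x -> U y -> wmap w1 x <> wmap w2 y.
  elim=> [|i w1 IH] [|j w2] x y //=.
  case: (eqVneq i j) => [<-|hij] h1 h2 hx hy.
    by move/smap_inj; apply: IH => //; move: h1 h2; rewrite ?eqxx.
  by apply: hdisj; [apply/eqP | exact: hmapU | exact: hmapU].
have [z0 hz0] := att_nonempty S.
(* The open set may be disjoint from the attractor, so its point [u0] is tied to the attractor by a
   distance only. *)
pose D := dist u0 z0 + diam S.
have hD0 : 0 <= D by have := dist_ge0 u0 z0; have := diam_ge1 S; rewrite /D; lra.
have hD : forall x, att S x -> dist u0 x <= D.
  move=> x hx; have := dist_triangle u0 z0 x; have := att_diam hz0 hx; rewrite /D; lra.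
have h0 := rmin_gt0 S.
have [C hC] := @packing d (H + 2 * D) (e * rmin S) ltac:(lra) ltac:(nra).
exists C => rho L y hrho hu hanti hL hdist.
have hext : forall w, exists w2, w \in L -> [/\ rmin S * rho <= wratio (w ++ w2),
    wratio (w ++ w2) <= rho & exists x, att S x /\ y w = wmap (w ++ w2) x].
  move=> w; case: (boolP (w \in L)) => hw; last by exists [::].
  by have [h1 h2] := hL w hw; have [w2 h3] := att_refine hrho h1 h2; exists w2.
have [ext hext'] := choice hext.
pose c w := wmap (w ++ ext w) u0.
have hcy : {in L, forall w, dist (c w) (y w) <= D * rho}.
  move=> w hw; have [h1 h2 [x [hx ->]]] := hext' w hw; rewrite wmap_dist.
  have := hD x hx; have := dist_ge0 u0 x; have := wratio_gt0 (w ++ ext w); nra.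
apply: (hC rho _ L c) => //.
- move=> s t hs ht hst.
  have [h1 h2 _] := hext' s hs; have [h3 h4 _] := hext' t ht.
  (* The centre of [t] is pulled back by [s]. If the centres are too close, this preimage lies in
     [U], and the images of [U] under the two words meet. *)
  have [z hz] := wmap_onto (s ++ ext s) (c t).
  have hUz : U z.
    apply: hball; apply: (Rmult_lt_reg_l (wratio (s ++ ext s))); first exact: wratio_gt0.
    rewrite -wmap_dist hz; apply: Rlt_le_trans hst _; nra.
  apply: contrapT => hne.
  have hne' : forall a b, a \in L -> b \in L -> a <> b ->
      ~~ prefix (a ++ ext a) (b ++ ext b).
    move=> a b ha hb hab; apply/negP => /catl_prefix hp.
    by case/orP: (prefix_comparable hp (prefix_prefix b (ext b))) => /hanti h; apply: hab;
      rewrite h.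
  have hp1 := hne' s t hs ht hne.
  have hp2 := hne' t s ht hs (nesym hne).
  exact: (hdis _ _ z u0 hp1 hp2 hUz hu0 hz).
- move=> s t hs ht; have a1 := hcy s hs; have a2 := hcy t ht; have a3 := hdist s t hs ht.
  have := dist_triangle (c s) (y s) (c t); have := dist_triangle (y s) (y t) (c t).
  rewrite (distC (y t)); lra.
Qed.

End Separation.

(** * Steering directions *)

Lemma fin_uniform_bound (T : finType) (P : T -> nat -> Prop) :
  (forall t, exists n, P t n) -> (forall t n k, (n <= k)%nat -> P t n -> P t k) ->
  exists n, forall t, P t n.
Proof.
move=> h hm; have [f hf] := choice h.
exists (\max_(t : T) f t)%nat => t; apply: hm (hf t); exact: leq_bigmax.
Qed.

Section Steering.
Variables (d : nat) (S : self_similar d).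
Notation letter := 'I_(alpha S).
Notation word := (seq letter).
Implicit Types (u v : Point d) (w : word).

(** Density of the semigroup: [wrot] involves no inverse rotations. *)
Definition dense_words := forall Q : Mat d, SOd Q -> forall e, 0 < e ->
  exists w, near_maps e (@wrot d S w) (mat_apply Q).

Lemma wrot_cat w1 w2 (x : Point d) : wrot (w1 ++ w2) x = wrot w1 (wrot w2 x).
Proof. exact: foldr_cat. Qed.

Lemma wrot_nseq n (i : letter) (x : Point d) :
  wrot (nseq n i) x = iter n (mat_apply (rota i)) x.
Proof. by elim: n => //= n ->. Qed.

(** Each inverse generator in a group element is replaced by a high positive power, through
    [orth_power_near_tr]. *)
Lemma dense_rotations_words (Rot : nat -> Mat d) : (forall i : letter, Rot i = rota i) ->
  dense_rotations (alpha S) Rot -> dense_words.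
Proof.
move=> hRot hdense Q hQ e he.
have hgen : forall g, gen_group (alpha S) Rot g ->
    forall e, 0 < e -> exists w, near_maps e (@wrot d S w) (mat_apply g).
  move=> g; elim=> {g}[|i g hi _ IH|i g hi _ IH] {}e {}he.
  - exists [::] => x; rewrite /= mat_apply_id dist_xx; have := nrm_ge0 x; nra.
  - have [w hw] := IH e he; exists (Ordinal hi :: w) => x.
    rewrite /= -hRot /= mat_apply_mul orth_dist ?hw //.
    by rewrite (hRot (Ordinal hi)); exact: rota_orth.
  - have [w hw] := IH (e / 2) ltac:(lra).
    have ho := rota_orth (Ordinal hi).
    have [n hn] := orth_power_near_tr ho (e := e / 2) ltac:(lra).
    exists (nseq n (Ordinal hi) ++ w) => x; rewrite wrot_cat wrot_nseq mat_apply_mul.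
    rewrite (hRot (Ordinal hi)).
    apply: Rle_trans (dist_triangle _ (mat_apply (mat_tr (rota (Ordinal hi))) (wrot w x)) _) _.
    have h1 := hn (wrot w x); rewrite nrm_wrot in h1.
    rewrite (orth_dist _ _ (orth_mat_tr ho)); have := hw x; lra.
have hd := pos_INR d.
have [g [hg hgQ]] := hdense Q hQ (e / 2 / (INR d * INR d + 1)) ltac:(apply: Rdiv_lt_0_compat; nra).
have [w hw] := hgen g hg (e / 2) ltac:(lra).
exists w => x; apply: Rle_trans (dist_triangle _ (mat_apply g x) _) _.
suff : dist (mat_apply g x) (mat_apply Q x) <= e / 2 * nrm x by have := hw x; lra.
have hx := nrm_ge0 x.
pose c := INR d * INR d + 1.
apply: Rle_trans (dist_le_sum (e := INR d * (e / 2 / c * nrm x)) _) _ => [i|]; last first.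
  have -> : INR d * (INR d * (e / 2 / c * nrm x)) = (e / 2 * nrm x) * ((INR d * INR d) / c).
    by field; rewrite /c; nra.
  have : INR d * INR d / c <= 1.
    have hc : 0 < c by rewrite /c; nra.
    by apply: (Rmult_le_reg_r c) => //; rewrite /Rdiv Rmult_assoc Rinv_l /c; nra.
  have : 0 <= e / 2 * nrm x by nra.
  move: (e / 2 * nrm x) (INR d * INR d / c) => s t hs ht; nra.
rewrite /mat_apply /Rminus -sumR_opp -big_split /=.
apply: Rle_trans (sumR_abs _ _) _.
have -> : INR d * (e / 2 / c * nrm x) = \big[Rplus/0]_(j < d) (e / 2 / c * nrm x).
  by rewrite -big_enum sumR_const size_enum_ord.
apply: sumR_le => j _ _.
have -> : g i j * x j + - (Q i j * x j) = (g i j - Q i j) * x j by lra.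
rewrite Rabs_mult; apply: Rmult_le_compat; try exact: Rabs_pos.
  exact: Rlt_le (hgQ i j).
exact: coord_le.
Qed.

(* Up to sign, because [proj] does not see the orientation of [v] and no
   rotation swaps the two unit vectors of a line when [d = 1]. *)
Lemma steering u e : dense_words -> unit_vec u -> 0 < e -> exists Z : nat,
  forall v, unit_vec v -> exists w, (size w <= Z)%nat /\
    (dist (wdir v w) u <= e \/ dist (wdir v w) (scal (-1) u) <= e).
Proof.
move=> hdense hu he.
have hd := pos_INR d.
pose goal e v w := dist (wdir v w) u <= e \/ dist (wdir v w) (scal (-1) u) <= e.
have hone : forall v, unit_vec v -> exists w, goal (e / 2) v w.
  move=> v hv.
  have huu : unit_vec (scal (-1) u).
    by rewrite /unit_vec dot_scalr dot_scall (_ : dot u u = 1) //; lra.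
  have aux : forall u', unit_vec u' -> 0 <= dot v u' -> exists w, dist (wdir v w) u' <= e / 2.
    move=> u' hu' h0.
    have [Q [hQ hQv]] := SOd_transitive hv hu' h0.
    have [w hw] := hdense Q hQ (e / 2) ltac:(lra).
    exists w; rewrite -(wdir_wrot w u') wdir_dist distC.
    by have := hw u'; rewrite hQv (nrm_unit hu') Rmult_1_r.
  case: (Rle_lt_dec 0 (dot v u)) => h0.
    by have [w hw] := aux u hu h0; exists w; left.
  have [|w hw] := aux _ huu; first by rewrite dot_scalr; lra.
  by exists w; right.
(* Rotations preserve distances, so a word that steers one vector of a small cell to within [e / 2]
   steers the whole cell to within [e]. Finitely many cells give the common length [Z]. *)
have he' : 0 < e / 2 / (INR d + 1) by apply: Rdiv_lt_0_compat; lra.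
have [M [cell hcell]] := @cell_map 'I_d 1 _ Rle_0_1 he'.
have hcoord : forall v, unit_vec v -> forall i, Rabs (v i) <= 1.
  by move=> v hv i; rewrite -(nrm_unit hv); exact: coord_le.
have [||Z hZ] := @fin_uniform_bound _ (fun (c : {ffun 'I_d -> 'I_M}) Z =>
    forall v, unit_vec v -> cell v = c -> exists w, (size w <= Z)%nat /\ goal e v w).
- move=> c; case: (EM (exists v, unit_vec v /\ cell v = c)) => [[v0 [hv0 hc]]|hno].
    have [w hw] := hone v0 hv0; exists (size w) => v hv hcv; exists w; split => //.
    have hvv : dist (wdir v w) (wdir v0 w) <= e / 2.
      rewrite wdir_dist.
      apply: Rle_trans (dist_le_sum (e := e / 2 / (INR d + 1)) _) _.
        by apply: hcell; [exact: hcoord | exact: hcoord | rewrite hcv hc].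
      have {2}-> : e / 2 = (INR d + 1) * (e / 2 / (INR d + 1)) by field; lra.
      nra.
    by case: hw => hw; [left | right]; apply: Rle_trans (dist_triangle _ (wdir v0 w) _) _; lra.
  by exists 0%nat => v hv hc; case: hno; exists v.
- move=> c n k hnk h v hv hc; have [w [h1 h2]] := h v hv hc; exists w; split => //.
  exact: leq_trans hnk.
by exists Z => v hv; have [w hw] := hZ _ v hv erefl; exists w.
Qed.

End Steering.

(** * Stopping-time cut sets *)

Section Words.
Variables (T : eqType) (A : seq T).

Fixpoint words_of k : seq (seq T) :=
  if k is k'.+1 then [seq b :: w | b <- A, w <- words_of k'] else [:: [::]].

Lemma sum_words_ofS k (F : seq T -> R) :
  \big[Rplus/0]_(w <- words_of k.+1) F w =
  \big[Rplus/0]_(b <- A) \big[Rplus/0]_(w <- words_of k) F (b :: w).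
Proof. by rewrite /= big_allpairs_dep. Qed.

Lemma mem_words_ofS k b w : (b :: w \in words_of k.+1) = (b \in A) && (w \in words_of k).
Proof.
apply/allpairsP/andP => [[[c x] /= [hc hx [-> ->]]] //|[hb hw]].
by exists (b, w).
Qed.

Lemma mem_words_ofP k w : w \in words_of k.+1 ->
  exists b w', [/\ w = b :: w', b \in A & w' \in words_of k].
Proof. by case/allpairsP=> -[b x] /= [hb hx ->]; exists b, x. Qed.

Lemma uniq_words_of k : uniq A -> uniq (words_of k).
Proof.
move=> hA; elim: k => [//|k IH]; apply: allpairs_uniq => //.
by move=> [a x] [b y] _ _ /= [-> ->].
Qed.

Lemma sum_wprod_words_of (p : T -> R) k :
  \big[Rplus/0]_(b <- A) p b = 1 -> \big[Rplus/0]_(w <- words_of k) wprod p w = 1.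
Proof.
move=> h; elim: k => [|k IH]; first by rewrite big_seq1.
rewrite sum_words_ofS -{}h; apply: eq_bigr => b _.
by rewrite /= -big_distrr /= IH Rmult_1_r.
Qed.

End Words.

Section Cut.
Variables (d : nat) (S : self_similar d).
Notation letter := 'I_(alpha S).
Notation word := (seq letter).
Variable p : letter -> R.
Hypotheses (p_gt0 : forall i, 0 < p i) (p_sum : \big[Rplus/0]_(i : letter) p i = 1).

(** [rho] is the target size relative to the current cylinder and [n] is fuel. When
    [rmax S ^ n <= rho], fuel ends only where [rho] has reached 1, so that the recursion stops at
    the right size; total weight 1 holds for any fuel. *)
Fixpoint cut n (rho : R) : seq word :=
  if n is n'.+1 then
    if Rle_dec 1 rho then [:: [::]]
    else flatten [seq [seq i :: w | w <- cut n' (rho / ratio i)] | i <- enum 'I_(alpha S)]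
  else [:: [::]].

Lemma sum_cutS n rho (P : pred word) (F : word -> R) : rho < 1 ->
  \big[Rplus/0]_(w <- cut n.+1 rho | P w) F w =
  \big[Rplus/0]_(i : letter) \big[Rplus/0]_(w <- cut n (rho / ratio i) | P (i :: w)) F (i :: w).
Proof.
move=> h; rewrite [cut n.+1 rho]/=; case: (Rle_dec 1 rho) => hr; first by lra.
rewrite big_flatten big_map big_enum; apply: eq_bigr => i _.
by rewrite big_map.
Qed.

Lemma cut_trivial n rho : 1 <= rho -> cut n rho = [:: [::]].
Proof. by move=> h; case: n => //= n; case: Rle_dec. Qed.

Lemma mem_cutS n rho w : rho < 1 -> w \in cut n.+1 rho ->
  exists i w', w = i :: w' /\ w' \in cut n (rho / ratio i).
Proof.
move=> /= h; case: (Rle_dec 1 rho) => hr; first by lra.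
by case/flatten_mapP => i _ /mapP [w' hw ->]; exists i, w'.
Qed.

Lemma sum_cut n rho : \big[Rplus/0]_(w <- cut n rho) wprod p w = 1.
Proof.
elim: n rho => [|n IH] rho; first by rewrite big_seq1.
case: (Rle_lt_dec 1 rho) => h; first by rewrite cut_trivial // big_seq1.
rewrite sum_cutS // -p_sum; apply: eq_bigr => i _.
by rewrite /= -big_distrr /= IH Rmult_1_r.
Qed.

(** The range up to [/ rmin S] is what the induction needs: dividing some [rho < 1] by a ratio leads
    there. *)
Lemma cut_ratio n rho w : 0 < rho -> rho <= / rmin S -> rmax S ^ n <= rho ->
  w \in cut n rho -> rmin S * rho <= wratio w <= rho.
Proof.
have h0 := rmin_gt0 S.
have triv : forall rho, rho <= / rmin S -> 1 <= rho -> rmin S * rho <= @wratio d S [::] <= rho.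
  move=> {}rho h1 h2; split => //.
  apply: (Rle_trans _ (rmin S * / rmin S)); first by apply: Rmult_le_compat_l; lra.
  rewrite Rinv_r /wratio /=; lra.
elim: n rho w => [|n IH] rho w hrho h1 h2; first by rewrite inE => /eqP ->; apply: triv.
case: (Rle_lt_dec 1 rho) => h3; first by rewrite cut_trivial // inE => /eqP ->; apply: triv.
move=> /(mem_cutS h3) [i [w' [-> hw']]].
have [hr hr1] := ratio_bounds i; have hr2 := rmin_le i; have hr3 := le_rmax i.
have hm := rmax_gt0 S.
have e : rho = ratio i * (rho / ratio i) by field; lra.
have hp : 0 < rho / ratio i by apply: Rdiv_lt_0_compat.
have := IH (rho / ratio i) w' hp _ _ hw'.
rewrite /wratio /= -/(wratio w') => hh.
have hhh : rmin S * (rho / ratio i) <= wratio w' <= rho / ratio i.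
  apply: hh.
    apply: (Rmult_le_reg_l (ratio i)) => //; rewrite -e.
    apply: (Rle_trans _ 1); first by lra.
    rewrite -(Rinv_r (rmin S)); last by lra.
    by apply: Rmult_le_compat_r => //; apply: Rlt_le; exact: Rinv_0_lt_compat.
  apply: (Rmult_le_reg_l (ratio i)) => //; rewrite -e.
  apply: Rle_trans h2; rewrite /=; apply: Rmult_le_compat_r => //.
  exact: pow_le (Rlt_le _ _ hm).
rewrite [in X in X /\ _]e [in X in _ /\ X]e; nra.
Qed.

Lemma cut_uniq n rho : uniq (cut n rho).
Proof.
elim: n rho => [//|n IH] rho.
case: (Rle_lt_dec 1 rho) => h; first by rewrite cut_trivial.
rewrite /=; case: (Rle_dec 1 rho) => hr; first by lra.
apply: (allpairs_uniq_dep (f := fun i w => i :: w)) => [|i _|]; [exact: enum_uniq | exact: IH |].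
by move=> [i x] [j y] _ _ /= [-> ->].
Qed.

Lemma cut_antichain n rho : antichain (cut n rho).
Proof.
elim: n rho => [|n IH] rho w1 w2; first by rewrite !inE => /eqP -> /eqP ->.
case: (Rle_lt_dec 1 rho) => h; first by rewrite cut_trivial // !inE => /eqP -> /eqP ->.
move=> /(mem_cutS h) [i [x [-> hx]]] /(mem_cutS h) [j [y [-> hy]]].
by rewrite prefix_cons => /andP[/eqP hij]; rewrite -hij in hy * => /(IH _ _ _ hx hy) ->.
Qed.

Lemma wprod_p_gt0 w : 0 < wprod p w. Proof. exact: wprod_gt0. Qed.

(** The cut words below [c] carry the whole weight of [c], or none if [c] properly extends a cut
    word. *)
Lemma sum_cut_prefix n rho c :
  \big[Rplus/0]_(w <- cut n rho | prefix c w) wprod p w <= wprod p c.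
Proof.
have triv : forall c, \big[Rplus/0]_(w <- [:: [::]] | prefix c w) wprod p w <= wprod p c.
  move=> {}c; rewrite big_mkcond big_seq1; case: c => [|i c] /=; first by lra.
  exact: Rlt_le (wprod_p_gt0 (i :: c)).
elim: n rho c => [|n IH] rho c; first exact: triv.
case: (Rle_lt_dec 1 rho) => h; first by rewrite cut_trivial.
case: c => [|j c].
  under eq_bigl => w do rewrite prefix0s.
  rewrite sum_cut /=; lra.
rewrite sum_cutS // (bigD1 j) //= [X in _ + X]big1 => [|i /negbTE hi]; last first.
  by rewrite big_pred0 // => w; rewrite eq_sym hi.
under eq_bigl => w do rewrite eqxx /=.
rewrite -big_distrr /= Rplus_0_r.
by apply: Rmult_le_compat_l; [exact: Rlt_le | exact: IH].
Qed.

(* Expectation of [f u_0 + ... + f u_(n-1)] along the random walk on directions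
   that moves from [u] to [R_i^T u] with probability [p i]. *)
Fixpoint time_sum (f : Point d -> R) n (u : Point d) : R :=
  if n is n'.+1 then
    f u + \big[Rplus/0]_(i : letter) (p i * time_sum f n' (wdir u [:: i]))
  else 0.

Section TimeSum.
Variable f : Point d -> R.
Hypothesis f_ge0 : forall u, 0 <= f u.

Lemma time_sum_ge0 n u : 0 <= time_sum f n u.
Proof.
elim: n u => [|n IH] u /=; first by lra.
apply: Rplus_le_le_0_compat => //.
by apply: sumR_ge0 => i _ _; apply: Rmult_le_pos; [exact: Rlt_le | exact: IH].
Qed.

Lemma time_sum_mono n k u : (n <= k)%nat -> time_sum f n u <= time_sum f k u.
Proof.
elim: n k u => [|n IH] [|k] u hnk //=; try lra; first exact: (time_sum_ge0 k.+1).
apply: Rplus_le_compat_l; apply: sumR_le => i _ _.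
by apply: Rmult_le_compat_l; [exact: Rlt_le | exact: IH].
Qed.

(** A strong Markov property: the walk restarts at the cut, reached after at most [n] letters, and
    the skipped terms are nonnegative. *)
Lemma cut_time_sum n rho N u :
  \big[Rplus/0]_(b <- cut n rho) (wprod p b * time_sum f N (wdir u b)) <= time_sum f (N + n) u.
Proof.
have triv : forall n u, wprod p [::] * time_sum f N (wdir u ([::] : word)) <= time_sum f (N + n) u.
  by move=> {}n {}u; rewrite /= Rmult_1_l; apply: time_sum_mono; lia.
elim: n rho u => [|n IH] rho u; first by rewrite big_seq1.
case: (Rle_lt_dec 1 rho) => h; first by rewrite cut_trivial // big_seq1.
rewrite sum_cutS // addnS /=.
apply: (Rle_trans _ (0 + \big[Rplus/0]_(i : letter) (p i * time_sum f (N + n) (wdir u [:: i]))));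
  last by apply: Rplus_le_compat_r.
rewrite Rplus_0_l; apply: sumR_le => i _ _.
apply: Rle_trans (Rmult_le_compat_l _ _ _ (Rlt_le _ _ (p_gt0 i)) (IH (rho / ratio i) _)).
by rewrite big_distrr /=; apply: Req_le; apply: eq_bigr => b _; lra.
Qed.

(** For [rho < 1] the cut uses at least one letter, so the term of the initial direction comes in
    addition. *)
Lemma cut_time_sumS n rho N u : rho < 1 -> f u +
  \big[Rplus/0]_(b <- cut n.+1 rho) (wprod p b * time_sum f N (wdir u b)) <=
  time_sum f (N + n.+1) u.
Proof.
move=> h; rewrite sum_cutS // addnS /=; apply: Rplus_le_compat_l.
apply: sumR_le => i _ _.
apply: Rle_trans (Rmult_le_compat_l _ _ _ (Rlt_le _ _ (p_gt0 i)) (cut_time_sum n (rho / ratio i) N _)).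
by rewrite big_distrr /=; apply: Req_le; apply: eq_bigr => b _; lra.
Qed.

End TimeSum.

End Cut.

(** * Mass and energy of the cut sets *)

Section Mass.
Variables (d : nat) (S : self_similar d).
Notation letter := 'I_(alpha S).
Notation word := (seq letter).
Variable p : letter -> R.
Hypotheses (p_gt0 : forall i, 0 < p i) (p_sum : \big[Rplus/0]_(i : letter) p i = 1).
Hypothesis p_le : forall i, p i <= ratio i.
Variable x0 : Point d.
Hypothesis x0_att : att S x0.

Lemma cut_refines n rho t (b : word) : rho <= t -> b \in cut S n rho ->
  exists2 c, c \in cut S n t & prefix c b.
Proof.
elim: n rho t b => [|n IH] rho t b hrt.
  by move=> hb; exists [::]; [exact: mem_head | exact: prefix0s].
case: (Rle_lt_dec 1 t) => ht.
  exists [::]; last exact: prefix0s.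
  rewrite cut_trivial //; exact: mem_head.
move=> /(@mem_cutS _ _ _ _ _ (Rle_lt_trans _ _ _ hrt ht)) [i [w [-> hw]]].
have [hr _] := ratio_bounds i.
have [|c hc hcw] := IH _ (t / ratio i) w _ hw.
  by apply: Rmult_le_compat_r => //; apply: Rlt_le; exact: Rinv_0_lt_compat.
exists (i :: c); last by rewrite prefix_cons eqxx.
rewrite /=; case: (Rle_dec 1 t) => h; first by lra.
by apply/flatten_mapP; exists i; rewrite ?mem_enum //; apply/mapP; exists c.
Qed.

Lemma wprod_le_ratio w : wprod p w <= wratio w.
Proof.
have [] // := @wprod_le _ p (@ratio d S) w.
by move=> i; have := p_gt0 i; have := p_le i; lra.
Qed.

(** The cylinders in question lie in cylinders of size about [t] close to [z]. There are boundedly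
    many of these, each of weight at most [wratio c <= t] because [p i <= ratio i]. *)
Lemma cut_mass : open_set_condition S -> exists C : R, 0 <= C /\
  forall n rho t z, 0 < rho -> rho <= t -> rmax S ^ n <= rho ->
    \big[Rplus/0]_(b <- cut S n rho | `[< dist z (wmap b x0) <= t >]) wprod p b <= C * t.
Proof.
move=> hosc.
have h0 := rmin_gt0 S; have h1 := rmin_lt1 S.
(* Coarse cylinders have size at least [rmin S * t], and their marked points are at most [2 * t]
   apart. The 1 added to the bound below covers [t >= 1], where the total mass suffices. *)
have hH : 0 <= 2 / rmin S by apply: Rle_mult_inv_pos; lra.
have [C hC] := osc_antichain_bound hosc hH.
exists (INR C + 1); split; first by have := pos_INR C; lra.
move=> n rho t z hrho hrt hn.
set W := cut S n rho.
case: (Rle_lt_dec 1 t) => ht.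
  apply: (Rle_trans _ 1); last by have := pos_INR C; nra.
  rewrite -(sum_cut p_sum n rho); apply: sumR_le_pred => // b _ _.
  exact: Rlt_le (wprod_p_gt0 p_gt0 b).
pose L := [seq c <- cut S n t | has (fun b => prefix c b && `[< dist z (wmap b x0) <= t >]) W].
have hy : forall c, exists b, c \in L -> [/\ b \in W, prefix c b & dist z (wmap b x0) <= t].
  move=> c; case: (boolP (c \in L)) => [|_]; last by exists [::].
  by rewrite mem_filter => /andP[/hasP [b hb /andP[h2 /asboolP h3]] _]; exists b.
have [f hf] := choice hy.
have hLr : {in L, forall c, rmin S * t <= wratio c <= t}.
  move=> c; rewrite mem_filter => /andP[_]; apply: cut_ratio; try lra.
  apply: (Rle_trans _ 1); first lra.
  by rewrite -Rinv_1; apply: Rinv_le_contravar; lra.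
have hsize : INR (size L) <= INR C.
  apply/le_INR/leP; apply: (hC (rmin S * t) L (fun c => wmap (f c) x0)).
  - nra.
  - by rewrite filter_uniq // cut_uniq.
  - move=> c c'; rewrite !mem_filter => /andP[_ hc] /andP[_ hc']; exact: cut_antichain hc hc'.
  - move=> c hc; split; first by have [] := hLr c hc.
    have [_ /prefixP [w ->] _] := hf c hc.
    by exists (wmap w x0); split; [exact: att_wmap | rewrite wmap_cat].
  - move=> c c' hc hc'; have [_ _ e1] := hf c hc; have [_ _ e2] := hf c' hc'.
    have -> : 2 / rmin S * (rmin S * t) = 2 * t by field; lra.
    apply: Rle_trans (dist_triangle _ z _) _; rewrite (distC _ z); lra.
apply: (Rle_trans _ (\big[Rplus/0]_(c <- L) \big[Rplus/0]_(b <- W | prefix c b) wprod p b)).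
  have -> : \big[Rplus/0]_(c <- L) \big[Rplus/0]_(b <- W | prefix c b) wprod p b =
      \big[Rplus/0]_(b <- W) \big[Rplus/0]_(c <- L | prefix c b) wprod p b.
    under eq_bigr => c _ do rewrite big_mkcond /=.
    by rewrite exchange_big; apply: eq_bigr => b _; rewrite -big_mkcond.
  rewrite big_mkcond /=; apply: sumR_le => b hb _.
  have hge : 0 <= \big[Rplus/0]_(c <- L | prefix c b) wprod p b.
    by apply: sumR_ge0 => c _ _; exact: Rlt_le (wprod_p_gt0 p_gt0 b).
  case: asboolP => // hd.
  have [c hc hcb] := cut_refines hrt hb.
  have hcL : c \in L.
    rewrite mem_filter hc andbT; apply/hasP; exists b => //.
    by rewrite hcb; apply/asboolP.
  rewrite big_mkcond /=.
  have := sumR_ge_term (F := fun c => if prefix c b then wprod p b else 0) hcL.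
  rewrite hcb; apply => c' _; case: ifP => _; last by lra.
  exact: Rlt_le (wprod_p_gt0 p_gt0 b).
apply: (Rle_trans _ (\big[Rplus/0]_(c <- L) t)).
  apply: sumR_le => c hc _; apply: Rle_trans (sum_cut_prefix p_gt0 p_sum _ _ _) _.
  by apply: Rle_trans (wprod_le_ratio c) _; have [] := hLr c hc.
rewrite sumR_const; nra.
Qed.

(* Dyadic decomposition in the distance from [z]: the scales [2 ^ j * rho]
   contribute equally, whence the factor [J + 1]. *)
Lemma energy_sum : open_set_condition S -> exists C : R, 0 <= C /\
  forall n rho (J : nat) z kappa (G : word -> R), 0 < rho -> rmax S ^ n <= rho -> 1 <= kappa ->
    (forall b, b \in cut S n rho -> [/\ 0 <= G b <= 1,
      G b * dist z (wmap b x0) <= kappa * rho & dist z (wmap b x0) <= 2 ^ J * rho]) ->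
    \big[Rplus/0]_(b <- cut S n rho) (wprod p b * G b) <= C * (kappa * INR J.+1 * rho).
Proof.
move=> /cut_mass [C [hC hmass]]; exists (2 * C); split; first lra.
move=> n rho J z kappa G hrho hn hk hG.
set W := cut S n rho.
have h2 : forall j, 0 < 2 ^ j by move=> j; apply: pow_lt; lra.
apply: (Rle_trans _ (\big[Rplus/0]_(b <- W) \big[Rplus/0]_(j <- iota 0 J.+1)
    (2 * kappa * / 2 ^ j * (if `[< dist z (wmap b x0) <= 2 ^ j * rho >] then wprod p b else 0)))).
  apply: sumR_le => b hb _; have [h01 hGd hJ] := hG b hb.
  have hw := wprod_p_gt0 p_gt0 b.
  have [j [hjJ hj hmin]] : exists j, [/\ (j <= J)%nat, dist z (wmap b x0) <= 2 ^ j * rho &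
      forall i : nat, (i < j)%nat -> 2 ^ i * rho < dist z (wmap b x0)].
    have hex : exists j, `[< dist z (wmap b x0) <= 2 ^ j * rho >] by exists J; apply/asboolP.
    exists (ex_minn hex); case: ex_minnP => j /asboolP hj hm; split => //.
      by apply: hm; apply/asboolP.
    move=> i hi; apply: Rnot_le_lt => hle.
    by move: hi; rewrite ltnNge hm //; apply/asboolP.
  (* For positive [j] the distance exceeds half of [2 ^ j * rho], whence the factor 2; for [j = 0]
     it follows from [G b <= 1 <= kappa]. *)
  have hGj : G b <= 2 * kappa * / 2 ^ j.
    case: j hjJ hj hmin => [|j] hjJ hj hmin; first by rewrite /= Rinv_1; lra.
    have := hmin j (ltnSn j) => hlt.
    have hp := h2 j.
    apply: (Rmult_le_reg_r (2 ^ j * rho)); first nra.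
    have -> : 2 * kappa * / 2 ^ j.+1 * (2 ^ j * rho) = kappa * rho.
      by rewrite /=; field; lra.
    nra.
  have hj' : j \in iota 0 J.+1 by rewrite mem_iota add0n ltnS.
  have := sumR_ge_term (F := fun j => 2 * kappa * / 2 ^ j *
    (if `[< dist z (wmap b x0) <= 2 ^ j * rho >] then wprod p b else 0)) hj'.
  rewrite asboolT // => hh; apply: (Rle_trans _ (2 * kappa * / 2 ^ j * wprod p b)); first by nra.
  apply: hh => i _; have := Rinv_0_lt_compat _ (h2 i); move=> hi.
  by apply: Rmult_le_pos; [nra | case: asboolP => _; lra].
rewrite exchange_big.
apply: (Rle_trans _ (\big[Rplus/0]_(j <- iota 0 J.+1) (2 * C * (kappa * rho)))); last first.
  by rewrite sumR_const size_iota; apply: Req_le; ring.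
apply: sumR_le => j _ _; rewrite -big_distrr /= -big_mkcond /=.
have hp := h2 j.
have hjr : rho <= 2 ^ j * rho.
  have := pow_R1_Rle 2 j ltac:(lra); nra.
have := hmass n rho (2 ^ j * rho) z hrho hjr hn.
rewrite -/W; move: (\big[Rplus/0]_(b <- W | _) _) => s hs.
have := Rinv_0_lt_compat _ hp => hi.
apply: (Rle_trans _ (2 * kappa * / 2 ^ j * (C * (2 ^ j * rho)))).
  by apply: Rmult_le_compat_l => //; nra.
apply: Req_le; field; lra.
Qed.

End Mass.

(** * A grid of directions *)

Lemma sumR_indicator (T : finType) (P : pred T) :
  \big[Rplus/0]_(t : T) (if P t then 1 else 0) = INR #|P|.
Proof.
rewrite -big_mkcond; transitivity (\big[Rplus/0]_(t <- enum P) 1).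
  by rewrite big_enum; apply: eq_bigl.
by rewrite sumR_const cardE Rmult_1_r.
Qed.

Lemma count_in_interval N (P : pred 'I_N) (q B : R) : q <> 0 -> 0 <= B ->
  (forall k l, P k -> P l -> Rabs ((INR k - INR l) * q) <= B) ->
  INR #|P| * Rabs q <= B + Rabs q.
Proof.
move=> hq hB h.
have hq' : 0 < Rabs q by exact: Rabs_pos_lt.
case: (pickP P) => [k0 hk0|hno]; last first.
  have -> : #|P| = 0%nat by rewrite eq_card0.
  rewrite /=; lra.
case: (arg_minnP (fun k : 'I_N => val k) hk0) => a ha hmin.
case: (arg_maxnP (fun k : 'I_N => val k) hk0) => b hb hmax.
have hab : (a <= b)%nat by apply: hmax.
have hcard : (#|P| <= (b - a).+1)%nat.
  rewrite cardE -(size_map val) -(size_iota a (b - a).+1).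
  apply: uniq_leq_size; first by rewrite map_inj_uniq ?enum_uniq //; exact: val_inj.
  move=> x /mapP [k]; rewrite mem_enum => hk ->; rewrite mem_iota.
  have /= h1 := hmin k hk; have /= h2 := hmax k hk.
  by move: h1 h2 hab; move: (nat_of_ord a) (nat_of_ord b) (nat_of_ord k) => x1 x2 x3; lia.
have := h b a hb ha; rewrite -minus_INR; last exact/leP.
rewrite Rabs_mult (Rabs_pos_eq (INR _)); last exact: pos_INR.
have /leP /le_INR := hcard; rewrite S_INR.
have -> : Nat.sub b a = (b - a)%nat by [].
move: (INR #|P|) (INR (b - a)) => s t hs ht; nra.
Qed.

Section Resample.
Variables (I T : finType).

Definition upd (f : {ffun I -> T}) (i : I) (t : T) : {ffun I -> T} :=
  [ffun j => if j == i then t else f j].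

(** Resampling one coordinate preserves the uniform distribution: the involution [h] exchanges the
    new value with the discarded one. *)
Lemma sum_upd (F : {ffun I -> T} -> R) (i : I) :
  \big[Rplus/0]_f \big[Rplus/0]_(t : T) F (upd f i t) = INR #|T| * \big[Rplus/0]_f F f.
Proof.
pose h (z : {ffun I -> T} * T) := (upd z.1 i z.2, z.1 i).
have hK : involutive h.
  move=> [f t]; rewrite /h /=; congr pair; last by rewrite ffunE eqxx.
  by apply/ffunP => j; rewrite !ffunE; case: eqP => [->|].
rewrite pair_big /= (reindex_inj (inv_inj hK)) /=.
under eq_bigr => z _.
  have -> : upd (upd z.1 i z.2) i (z.1 i) = z.1.
    by have := hK z; rewrite {1}/h /=; case: z => f t /= -[-> _].
  over.
rewrite -(pair_big xpredT xpredT (fun f (_ : T) => F f)) /= big_distrr /=.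
apply: eq_bigr => f _; by rewrite -big_enum sumR_const -cardT.
Qed.

End Resample.

Section Grid.
Variable d : nat.

(** Coordinates run from 1 to [N], so the vector can be normalised. Directions in the positive
    orthant suffice for the average. *)
Definition grid_point N (th : {ffun 'I_d -> 'I_N}) : Point d := fun i => INR (th i).+1.
Definition grid_dir N (th : {ffun 'I_d -> 'I_N}) : Point d :=
  scal (/ nrm (grid_point th)) (grid_point th).

Lemma grid_nrm N (th : {ffun 'I_d -> 'I_N}) : (0 < d)%nat ->
  0 < nrm (grid_point th) <= INR d * INR N.
Proof.
move=> hd; split.
  have := coord_le (grid_point th) (Ordinal hd).
  have h : 0 < grid_point th (Ordinal hd) by apply: (lt_0_INR _.+1); lia.
  rewrite Rabs_pos_eq; lra.
apply: Rle_trans (nrm_le_sum _) _.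
have -> : INR d * INR N = \big[Rplus/0]_(j < d) INR N.
  by rewrite -big_enum sumR_const size_enum_ord.
apply: sumR_le => i _ _; rewrite Rabs_pos_eq; last exact: pos_INR.
by apply/le_INR/leP; exact: ltn_ord.
Qed.

Lemma grid_dir_unit N (th : {ffun 'I_d -> 'I_N}) : (0 < d)%nat -> unit_vec (grid_dir th).
Proof.
move=> hd; have [h _] := grid_nrm th hd.
rewrite /unit_vec dot_scalr dot_scall -nrm_sq; field; lra.
Qed.

(* Some coordinate of [y] is at least [nrm y / d]; resampling that coordinate of
   the grid point moves the scalar product at a definite speed. *)
Lemma grid_equidistributed N y tau : (0 < d)%nat -> (0 < N)%nat -> 0 <= tau ->
  INR #|[pred th : {ffun 'I_d -> 'I_N} | `[< Rabs (dot (grid_dir th) y) <= tau >]]| * nrm y <=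
  INR #|{ffun 'I_d -> 'I_N}| * (2 * INR d * INR d * tau + nrm y / INR N).
Proof.
move=> hd hN htau.
have hd' : 1 <= INR d by apply: (le_INR 1); lia.
have hN' : 1 <= INR N by apply: (le_INR 1); lia.
have hy0 := nrm_ge0 y.
have [j hj] : exists j, nrm y <= INR d * Rabs (y j).
  apply: contrapT => hno.
  have : nrm y < nrm y; last by lra.
  have hlt : forall j, Rabs (y j) * INR d < nrm y.
    by move=> j; apply: Rnot_le_lt => h; apply: hno; exists j; lra.
  apply: Rle_lt_trans (nrm_le_sum y) _.
  apply: (Rmult_lt_reg_l (INR d)); first lra.
  rewrite big_distrr /=.
  have -> : INR d * nrm y = \big[Rplus/0]_(j < d) nrm y.
    by rewrite -big_enum sumR_const size_enum_ord.
  rewrite (bigD1 (Ordinal hd)) //= [X in _ < X](bigD1 (Ordinal hd)) //=.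
  apply: Rplus_lt_le_compat; first by have := hlt (Ordinal hd); lra.
  by apply: sumR_le => i _ _; have := hlt i; lra.
case: (Req_dec (y j) 0) => hyj.
  have -> : nrm y = 0 by rewrite hyj Rabs_R0 in hj; lra.
  have := pos_INR #|{ffun 'I_d -> 'I_N}|; rewrite Rmult_0_r => h.
  apply: Rmult_le_pos => //; rewrite /Rdiv Rmult_0_l; nra.
set P := [pred th | _].
pose F th : R := if P th then 1 else 0.
have eF : INR #|P| = \big[Rplus/0]_th F th by rewrite sumR_indicator.
(* The bound [tau] for unit directions, multiplied by the largest norm of a grid point. The
   unnormalised scalar product is affine in each coordinate. *)
pose T := tau * (INR d * INR N).
have hT : 0 <= T by apply: Rmult_le_pos => //; nra.
have hfib : forall th, \big[Rplus/0]_(k : 'I_N) F (upd th j k) * nrm y <=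
    2 * INR d * T + nrm y.
  move=> th; rewrite sumR_indicator.
  set Q := (X in #|X|).
  have hc : INR #|Q| * Rabs (y j) <= 2 * T + Rabs (y j).
    apply: count_in_interval => // [|k l hk hl]; first lra.
    have hdot : forall k, Q k -> Rabs (dot (grid_point (upd th j k)) y) <= T.
      move=> k' /asboolP; rewrite /grid_dir dot_scall Rabs_mult.
      have [g1 g2] := grid_nrm (upd th j k') hd.
      rewrite Rabs_inv (Rabs_pos_eq (nrm _)); last by lra.
      move=> h; apply: (Rle_trans _ (tau * nrm (grid_point (upd th j k')))).
        apply: (Rmult_le_reg_l (/ nrm (grid_point (upd th j k')))).
          exact: Rinv_0_lt_compat.
        apply: Rle_trans h _; apply: Req_le; field; lra.
      by rewrite /T; apply: Rmult_le_compat_l.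
    have e : dot (grid_point (upd th j k)) y - dot (grid_point (upd th j l)) y =
        (INR k - INR l) * y j.
      rewrite -dot_vsubl /dot (bigD1 j) //= big1 => [|i /negbTE hi].
        by rewrite /vsub /grid_point !ffunE eqxx !S_INR; lra.
      by rewrite /vsub /grid_point !ffunE hi; lra.
    by rewrite -e; have := hdot k hk; have := hdot l hl; split_Rabs; lra.
  have := Rabs_pos_lt _ hyj; have := pos_INR #|Q|.
  move: (INR #|Q|) (Rabs (y j)) hc hj => q a; nra.
have hsum : INR #|P| * INR N * nrm y <=
    INR #|{ffun 'I_d -> 'I_N}| * (2 * INR d * T + nrm y).
  have := sum_upd F j; rewrite card_ord -eF => e.
  have -> : INR #|P| * INR N * nrm y = (INR N * INR #|P|) * nrm y by lra.
  rewrite -e big_distrl /=.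
  apply: (Rle_trans _ (\big[Rplus/0]_(th : {ffun 'I_d -> 'I_N}) (2 * INR d * T + nrm y))).
    by apply: sumR_le => th _ _; exact: hfib.
  by apply: Req_le; rewrite -big_enum sumR_const cardT.
apply: (Rmult_le_reg_r (INR N)); first lra.
apply: Rle_trans (Rle_trans _ _ _ _ hsum) _; first by lra.
apply: Req_le; rewrite /T; field; lra.
Qed.

End Grid.

(** * Time averages along directions *)

Lemma fin_pos_lower_bound (T : finType) (F : T -> R) : (forall t, 0 < F t) ->
  exists c, 0 < c <= 1 /\ forall t, c <= F t.
Proof.
move=> h.
have [c [hc hle]] : exists c, 0 < c <= 1 /\ {in enum T, forall t, c <= F t}.
  elim: (enum T) => [|t s [c [hc hle]]]; first by exists 1; split; [lra | ].
  exists (Rmin c (F t)); have := h t => ht; split.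
    by have := Rmin_glb_lt _ _ _ (proj1 hc) ht; have := Rmin_l c (F t); lra.
  move=> x; rewrite inE => /orP[/eqP ->|/hle hx]; first exact: Rmin_r.
  by have := Rmin_l c (F t); lra.
by exists c; split => // t; apply: hle; rewrite mem_enum.
Qed.

Section TimeAverages.
Variables (d : nat) (S : self_similar d).
Notation letter := 'I_(alpha S).
Notation word := (seq letter).
Implicit Types (u v : Point d) (w : word).
Variable p : letter -> R.
Hypotheses (p_gt0 : forall i, 0 < p i) (p_sum : \big[Rplus/0]_(i : letter) p i = 1).
Variable f : Point d -> R.
Hypothesis f_bounds : forall u, 0 <= f u <= 1.

Lemma time_sum_le n u : time_sum p f n u <= INR n.
Proof.
elim: n u => [|n IH] u; first by rewrite /=; lra.
rewrite S_INR /=; have := f_bounds u => h.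
apply: (Rle_trans _ (1 + \big[Rplus/0]_(i : letter) (p i * INR n))); last first.
  rewrite -big_distrl /= p_sum; lra.
apply: Rplus_le_compat; first lra.
by apply: sumR_le => i _ _; apply: Rmult_le_compat_l; [exact: Rlt_le | exact: IH].
Qed.

(** The two walks can use the same letters, and each letter applies the same isometry to both
    directions. *)
Lemma time_sum_lipschitz lam n u v : (forall u v, Rabs (f u - f v) <= lam * dist u v) ->
  Rabs (time_sum p f n u - time_sum p f n v) <= INR n * (lam * dist u v).
Proof.
move=> hl; elim: n u v => [|n IH] u v; first by rewrite /= Rminus_0_r Rabs_R0; lra.
rewrite S_INR [time_sum p f n.+1 u]/= [time_sum p f n.+1 v]/=.
set A := \big[Rplus/0]_i _; set B := \big[Rplus/0]_i _.
suff : Rabs (A - B) <= INR n * (lam * dist u v).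
  by have := hl u v; split_Rabs; lra.
rewrite /A /B /Rminus -sumR_opp -big_split /=; apply: Rle_trans (sumR_abs _ _) _.
apply: (Rle_trans _ (\big[Rplus/0]_(i : letter) (p i * (INR n * (lam * dist u v))))); last first.
  rewrite -big_distrl /= p_sum; lra.
apply: sumR_le => i _ _.
set x := time_sum _ _ _ _; set y := time_sum _ _ _ _.
have -> : p i * x + - (p i * y) = p i * (x - y) by lra.
rewrite Rabs_mult (Rabs_pos_eq (p i)); last exact: Rlt_le.
apply: Rmult_le_compat_l; first exact: Rlt_le.
apply: Rle_trans (IH _ _) _.
by rewrite (orth_dist _ _ (orth_mat_tr (rota_orth i))); lra.
Qed.

Lemma time_sum_opp n u : (forall u, f (scal (-1) u) = f u) ->
  time_sum p f n (scal (-1) u) = time_sum p f n u.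
Proof.
move=> h; elim: n u => [//|n IH] u /=; rewrite h; congr Rplus.
by apply: eq_bigr => i _; rewrite mat_apply_scal IH.
Qed.

(** A proportion [wprod p w] of the walks follows [w], which spends at most [size w]; a walk that
    leaves [w] continues from a unit vector and is bounded by [Y]. *)
Lemma time_sum_unroll n Y v w : (forall u, unit_vec u -> time_sum p f n u <= Y) ->
  unit_vec v -> time_sum p f n v <=
    INR (size w) + wprod p w * time_sum p f n (wdir v w) + (1 - wprod p w) * Y.
Proof.
move=> hY; elim: w v => [|i w IH] v hv; first by rewrite /=; lra.
have hf0 : forall u, 0 <= f u by move=> u; case: (f_bounds u).
apply: Rle_trans (time_sum_mono p_gt0 hf0 v (leqnSn n)) _.
have hi := IH (wdir v [:: i]) (wdir_unit [:: i] hv).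
pose A := \big[Rplus/0]_(j | j != i) (p j * time_sum p f n (wdir v [:: j])).
have -> : time_sum p f n.+1 v = f v + (p i * time_sum p f n (wdir v [:: i]) + A).
  by rewrite [LHS]/= (bigD1 i).
have hA : A <= (1 - p i) * Y.
  have -> : 1 - p i = \big[Rplus/0]_(j | j != i) p j by rewrite -p_sum (bigD1 i) //=; lra.
  rewrite big_distrl; apply: sumR_le => j _ _.
  apply: Rmult_le_compat_l; first exact: Rlt_le.
  by apply: hY; exact: (wdir_unit [:: j] hv).
have := f_bounds v; have := p_gt0 i => hp hfv.
have -> : INR (size (i :: w)) = INR (size w) + 1 by exact: S_INR.
rewrite -[wprod p (i :: w)]/(p i * wprod p w) -[wdir v (i :: w)]/(wdir (wdir v [:: i]) w).
have hp1 : p i <= 1.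
  by rewrite -p_sum; apply: sumR_ge_term => [|j _]; [exact: mem_index_enum | exact: Rlt_le].
have := Rmult_le_compat_l _ _ _ (Rlt_le _ _ hp) hi => hh.
have := pos_INR (size w) => hs; nra.
Qed.

(* From every direction a word of bounded length, hence of weight bounded below,
   leads close to one of finitely many directions with small time averages. *)
Lemma time_sum_uniform (T : finType) (V : T -> Point d) lam E : dense_words S ->
  (forall t, unit_vec (V t)) -> 0 <= lam -> 0 < E ->
  (forall u v, Rabs (f u - f v) <= lam * dist u v) ->
  (forall u, f (scal (-1) u) = f u) ->
  (forall n, exists t, time_sum p f n (V t) <= INR n * E) ->
  exists n0 : nat, forall n u, (n0 <= n)%nat -> unit_vec u ->
    time_sum p f n u <= INR n * (3 * E).
Proof.
move=> hdense hV hlam hE hlip hopp hn.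
have he : 0 < E / (lam + 1) by apply: Rdiv_lt_0_compat; lra.
have [||Z hZ] := @fin_uniform_bound T (fun t Z => forall v, unit_vec v ->
    exists w, (size w <= Z)%nat /\ (dist (wdir v w) (V t) <= E / (lam + 1) \/
      dist (wdir v w) (scal (-1) (V t)) <= E / (lam + 1))).
- by move=> t; apply: steering.
- move=> t n k hnk h v hv; have [w [h1 h2]] := h v hv; exists w; split => //.
  exact: leq_trans hnk.
have [pm [[hpm hpm1] hpmle]] := fin_pos_lower_bound p_gt0.
pose q := pm ^ Z.
have hq : 0 < q by exact: pow_lt.
(* Beyond [n0] the [Z] steering steps, divided by the probability [q] of steering, cost at most
   [INR n * E]. *)
have [n0 hn0] : exists n0 : nat, INR Z / (q * E) <= INR n0.
  have [n0 h] := INR_unbounded (INR Z / (q * E)); exists n0; lra.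
exists n0 => n u hnn hu.
have [t ht] := hn n.
have hn' : INR Z <= q * (INR n * E).
  have h1 : INR Z / (q * E) <= INR n by apply: Rle_trans hn0 _; apply/le_INR/leP.
  have -> : INR Z = INR Z / (q * E) * (q * E) by field; lra.
  have -> : q * (INR n * E) = INR n * (q * E) by lra.
  by apply: Rmult_le_compat_r => //; nra.
pose X x := exists v, unit_vec v /\ x = time_sum p f n v.
have [X0 [hub hlub]] : {m : R | is_lub X m}.
  apply: completeness; last by exists (time_sum p f n u), u.
  by exists (INR n) => x [v [_ ->]]; exact: time_sum_le.
have hX : forall v, unit_vec v -> time_sum p f n v <= X0.
  by move=> v hv; apply: hub; exists v.
apply: Rle_trans (hX u hu) _.
have hnE : 0 <= INR n * E by have := pos_INR n; nra.
(* In the second case the value after steering lies below the supremum [X0], so the weight of the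
   steering word may be replaced by its lower bound [q]. *)
case: (Rle_lt_dec X0 (INR n * (2 * E))) => hcmp; first by lra.
(* A self-improving inequality for the supremum: it gives [X0 <= INR Z / q + INR n * (2 * E)]. The
   three parts of [3 * E] are the good direction, the distance to it, and the steering. *)
have key : X0 <= INR Z + q * (INR n * (2 * E)) + (1 - q) * X0.
  apply: hlub => x [v [hv ->]].
  have [w [hw hd]] := hZ t v hv.
  have hdw : time_sum p f n (wdir v w) <= INR n * (2 * E).
    have hl : forall v', dist (wdir v w) v' <= E / (lam + 1) ->
        time_sum p f n v' <= INR n * E -> time_sum p f n (wdir v w) <= INR n * (2 * E).
      move=> v' h1 h2; have := time_sum_lipschitz n (wdir v w) v' hlip.
      have h3 : lam * dist (wdir v w) v' <= E.
        have -> : E = (lam + 1) * (E / (lam + 1)) by field; lra.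
        have := dist_ge0 (wdir v w) v'; nra.
      have := pos_INR n; move: (lam * _) h3 => a h3 hn3.
      have : INR n * a <= INR n * E by exact: Rmult_le_compat_l.
      by split_Rabs; lra.
    by case: hd => hd; apply: hl hd _; rewrite ?time_sum_opp.
  apply: Rle_trans (time_sum_unroll w hX hv) _.
  have hpw : q <= wprod p w.
    apply: (Rle_trans _ (pm ^ size w)).
      rewrite /q -(subnKC hw) pow_add -{2}(Rmult_1_r (pm ^ size w)).
      apply: Rmult_le_compat_l; first exact: pow_le (Rlt_le _ _ hpm).
      by rewrite -(pow1 (Z - size w)); apply: pow_incr; lra.
    by have [_] := pow_wprod_le w (Rlt_le _ _ hpm) hpmle.
  have := wprod_p_gt0 p_gt0 w; have : INR (size w) <= INR Z by apply/le_INR/leP.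
  move: (wprod p w) (time_sum p f n (wdir v w)) hpw hdw => pw L hpw hdw hs hpw0; nra.
nra.
Qed.

End TimeAverages.

(** * Spread-out weights at one scale *)

Lemma wprod_flatten (T : Type) (p : T -> R) (bs : seq (seq T)) :
  wprod p (flatten bs) = wprod (wprod p) bs.
Proof. by elim: bs => //= b bs IH; rewrite wprod_cat IH. Qed.

Section Blocks.
Variables (d : nat) (S : self_similar d).
Notation letter := 'I_(alpha S).
Notation word := (seq letter).
Implicit Types (u v : Point d) (w b : word) (bs : seq word).
Variable p : letter -> R.
Hypotheses (p_gt0 : forall i, 0 < p i) (p_sum : \big[Rplus/0]_(i : letter) p i = 1).
Variables (n : nat) (delta : R).
Hypotheses (delta_gt0 : 0 < delta) (delta_lt1 : delta < 1) (n_large : rmax S ^ n <= delta).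
Notation W := (cut S n delta).
Notation blocks := (words_of W).

Lemma W_ratio b : b \in W -> rmin S * delta <= wratio b <= delta.
Proof.
apply: cut_ratio => //; apply: (Rle_trans _ 1); first lra.
have := rmin_gt0 S; have := rmin_lt1 S => h1 h0.
by rewrite -Rinv_1; apply: Rinv_le_contravar; lra.
Qed.

Lemma blocks_ratio k bs : bs \in blocks k ->
  (rmin S * delta) ^ k <= wratio (flatten bs) <= delta ^ k.
Proof.
have h0 : 0 < rmin S * delta by have := rmin_gt0 S; nra.
elim: k bs => [|k IH] bs; first by rewrite inE => /eqP -> /=; rewrite /wratio /=; lra.
move=> /mem_words_ofP [b [bs' [-> /W_ratio hb /IH hbs]]] /=; rewrite wratio_cat.
have := pow_lt _ k h0; have := wratio_gt0 (flatten bs'); nra.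
Qed.

Lemma blocks_prefix k bs bs' : bs \in blocks k -> bs' \in blocks k ->
  prefix (flatten bs) (flatten bs') -> bs = bs'.
Proof.
elim: k bs bs' => [|k IH] bs bs'; first by rewrite !inE => /eqP -> /eqP ->.
move=> /mem_words_ofP [b [cs [-> hb hcs]]] /mem_words_ofP [b' [cs' [-> hb' hcs']]] /= hp.
have e : b = b'.
  have := prefix_comparable (catl_prefix hp) (prefix_prefix b' (flatten cs')).
  by case/orP => h; [|apply: esym]; apply: (@cut_antichain _ S n delta) h.
by move: hp; rewrite -e prefix_catr // eqxx /= => /(IH _ _ hcs hcs') ->.
Qed.

Variable bad : Point d -> word -> bool.

Fixpoint nbad u bs : nat :=
  if bs is b :: bs' then (bad u b + nbad (wdir u b) bs')%nat else 0%nat.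

Definition bad_mass u := \big[Rplus/0]_(b <- W) (if bad u b then wprod p b else 0).

Lemma bad_mass_ge0 u : 0 <= bad_mass u.
Proof.
apply: sumR_ge0 => b _ _; have := wprod_p_gt0 p_gt0 b; case: (bad u b) => h; lra.
Qed.

(** The block boundaries are among the first [k * n] times of the walk by single letters; [bad_mass]
    at the other times only adds to the right-hand side. *)
Lemma expected_nbad k u : (0 < n)%nat ->
  \big[Rplus/0]_(bs <- blocks k) (wprod (wprod p) bs * INR (nbad u bs)) <=
  time_sum p bad_mass (k * n) u.
Proof.
move=> hn; elim: k u => [|k IH] u; first by rewrite big_seq1 mul0n /=; lra.
rewrite sum_words_ofS mulSn addnC.
apply: (Rle_trans _ (\big[Rplus/0]_(b <- W) ((if bad u b then wprod p b else 0) +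
    wprod p b * time_sum p bad_mass (k * n) (wdir u b)))).
  apply: sumR_le => b _ _.
  have hb := wprod_p_gt0 p_gt0 b.
  apply: (Rle_trans _ (\big[Rplus/0]_(bs <- blocks k) (wprod (wprod p) bs * (wprod p b * INR (bad u b)) +
      wprod p b * (wprod (wprod p) bs * INR (nbad (wdir u b) bs))))).
    by apply: sumR_le => bs _ _ /=; rewrite plus_INR; lra.
  rewrite big_split -big_distrl -big_distrr /= sum_wprod_words_of; last exact: sum_cut.
  apply: Rplus_le_compat; last by apply: Rmult_le_compat_l; [lra | exact: IH].
  by case: (bad u b) => /=; lra.
rewrite big_split /=.
have := cut_time_sumS p_gt0 bad_mass_ge0 n.-1 (k * n) u delta_lt1.
by rewrite prednK.
Qed.

Variable lam : R.
Hypothesis lam_bounds : 0 < lam <= 1.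
Hypothesis good_mass : forall u x y, unit_vec u -> y - x <= rmin S * delta ->
  \big[Rplus/0]_(b <- W | `[< hits u b x y >] && ~~ bad u b) wprod p b <= lam.

(* Discounting each bad block by [lam] makes all blocks equally spread out, so
   no correlation between bad blocks and the interval has to be controlled. *)
Lemma discounted_mass k u x y : unit_vec u -> y - x <= (rmin S * delta) ^ k ->
  \big[Rplus/0]_(bs <- blocks k | `[< hits u (flatten bs) x y >])
    (wprod (wprod p) bs * lam ^ nbad u bs) <= (2 * lam) ^ k.
Proof.
have h0 : 0 < rmin S * delta < 1.
  by have := rmin_gt0 S; have := rmin_lt1 S; split; nra.
elim: k u x y => [|k IH] u x y hu hxy.
  by rewrite big_mkcond big_seq1 /=; case: asbool; lra.
have hpk := pow_lt _ k (proj1 h0).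
have hp2 : 0 < (2 * lam) ^ k by apply: pow_lt; lra.
have hp1 : (rmin S * delta) ^ k <= 1 by rewrite -(pow1 k); apply: pow_incr; lra.
rewrite big_mkcond sum_words_ofS.
(* The source of [2 * lam]: good blocks that hit the interval weigh at most [lam], and all blocks
   discounted by [lam] weigh [lam] again. *)
apply: (Rle_trans _ (\big[Rplus/0]_(b <- W) ((2 * lam) ^ k *
  ((if `[< hits u b x y >] && ~~ bad u b then wprod p b else 0) + lam * wprod p b)))).
  apply: sumR_le => b hb _.
  have hw := wprod_p_gt0 p_gt0 b.
  case: (asboolP (hits u b x y)) => hit; last first.
    rewrite big1 /= => [|bs _]; first by apply: Rmult_le_pos; nra.
    by rewrite asboolF // => /hits_prefix.
  have [x' [y' [exy hit']]] := hits_rescale u b x y.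
  have [hr _] := W_ratio hb.
  have hr0 : 0 < wratio b := wratio_gt0 b.
  have hxy' : y' - x' <= (rmin S * delta) ^ k.
    rewrite exy; apply: (Rmult_le_reg_r (wratio b)) => //.
    have -> : (y - x) / wratio b * wratio b = y - x by field; lra.
    apply: Rle_trans hxy _; rewrite /=; nra.
  have := IH _ _ _ (wdir_unit b hu) hxy'.
  set s := \big[Rplus/0]_(bs <- _ | _) _ => hs.
  have -> : \big[Rplus/0]_(bs <- blocks k) (if `[< hits u (flatten (b :: bs)) x y >]
      then wprod (wprod p) (b :: bs) * lam ^ nbad u (b :: bs) else 0) =
      (wprod p b * lam ^ bad u b) * s.
    rewrite /s [in RHS]big_mkcond big_distrr /=; apply: eq_bigr => bs _.
    rewrite (asbool_equiv_eq (hit' (flatten bs))).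
    by case: asbool; rewrite ?pow_add; lra.
  have hs0 : wprod p b * lam ^ bad u b <=
      (if ~~ bad u b then wprod p b else 0) + lam * wprod p b.
    by case: (bad u b) => /=; nra.
  have hs1 : 0 < lam ^ bad u b by apply: pow_lt; lra.
  apply: (Rle_trans _ (wprod p b * lam ^ bad u b * (2 * lam) ^ k)).
    by apply: Rmult_le_compat_l => //; nra.
  rewrite Rmult_comm /=; apply: Rmult_le_compat_l; lra.
rewrite -big_distrr big_split -big_distrr -big_mkcond /= sum_cut //.
have hl : \big[Rplus/0]_(b <- W | `[< hits u b x y >] && ~~ bad u b) wprod p b <= lam.
  by apply: good_mass => //; apply: Rle_trans hxy _; rewrite /=; nra.
by move: (\big[Rplus/0]_(b <- W | _) _) hl => t hl; nra.
Qed.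

End Blocks.

(** A Lipschitz majorant of the indicator of [-1, 1]: time averages are compared between nearby
    directions, so the correlation must depend on the direction in a Lipschitz way. *)
Definition bump (t : R) := Rmax 0 (Rmin 1 (2 - Rabs t)).

Lemma bump_bounds t : 0 <= bump t <= 1.
Proof. by rewrite /bump /Rmax /Rmin; do 2 case: Rle_dec; lra. Qed.

Lemma bump1 t : Rabs t <= 1 -> bump t = 1.
Proof. by rewrite /bump /Rmax /Rmin; do 2 case: Rle_dec; lra. Qed.

Lemma bump0 t : 2 <= Rabs t -> bump t = 0.
Proof. by rewrite /bump /Rmax /Rmin; do 2 case: Rle_dec; lra. Qed.

Lemma bump_lipschitz s t : Rabs (bump s - bump t) <= Rabs (s - t).
Proof.
have : Rabs (Rabs s - Rabs t) <= Rabs (s - t) by split_Rabs; lra.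
rewrite /bump /Rmax /Rmin; move: (Rabs s) (Rabs t) (Rabs (s - t)) => a b c.
by do 4 case: Rle_dec; split_Rabs; lra.
Qed.

(** * Pair correlations of projected cylinders *)

Section Correlation.
Variables (d : nat) (S : self_similar d).
Notation letter := 'I_(alpha S).
Notation word := (seq letter).
Implicit Types (u v : Point d) (w b : word).
Variable p : letter -> R.
Hypotheses (p_gt0 : forall i, 0 < p i) (p_sum : \big[Rplus/0]_(i : letter) p i = 1).
Hypothesis p_le : forall i, p i <= ratio i.
Variable x0 : Point d.
Hypothesis x0_att : att S x0.

(** In units of [delta]: two cylinders over a common interval of length [rmin S * delta] contribute
    one [diam S] each, and the interval at most a third. *)
Definition width := 3 * diam S.

Section Scale.
Variables (n : nat) (delta : R).
Hypotheses (delta_gt0 : 0 < delta) (delta_lt1 : delta < 1) (n_large : rmax S ^ n <= delta).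
Notation W := (cut S n delta).

Definition close u b b' := bump (dot u (vsub (wmap b x0) (wmap b' x0)) / (width * delta)).
Definition local_mass u b := \big[Rplus/0]_(b' <- W) (wprod p b' * close u b b').
Definition correlation u := \big[Rplus/0]_(b <- W) (wprod p b * local_mass u b).

Lemma width_gt0 : 0 < width * delta.
Proof. by apply: Rmult_lt_0_compat => //; rewrite /width; have := diam_ge1 S; lra. Qed.

Lemma local_mass_bounds u b : 0 <= local_mass u b <= 1.
Proof.
have hw := wprod_p_gt0 p_gt0.
split.
  apply: sumR_ge0 => b' _ _; have := hw b'; rewrite /close.
  by move: (_ / _) => t; have := bump_bounds t; nra.
rewrite -(sum_cut p_sum n delta); apply: sumR_le => b' _ _; rewrite /close.
by move: (_ / _) => t; have := bump_bounds t; have := hw b'; nra.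
Qed.

Lemma correlation_bounds u : 0 <= correlation u <= 1.
Proof.
have hw := wprod_p_gt0 p_gt0.
split.
  by apply: sumR_ge0 => b' _ _; have := hw b'; have := local_mass_bounds u b'; nra.
rewrite -(sum_cut p_sum n delta); apply: sumR_le => b' _ _.
by have := hw b'; have := local_mass_bounds u b'; nra.
Qed.

Lemma correlation_opp u : correlation (scal (-1) u) = correlation u.
Proof.
apply: eq_bigr => b _; congr Rmult; apply: eq_bigr => b' _; congr Rmult.
rewrite /close dot_scall /bump; congr (Rmax 0 (Rmin 1 (2 - _))).
by rewrite -Rabs_Ropp; congr Rabs; lra.
Qed.

(** Marked points differ by at most [diam S], and the argument of [bump] is divided by
    [3 * diam S * delta]. *)
Lemma correlation_lipschitz u v :
  Rabs (correlation u - correlation v) <= / (3 * delta) * dist u v.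
Proof.
have hw := wprod_p_gt0 p_gt0.
have hD := width_gt0.
have hd : 0 <= / (3 * delta) * dist u v.
  apply: Rmult_le_pos; last exact: dist_ge0.
  by apply: Rlt_le; apply: Rinv_0_lt_compat; lra.
have hclose : forall b b', Rabs (close u b b' - close v b b') <= / (3 * delta) * dist u v.
  move=> b b'; apply: Rle_trans (bump_lipschitz _ _) _.
  set y := vsub _ _.
  have -> : dot u y / (width * delta) - dot v y / (width * delta) =
      (dot y u - dot y v) * / (width * delta).
    by rewrite (dotC u y) (dotC v y) /Rdiv; ring.
  rewrite Rabs_mult (Rabs_pos_eq (/ _)); last by apply: Rlt_le; exact: Rinv_0_lt_compat.
  have h1 := dot_dist y u v.
  have h2 : nrm y <= diam S by apply: att_diam; exact: att_wmap.
  apply: (Rle_trans _ (diam S * dist u v * / (width * delta))).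
    apply: Rmult_le_compat_r; first by apply: Rlt_le; exact: Rinv_0_lt_compat.
    by have := dist_ge0 u v; nra.
  by apply: Req_le; rewrite /width; field; have := diam_ge1 S; lra.
have hlocal : forall b, Rabs (local_mass u b - local_mass v b) <= / (3 * delta) * dist u v.
  move=> b; rewrite /local_mass /Rminus -sumR_opp -big_split /=.
  apply: Rle_trans (sumR_abs _ _) _.
  rewrite -[X in _ <= X]Rmult_1_l -(sum_cut p_sum n delta) big_distrl /=.
  apply: sumR_le => b' _ _; rewrite Ropp_mult_distr_r -Rmult_plus_distr_l Rabs_mult.
  rewrite (Rabs_pos_eq (wprod p b')); last exact: Rlt_le.
  by apply: Rmult_le_compat_l; [exact: Rlt_le | exact: hclose].
rewrite /correlation /Rminus -sumR_opp -big_split /=.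
apply: Rle_trans (sumR_abs _ _) _.
rewrite -[X in _ <= X]Rmult_1_l -(sum_cut p_sum n delta) big_distrl /=.
apply: sumR_le => b' _ _; rewrite Ropp_mult_distr_r -Rmult_plus_distr_l Rabs_mult.
rewrite (Rabs_pos_eq (wprod p b')); last exact: Rlt_le.
by apply: Rmult_le_compat_l; [exact: Rlt_le | exact: hlocal].
Qed.

Definition crowded (lam : R) u b : bool := `[< lam < local_mass u b >].

(** Markov's inequality. *)
Lemma bad_mass_correlation lam u : 0 < lam ->
  bad_mass p n delta (crowded lam) u <= / lam * correlation u.
Proof.
move=> hl; rewrite /bad_mass /correlation big_distrr /=; apply: sumR_le => b _ _.
have hw := wprod_p_gt0 p_gt0 b; have [h0 _] := local_mass_bounds u b.
have hi := Rinv_0_lt_compat _ hl.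
rewrite /crowded; case: asboolP => h; last by apply: Rmult_le_pos; nra.
apply: (Rmult_le_reg_l lam) => //.
have -> : lam * (/ lam * (wprod p b * local_mass u b)) = wprod p b * local_mass u b by field; lra.
nra.
Qed.

(** If an uncrowded cylinder meets the interval, all others meeting it are close to that one, and so
    are counted in its [local_mass]. *)
Lemma uncrowded_mass lam u x y : 0 < lam -> unit_vec u -> y - x <= rmin S * delta ->
  \big[Rplus/0]_(b <- W | `[< hits u b x y >] && ~~ crowded lam u b) wprod p b <= lam.
Proof.
move=> hl hu hxy.
have hw := wprod_p_gt0 p_gt0.
pose P b := `[< hits u b x y >] && ~~ crowded lam u b.
change (\big[Rplus/0]_(b <- W | P b) wprod p b <= lam).
case: (boolP (has P W)) => [/hasP [b0 hb0]|hno]; last first.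
  rewrite big_seq_cond big_pred0; first lra.
  by move=> b; apply/negbTE; apply: contra hno => /andP[h1 h2]; apply/hasP; exists b.
rewrite /P => /andP[/asboolP [z0 [hz0 hx0]] /asboolPn /Rnot_lt_le hc].
apply: Rle_trans hc; rewrite big_mkcond; apply: sumR_le => b hb _.
case: ifP => [/andP[/asboolP [z [hz hx]] _]|_]; last first.
  by have := hw b; rewrite /close; move: (_ / _) => t; have := bump_bounds t; nra.
rewrite /close bump1; first by lra.
have hD := width_gt0.
have n0 := cylinder_near b0 hu hz0 x0_att; have n1 := cylinder_near b hu hz x0_att.
have [_ r0] := W_ratio delta_gt0 delta_lt1 n_large hb0.
have [_ r1] := W_ratio delta_gt0 delta_lt1 n_large hb.
have hm := rmin_lt1 S; have hd1 := diam_ge1 S.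
have m0 : wratio b0 * diam S <= delta * diam S by apply: Rmult_le_compat_r; lra.
have m1 : wratio b * diam S <= delta * diam S by apply: Rmult_le_compat_r; lra.
have hdd : rmin S * delta <= delta * diam S by nra.
rewrite Rabs_mult (Rabs_pos_eq (/ _)); last by apply: Rlt_le; exact: Rinv_0_lt_compat.
apply: (Rmult_le_reg_r (width * delta)) => //; rewrite Rmult_assoc Rinv_l; last by lra.
rewrite Rmult_1_l Rmult_1_r dot_vsubr /width.
move: hx hx0 n0 n1.
move: (dot u (wmap b0 x0)) (dot u (wmap b x0)) (dot u (wmap b z)) (dot u (wmap b0 z0)) => a1 a2 a3 a4.
move=> h1 h2 h3 h4; split_Rabs; lra.
Qed.

End Scale.

(** Averaged over the grid, [close] is of order delta / dist, as [energy_sum] requires. Turning the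
    grid by [w] amounts to turning the difference vector by [wrot w], which keeps its norm; hence
    the bound is uniform in [w]. *)
Lemma correlation_grid : (0 < d)%nat -> open_set_condition S -> exists C, 0 < C /\
  forall n delta J N w, 0 < delta -> delta < 1 -> rmax S ^ n <= delta ->
    diam S <= 2 ^ J * delta -> (0 < N)%nat -> / INR N <= delta ->
    \big[Rplus/0]_(th : {ffun 'I_d -> 'I_N}) correlation n delta (wdir (grid_dir th) w) <=
    INR #|{ffun 'I_d -> 'I_N}| * (C * INR J.+1 * delta).
Proof.
move=> hd hosc.
have [C [hC henergy]] := energy_sum p_gt0 p_sum p_le x0_att hosc.
have hdR : 1 <= INR d by apply: (le_INR 1); lia.
have hD := diam_ge1 S.
(* The constant of [grid_equidistributed] at [tau = 2 * (width * delta)], beyond which [bump]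
   vanishes, plus [diam S] for its term in [/ INR N <= delta]. *)
pose kappa := 2 * INR d * INR d * (2 * width) + diam S.
have hk : 1 <= kappa by rewrite /kappa /width; nra.
exists ((C + 1) * kappa); split; first nra.
move=> n delta J N w h0 h1 hn hJ hN hNd.
have hwid := width_gt0 h0.
set W := cut S n delta.
have hTh : 0 < INR #|{ffun 'I_d -> 'I_N}|.
  by apply: lt_0_INR; apply/ltP/card_gt0P; exists [ffun _ => Ordinal hN].
have hw := wprod_p_gt0 p_gt0.
pose G b b' := / INR #|{ffun 'I_d -> 'I_N}| * \big[Rplus/0]_(th : {ffun 'I_d -> 'I_N}) close delta (wdir (grid_dir th) w) b b'.
have hG : forall b, b \in W -> forall b', b' \in W -> [/\ 0 <= G b b' <= 1,
    G b b' * dist (wmap b x0) (wmap b' x0) <= kappa * delta &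
    dist (wmap b x0) (wmap b' x0) <= 2 ^ J * delta].
  move=> b hb b' hb'.
  have hi := Rinv_0_lt_compat _ hTh.
  have hdist : dist (wmap b x0) (wmap b' x0) <= diam S by apply: att_diam; exact: att_wmap.
  have hs0 : 0 <= \big[Rplus/0]_(th : {ffun 'I_d -> 'I_N}) close delta (wdir (grid_dir th) w) b b'.
    by apply: sumR_ge0 => th _ _; case: (bump_bounds (dot (wdir (grid_dir th) w)
      (vsub (wmap b x0) (wmap b' x0)) / (width * delta))).
  have hs1 : \big[Rplus/0]_(th : {ffun 'I_d -> 'I_N}) close delta (wdir (grid_dir th) w) b b' <= INR #|{ffun 'I_d -> 'I_N}|.
    have -> : INR #|{ffun 'I_d -> 'I_N}| = \big[Rplus/0]_(th : {ffun 'I_d -> 'I_N}) 1.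
      by rewrite -big_enum sumR_const -cardT Rmult_1_r.
    by apply: sumR_le => th _ _; case: (bump_bounds (dot (wdir (grid_dir th) w)
      (vsub (wmap b x0) (wmap b' x0)) / (width * delta))).
  split; last by apply: Rle_trans hJ.
    split; first by apply: Rmult_le_pos; lra.
    apply: (Rmult_le_reg_l (INR #|{ffun 'I_d -> 'I_N}|)) => //; rewrite /G -Rmult_assoc Rinv_r; lra.
  pose y := wrot w (vsub (wmap b x0) (wmap b' x0)).
  have ey : nrm y = dist (wmap b x0) (wmap b' x0) by rewrite nrm_wrot.
  have hgrid := @grid_equidistributed d N y (2 * (width * delta)) hd hN ltac:(lra).
  rewrite -ey; apply: (Rmult_le_reg_l (INR #|{ffun 'I_d -> 'I_N}|)) => //.
  have -> : INR #|{ffun 'I_d -> 'I_N}| * (G b b' * nrm y) =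
      \big[Rplus/0]_(th : {ffun 'I_d -> 'I_N}) close delta (wdir (grid_dir th) w) b b' * nrm y.
    by rewrite /G; field; lra.
  apply: (Rle_trans _ _ _ _ (Rle_trans _ _ _ hgrid _)).
    apply: Rmult_le_compat_r; first exact: nrm_ge0.
    rewrite -sumR_indicator; apply: sumR_le => th _ _ /=.
    rewrite /close dot_wdir -/y; case: asboolP => h.
      by case: (bump_bounds (dot (grid_dir th) y / (width * delta))).
    rewrite bump0; first lra.
    rewrite Rabs_mult (Rabs_pos_eq (/ _)); last by apply: Rlt_le; exact: Rinv_0_lt_compat.
    apply: (Rmult_le_reg_r (width * delta)) => //; rewrite Rmult_assoc Rinv_l; lra.
  apply: Rmult_le_compat_l; first lra.
  have : nrm y / INR N <= diam S * delta.
    rewrite ey; apply: Rmult_le_compat => //; first exact: dist_ge0.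
    by apply: Rlt_le; apply: Rinv_0_lt_compat; apply: (lt_0_INR N); lia.
  by rewrite /kappa; lra.
have e : \big[Rplus/0]_(th : {ffun 'I_d -> 'I_N}) correlation n delta (wdir (grid_dir th) w) =
    INR #|{ffun 'I_d -> 'I_N}| * \big[Rplus/0]_(b <- W) (wprod p b * \big[Rplus/0]_(b' <- W) (wprod p b' * G b b')).
  rewrite /correlation exchange_big big_distrr; apply: eq_bigr => b _ /=.
  rewrite -big_distrr /= /local_mass exchange_big /=.
  have -> : forall a c D, a * (c * D) = c * (a * D) by move=> *; lra.
  congr Rmult; rewrite big_distrr; apply: eq_bigr => b' _ /=.
  have aux : forall a c D, 0 < c -> a * D = c * (a * (/ c * D)) by move=> *; field; lra.
  by rewrite -big_distrr; exact: aux.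
rewrite e; apply: Rmult_le_compat_l; first lra.
have hJ0 : 0 < INR J.+1 by apply: lt_0_INR; lia.
have hJd : 0 <= kappa * INR J.+1 * delta by apply: Rmult_le_pos; [apply: Rmult_le_pos|]; lra.
apply: (Rle_trans _ (\big[Rplus/0]_(b <- W) (wprod p b * (C * (kappa * INR J.+1 * delta))))).
  rewrite 2!big_seq; apply: sumR_le => b _ hb.
  apply: Rmult_le_compat_l; first exact: Rlt_le.
  by apply: henergy => // b' hb'; exact: hG.
rewrite -big_distrl sum_cut //.
apply: (Rle_trans _ (1 * (C * (kappa * INR J.+1 * delta)))); first exact: Rle_refl.
have -> : (C + 1) * kappa * INR J.+1 * delta = (C + 1) * (kappa * INR J.+1 * delta) by ring.
nra.
Qed.

(** For each number of steps some grid direction has at most the average time sum;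
    [time_sum_uniform] carries this over to all directions. [J] is of order log (1 / delta). *)
Lemma correlation_time_average : (0 < d)%nat -> open_set_condition S -> dense_words S ->
  exists C, 0 < C /\ forall n delta J, 0 < delta -> delta < 1 -> rmax S ^ n <= delta ->
    diam S <= 2 ^ J * delta -> exists k0 : nat, forall k u, (k0 <= k)%nat -> unit_vec u ->
      time_sum p (correlation n delta) k u <= INR k * (C * INR J.+1 * delta).
Proof.
move=> hd hosc hdense.
have [C [hC hgrid]] := correlation_grid hd hosc.
exists (3 * C); split; first lra.
move=> n delta J h0 h1 hn hJ.
have [N hN] := INR_unbounded (/ delta).
have hid := Rinv_0_lt_compat _ h0.
have hN0 : (0 < N)%nat by apply/ltP; apply: INR_lt; rewrite /=; lra.
have hNd : / INR N <= delta.
  by rewrite -(Rinv_inv delta); apply: Rinv_le_contravar; lra.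
set E := C * INR J.+1 * delta.
have hJ0 : 0 < INR J.+1 by apply: lt_0_INR; lia.
have hE : 0 < E by rewrite /E; apply: Rmult_lt_0_compat => //; nra.
have [||||||k0 hk0] := @time_sum_uniform d S p p_gt0 p_sum (correlation n delta)
    (fun u => correlation_bounds n delta u) {ffun 'I_d -> 'I_N} (@grid_dir d N) (/ (3 * delta)) E hdense.
- by move=> th; exact: grid_dir_unit.
- by apply: Rlt_le; apply: Rinv_0_lt_compat; lra.
- exact: hE.
- by move=> u v; exact: correlation_lipschitz.
- by move=> u; exact: correlation_opp.
- move=> k.
  (* A step of the walk turns the whole grid, so the induction runs over all words [w]. *)
  have hsum : forall w, \big[Rplus/0]_(th : {ffun 'I_d -> 'I_N})
      time_sum p (correlation n delta) k (wdir (grid_dir th) w) <= INR #|{ffun 'I_d -> 'I_N}| * (INR k * E).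
    elim: k => [|k IH] w; first by rewrite big1 // Rmult_0_l Rmult_0_r; lra.
    rewrite S_INR.
    have -> : \big[Rplus/0]_(th : {ffun 'I_d -> 'I_N}) time_sum p (correlation n delta) k.+1 (wdir (grid_dir th) w) =
        \big[Rplus/0]_(th : {ffun 'I_d -> 'I_N}) correlation n delta (wdir (grid_dir th) w) +
        \big[Rplus/0]_(i : letter) (p i * \big[Rplus/0]_(th : {ffun 'I_d -> 'I_N})
          time_sum p (correlation n delta) k (wdir (grid_dir th) (w ++ [:: i]))).
      rewrite [LHS]/= big_split; congr Rplus; rewrite exchange_big /=.
      by apply: eq_bigr => i _; rewrite -big_distrr; congr Rmult;
        apply: eq_bigr => th _; rewrite wdir_cat.
    have hg := hgrid n delta J N w h0 h1 hn hJ hN0 hNd.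
    suff : \big[Rplus/0]_(i : letter) (p i * \big[Rplus/0]_(th : {ffun 'I_d -> 'I_N})
          time_sum p (correlation n delta) k (wdir (grid_dir th) (w ++ [:: i]))) <=
        INR #|{ffun 'I_d -> 'I_N}| * (INR k * E) by rewrite -/E in hg *; lra.
    rewrite -[X in _ <= X]Rmult_1_l -p_sum big_distrl /=; apply: sumR_le => i _ _.
    by apply: Rmult_le_compat_l; [exact: Rlt_le | exact: IH].
  apply: contrapT => hno.
  have hlt : forall th, 0 < time_sum p (correlation n delta) k (@grid_dir d N th) - INR k * E.
    by move=> th; apply: Rnot_le_lt => h; apply: hno; exists th; lra.
  have := sumR_pos (mem_index_enum [ffun _ : 'I_d => Ordinal hN0]) (fun th _ => hlt th).
  rewrite /Rminus big_split /= (_ : \big[Rplus/0]_(th : {ffun 'I_d -> 'I_N}) - (INR k * E) = - (INR #|{ffun 'I_d -> 'I_N}| * (INR k * E))).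
    by have := hsum [::]; rewrite /=; lra.
  transitivity (INR #|{ffun 'I_d -> 'I_N}| * - (INR k * E)); last by lra.
  by rewrite -big_enum sumR_const -cardT.
exists k0 => k u hk hu; apply: Rle_trans (hk0 k u hk hu) _.
by apply: Req_le; rewrite /E; ring.
Qed.

End Correlation.

Lemma pow_exp a n : exp a ^ n = exp (INR n * a).
Proof.
elim: n => [|n IH]; first by rewrite /= Rmult_0_l exp_0.
by rewrite S_INR -tech_pow_Rmult IH -exp_plus; congr exp; lra.
Qed.

Lemma exp_le a b : a <= b -> exp a <= exp b.
Proof. by case=> [/exp_increasing|->]; lra. Qed.

Lemma half_pow n : (/ 2) ^ n = exp (- (INR n * ln 2)).
Proof. by rewrite -[/ 2]exp_ln ?ln_Rinv ?pow_exp; try lra; congr exp; lra. Qed.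

(** In the choice of scale one factor [l] is the logarithm of the energy estimate, the other the
    number of letters in a block. *)
Lemma quadratic_lt_exponential (A B : R) :
  exists l : nat, [/\ (0 < l)%nat, B <= INR l & A * (INR l * INR l) * (/ 2) ^ l <= 1].
Proof.
have [j hj] := INR_unbounded (Rmax 1 (Rmax B (16 * A))).
have h1 := Rmax_l 1 (Rmax B (16 * A)); have h2 := Rmax_r 1 (Rmax B (16 * A)).
have h3 := Rmax_l B (16 * A); have h4 := Rmax_r B (16 * A).
have hl : INR (4 * j) = 4 * INR j by rewrite mult_INR /=; lra.
exists (4 * j)%nat; split; [|rewrite hl; lra|].
  by have : (0 < j)%nat; [apply/ltP/INR_lt; rewrite /=; lra | lia].
have hb : INR j < 2 ^ j.
  elim: (j) => [|i IH]; first by rewrite /=; lra.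
  have := pow_R1_Rle 2 i; rewrite S_INR /=; lra.
have -> : (/ 2) ^ (4 * j) = / ((2 ^ j) ^ 4) by rewrite pow_inv mulnC -pow_mult.
rewrite hl; set x := INR j in hj hb *; set y := 2 ^ j in hb *.
apply: (Rmult_le_reg_r (y ^ 4)); first by apply: pow_lt; lra.
rewrite Rmult_assoc Rinv_l ?Rmult_1_l ?Rmult_1_r; last by apply: pow_nonzero; lra.
have e2 : x * x <= y * y by nra.
have e4 : x * x * (x * x) <= y * y * (y * y) by nra.
have e5 : A * (4 * x * (4 * x)) <= x * (x * x) by have := Rle_0_sqr x; rewrite /Rsqr; nra.
have e6 : x * (x * x) <= x * x * (x * x) by have := Rle_0_sqr x; rewrite /Rsqr; nra.
rewrite /=; lra.
Qed.

Lemma time_sum_scale (d : nat) (S : self_similar d) (p : 'I_(alpha S) -> R) (f h : Point d -> R) c :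
  (forall i, 0 < p i) -> (forall u, f u <= c * h u) ->
  forall n u, time_sum p f n u <= c * time_sum p h n u.
Proof.
move=> hp hfh; elim=> [|n IH] u; first by rewrite /=; lra.
rewrite /= Rmult_plus_distr_l big_distrr /=; apply: Rplus_le_compat; first exact: hfh.
apply: sumR_le => i _ _.
by have := Rmult_le_compat_l _ _ _ (Rlt_le _ _ (hp i)) (IH (mat_apply (mat_tr (rota i)) u)); lra.
Qed.

(** * Choice of the scale and of the one-scale weights *)

Section KeyProposition.
Variables (d : nat) (S : self_similar d).
Notation letter := 'I_(alpha S).
Notation word := (seq letter).
Implicit Types (u v : Point d) (w b : word) (bs : seq word).
Variable p : letter -> R.
Hypotheses (p_gt0 : forall i, 0 < p i) (p_sum : \big[Rplus/0]_(i : letter) p i = 1).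
Hypothesis p_le : forall i, p i <= ratio i.

(* The factor [2] comes from renormalising: at least half of the natural weight
   [p] lies on block sequences with few crowded blocks. *)
Lemma spread_weights eps : (0 < d)%nat -> open_set_condition S -> dense_words S ->
  0 < eps < 1 -> exists (X : R) (A : seq (seq word)) (q : Point d -> seq word -> R),
  [/\ / eps <= X, uniq A,
   {in A &, forall bs bs', prefix (flatten bs) (flatten bs') -> bs = bs'},
   {in A, forall bs, exp (- X) <= wratio (flatten bs) <= exp (- ((1 - eps) * X))} &
   forall u, unit_vec u ->
     [/\ {in A, forall bs, 0 <= q u bs <= 2 * wprod p (flatten bs)},
         \big[Rplus/0]_(bs <- A) q u bs = 1 &
         forall x y, y - x <= exp (- X) ->
           \big[Rplus/0]_(bs <- A | `[< hits u (flatten bs) x y >]) q u bs <=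
           exp (- ((1 - eps) * X))]].
Proof.
move=> hd hosc hdense heps.
have [x0 hx0] := att_nonempty S.
have [C [hC htime]] := correlation_time_average p_gt0 p_sum p_le hx0 hd hosc hdense.
have hl2 : 0 < ln 2 by rewrite -ln_1; apply: ln_increasing; lra.
have hr0 := rmin_gt0 S; have hr1 := rmin_lt1 S.
pose rho := - ln (rmin S).
have hrho : 0 < rho by rewrite /rho; have := ln_increasing _ _ hr0 hr1; rewrite ln_1; lra.
have er : rmin S = exp (- rho) by rewrite /rho Ropp_involutive exp_ln.
(* [1 / Q] is both the loss in the exponent of [lam] against [delta] and the tolerated proportion of
   bad blocks; each costs about [Q * g] per [J'] in the final exponent. *)
have [Q hQ] := INR_unbounded (4 / eps).
have hQ4 : 4 < INR Q * eps.
  have -> : 4 = 4 / eps * eps by field; lra.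
  by apply: Rmult_lt_compat_r; lra.
have hQ1 : 4 < INR Q by nra.
have [N0 [hN0 hN0r]] : exists N0 : nat, (0 < N0)%nat /\ rmax S ^ N0 <= / 2.
  have hm := rmax_gt0 S; have hm1 := rmax_lt1 S.
  have [|N hN] := @pow_lt_1_zero (rmax S) _ (/ 2) ltac:(lra).
    by rewrite Rabs_pos_eq; lra.
  exists N.+1; split => //; have := hN N.+1 (Nat.le_succ_diag_r N).
  by rewrite Rabs_pos_eq; [lra | apply: pow_le; lra].
have [J0 hJ0] : exists J0 : nat, diam S <= 2 ^ J0.
  have [N hN] := INR_unbounded (diam S); exists N.
  have : INR N < 2 ^ N; last by lra.
  elim: (N) => [|i IH]; first by rewrite /=; lra.
  have := pow_R1_Rle 2 i; rewrite S_INR /=; lra.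
(* Chosen to make the expected number of bad blocks at most [INR J' / 2]. *)
pose Ac := 2 * (INR Q * INR Q) * INR N0 * C * (INR Q + INR J0 + 1).
(* The first bound absorbs the factor [rmin S] lost in each block; the second absorbs the powers of
   2 and of [rmin S] in the final exponent. *)
pose Bc := Rmax (rho / (eps * INR Q * ln 2)) (((INR Q + 1) * ln 2 + INR Q * rho) / (2 * INR Q * ln 2)).
have [l [hl hlB hlA]] := quadratic_lt_exponential Ac Bc.
have hl1 : 1 <= INR l by apply: (le_INR 1); lia.
have hB1 : rho <= INR l * (eps * INR Q * ln 2).
  have hp : 0 < eps * INR Q * ln 2 by apply: Rmult_lt_0_compat; nra.
  have -> : rho = rho / (eps * INR Q * ln 2) * (eps * INR Q * ln 2) by field; nra.
  apply: Rmult_le_compat_r; first lra.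
  by apply: Rle_trans hlB; exact: Rmax_l.
have hB2 : (INR Q + 1) * ln 2 + INR Q * rho <= INR l * (2 * INR Q * ln 2).
  have hp : 0 < 2 * INR Q * ln 2 by apply: Rmult_lt_0_compat; nra.
  have -> : (INR Q + 1) * ln 2 + INR Q * rho =
    ((INR Q + 1) * ln 2 + INR Q * rho) / (2 * INR Q * ln 2) * (2 * INR Q * ln 2) by field; nra.
  apply: Rmult_le_compat_r; first lra.
  by apply: Rle_trans hlB; exact: Rmax_r.
pose g := INR l * ln 2.
have hg : 0 < g by rewrite /g; nra.
pose delta := exp (- (INR Q * g)).
(* With [delta = 2 ^ - (l * Q)] this is [2 ^ - (l * (Q - 1))], so Markov's inequality leaves
   [delta / lam = 2 ^ - l]. *)
pose lam := exp (- ((INR Q - 1) * g)).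
pose n := (N0 * (l * Q))%nat.
have hQ0 : (0 < Q)%nat by apply/ltP/INR_lt; rewrite /=; lra.
have hn0 : (0 < n)%nat by rewrite /n !muln_gt0 hN0 hl hQ0.
have edelta : delta = (/ 2) ^ (l * Q).
  by rewrite half_pow /delta /g mult_INR; congr exp; ring.
have hdelta0 : 0 < delta := exp_pos _.
have hdelta1 : delta < 1.
  rewrite -exp_0 /delta.
  by apply: exp_increasing; have hQg : 0 < INR Q * g by [nra]; lra.
have hlam : 0 < lam <= 1.
  split; first exact: exp_pos.
  by rewrite -exp_0 /lam; apply: exp_le; have hQg : 0 <= (INR Q - 1) * g by [nra]; lra.
have hnlarge : rmax S ^ n <= delta.
  rewrite /n -[(_ * _)%nat]/(Nat.mul N0 (l * Q)) pow_mult edelta; apply: pow_incr; split => //.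
  by apply: pow_le; apply: Rlt_le; exact: rmax_gt0.
pose J := (l * Q + J0)%nat.
have hJ : diam S <= 2 ^ J * delta.
  rewrite /J -[(_ + J0)%nat]/(Nat.add (l * Q) J0) pow_add edelta pow_inv.
  have := pow_lt 2 (l * Q) ltac:(lra) => hp.
  by have -> : forall s t, 0 < s -> s * t * / s = t by move=> s t hs; field; lra.
have [k0 hk0] := htime n delta J hdelta0 hdelta1 hnlarge hJ.
(* [J'] is the number of bad blocks allowed among [k = Q * J']. It exceeds [k0], so that the time
   average is valid, and is large enough for [/ eps <= X]. *)
have [J' hJ'] := INR_unbounded (Rmax (INR k0) (Rmax 1 (/ (eps * ln 2)))).
have j1 := Rmax_l (INR k0) (Rmax 1 (/ (eps * ln 2))).
have j2 := Rmax_r (INR k0) (Rmax 1 (/ (eps * ln 2))).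
have j3 := Rmax_l 1 (/ (eps * ln 2)); have j4 := Rmax_r 1 (/ (eps * ln 2)).
pose k := (Q * J')%nat.
have ek : INR k = INR Q * INR J' by rewrite mult_INR.
pose X := INR Q * INR J' * (INR Q * g + rho).
have eX : (rmin S * delta) ^ k = exp (- X).
  by rewrite er /delta -exp_plus pow_exp ek /X; congr exp; ring.
set W := cut S n delta.
pose bad := crowded p x0 n delta lam.
have hgood : forall u x y, unit_vec u -> y - x <= rmin S * delta ->
    \big[Rplus/0]_(b <- W | `[< hits u b x y >] && ~~ bad u b) wprod p b <= lam.
  move=> u x y hu hxy; apply: uncrowded_mass => //; lra.
pose few u bs := (nbad bad u bs <= J')%nat.
pose wt bs := wprod (wprod p) bs.
have hwt : forall bs, 0 < wt bs by move=> bs; apply: wprod_gt0 => b; exact: wprod_p_gt0.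
pose M u := \big[Rplus/0]_(bs <- words_of W k | few u bs) wt bs.
have hM : forall u, unit_vec u -> / 2 <= M u.
  move=> u hu.
  have hE : \big[Rplus/0]_(bs <- words_of W k) (wt bs * INR (nbad bad u bs)) <= INR J' / 2.
    apply: Rle_trans (expected_nbad p_gt0 p_sum hdelta1 bad k u hn0) _.
    have hkk : (k0 <= k * n)%nat.
      have h1 : (k0 <= J')%nat by apply/leP/INR_le; lra.
      apply: leq_trans h1 (leq_trans (leq_pmull J' hQ0) _).
      exact: leq_pmulr.
    have hscale := time_sum_scale p_gt0 (fun u => bad_mass_correlation p_gt0 p_sum x0 n delta u (proj1 hlam)).
    apply: Rle_trans (hscale (k * n)%nat u) _.
    have hil := Rinv_0_lt_compat _ (proj1 hlam).
    apply: Rle_trans (Rmult_le_compat_l _ _ _ (Rlt_le _ _ hil) (hk0 _ u hkk hu)) _.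
    have eh : / lam * delta = (/ 2) ^ l.
      by rewrite half_pow /lam /delta -exp_Ropp -exp_plus; congr exp; rewrite /g; ring.
    have hh : 0 < (/ 2) ^ l by apply: pow_lt; lra.
    have eJ : INR J.+1 <= INR l * (INR Q + INR J0 + 1).
      rewrite S_INR /J -[(_ + J0)%nat]/(Nat.add (l * Q) J0) plus_INR mult_INR.
      by have := pos_INR J0; nra.
    have ekn : INR (k * n) = INR J' * (INR Q * INR Q * INR N0 * INR l).
      by rewrite mult_INR ek /n !mult_INR; ring.
    have -> : / lam * (INR (k * n) * (C * INR J.+1 * delta)) =
        INR J' * (INR Q * INR Q * INR N0 * INR l * C * (/ 2) ^ l) * INR J.+1.
      by rewrite ekn -eh; ring.
    have hpos : 0 <= INR J' * (INR Q * INR Q * INR N0 * INR l * C * (/ 2) ^ l).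
      by repeat apply: Rmult_le_pos; try exact: pos_INR; lra.
    apply: Rle_trans (Rmult_le_compat_l _ _ _ hpos eJ) _.
    have -> : INR J' * (INR Q * INR Q * INR N0 * INR l * C * (/ 2) ^ l) * (INR l * (INR Q + INR J0 + 1)) =
        INR J' / 2 * (Ac * (INR l * INR l) * (/ 2) ^ l) by rewrite /Ac; field.
    by have := pos_INR J'; nra.
  have hone : \big[Rplus/0]_(bs <- words_of W k) wt bs = 1.
    by apply: sum_wprod_words_of; exact: sum_cut.
  (* Markov's inequality for the number of bad blocks. *)
  have hMc : INR J' * (1 - M u) <= \big[Rplus/0]_(bs <- words_of W k) (wt bs * INR (nbad bad u bs)).
    have -> : 1 - M u = \big[Rplus/0]_(bs <- words_of W k | ~~ few u bs) wt bs.
      have h := hone; rewrite (bigID (few u)) /= -/(M u) in h; rewrite -h; set z := \big[Rplus/0]_(bs <- _ | ~~ _) _; ring.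
    rewrite big_distrr big_mkcond /=; apply: sumR_le => bs _ _.
    have h1 := hwt bs; have h2 := pos_INR (nbad bad u bs).
    rewrite /few; case: (leqP (nbad bad u bs) J') => h3 /=.
      by apply: Rmult_le_pos; lra.
    have := le_INR _ _ (elimT leP (ltnW h3)); nra.
  nra.
have hJ1 : 1 <= INR J' by lra.
have hrX : (1 - eps) * (INR Q * g + rho) <= INR Q * g.
  have : rho <= eps * INR Q * g by rewrite /g; lra.
  nra.
(* The natural weights conditioned on having few bad blocks. *)
exists X, (words_of W k), (fun u bs => if few u bs then wt bs / M u else 0); split.
- have h1 : / eps <= INR J' * ln 2.
    have -> : / eps = / (eps * ln 2) * ln 2 by field; lra.
    by apply: Rmult_le_compat_r; lra.
  have h2 : ln 2 <= g by rewrite /g; nra.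
  have h3 : INR Q * g + rho >= g by nra.
  have h4 : INR J' <= INR Q * INR J' by nra.
  by apply: Rle_trans h1 _; rewrite /X; apply: Rmult_le_compat; lra.
- by apply: uniq_words_of; exact: cut_uniq.
- by move=> bs bs'; exact: blocks_prefix.
- move=> bs hbs; have [h1 h2] := blocks_ratio hdelta0 hdelta1 hnlarge hbs.
  rewrite -eX; split => //; apply: Rle_trans h2 _.
  rewrite /delta pow_exp ek; apply: exp_le; rewrite /X.
  have hq : 0 <= INR Q * INR J' by apply: Rmult_le_pos; exact: pos_INR.
  by have := Rmult_le_compat_l _ _ _ hq hrX; lra.
move=> u hu; have hMu := hM u hu.
have hMi : 0 < / M u <= 2.
  split; first by apply: Rinv_0_lt_compat; lra.
  by rewrite -(Rinv_inv 2); apply: Rinv_le_contravar; lra.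
split.
- move=> bs _; rewrite wprod_flatten -/(wt bs); have := hwt bs.
  by case: (few u bs); rewrite /Rdiv; nra.
- rewrite -big_mkcond /= /Rdiv -big_distrl /= -/(M u) Rinv_r //; lra.
move=> x y hxy.
have hlJ : 0 < lam ^ J' by apply: pow_lt; lra.
(* With at most [J'] bad blocks the discount is at least [lam ^ J'], so removing it costs only
   [/ lam ^ J']. *)
apply: (Rle_trans _ (\big[Rplus/0]_(bs <- words_of W k | `[< hits u (flatten bs) x y >])
    (2 * / lam ^ J' * (wt bs * lam ^ nbad bad u bs)))).
  apply: sumR_le => bs _ _; have hb := hwt bs.
  have hln : 0 < lam ^ nbad bad u bs by apply: pow_lt; lra.
  have hli := Rinv_0_lt_compat _ hlJ.
  rewrite /few; case: (leqP (nbad bad u bs) J') => hnb; last first.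
    by apply: Rmult_le_pos; nra.
  have hle : lam ^ J' <= lam ^ nbad bad u bs.
    rewrite -(subnKC hnb) -[(_ + _)%nat]/(Nat.add (nbad bad u bs) (J' - nbad bad u bs)) pow_add.
    rewrite -{2}(Rmult_1_r (lam ^ nbad bad u bs)).
    apply: Rmult_le_compat_l; first lra.
    by rewrite -(pow1 (J' - nbad bad u bs)); apply: pow_incr; lra.
  have -> : 2 * / lam ^ J' * (wt bs * lam ^ nbad bad u bs) =
      wt bs * (2 * (/ lam ^ J' * lam ^ nbad bad u bs)) by ring.
  apply: Rmult_le_compat_l; first lra.
  have : 1 <= / lam ^ J' * lam ^ nbad bad u bs.
    by rewrite -(Rinv_l (lam ^ J')); [apply: Rmult_le_compat_l; lra | lra].
  lra.
rewrite -big_distrr.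
have hdisc := discounted_mass p_gt0 p_sum hdelta0 hdelta1 hnlarge hlam hgood hu (k := k) (x := x) (y := y).
rewrite eX in hdisc; have {}hdisc := hdisc hxy.
have hli := Rinv_0_lt_compat _ hlJ.
apply: Rle_trans (Rmult_le_compat_l _ _ _ _ hdisc) _; first lra.
have e2 : 2 = exp (ln 2) by rewrite exp_ln //; lra.
have -> : 2 * / lam ^ J' * (2 * lam) ^ k =
    exp (ln 2 + INR J' * ((INR Q - 1) * g) + INR Q * INR J' * (ln 2 - (INR Q - 1) * g)).
  rewrite {1 2}e2 /lam -exp_plus !pow_exp -exp_Ropp -!exp_plus ek; congr exp; ring.
apply: exp_le; rewrite /X.
have hfin : (INR Q + 1) * ln 2 + INR Q * rho <= 2 * INR Q * g by rewrite /g; lra.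
(* The final exponent per unit of [J']. The gain [eps * Q * Q * g >= 4 * Q * g] pays [2 * Q * g] for
   the bad blocks and for [lam] against [delta], and [2 * Q * g] for the terms in [ln 2] and
   [rho]. *)
have hmain : (INR Q + 1) * ln 2 + (INR Q - 1) * g - INR Q * (INR Q - 1) * g +
    (1 - eps) * (INR Q * (INR Q * g + rho)) <= 0.
  have h1 : INR Q * INR Q * eps * g >= 4 * INR Q * g.
    apply: Rle_ge; apply: Rmult_le_compat_r; nra.
  have h2 : 0 <= eps * (INR Q * rho) by apply: Rmult_le_pos; nra.
  lra.
have h3 : ln 2 <= INR J' * ln 2 by nra.
have := Rmult_le_compat_l (INR J') _ _ ltac:(lra) hmain; lra.
Qed.

End KeyProposition.

(** * Trees of cylinders *)

Section Tree.
Variables (d : nat) (S : self_similar d).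
Notation letter := 'I_(alpha S).
Notation word := (seq letter).
Variables (T : eqType) (A : seq T) (wd : T -> word) (p : letter -> R).
Variables (X theta : R) (q : Point d -> T -> R).
Implicit Types (u v : Point d) (ts : seq T) (a : T).
Hypotheses (X_gt0 : 0 < X) (theta_bounds : 0 < theta <= 1).
Hypothesis p_gt0 : forall i, 0 < p i.
Hypothesis A_prefix : {in A &, forall a a', prefix (wd a) (wd a') -> a = a'}.
Hypothesis A_ratio : {in A, forall a, exp (- X) <= wratio (wd a) <= exp (- (theta * X))}.
Hypothesis q_bounds : forall u, unit_vec u -> {in A, forall a, 0 <= q u a <= 2 * wprod p (wd a)}.
Hypothesis q_sum : forall u, unit_vec u -> \big[Rplus/0]_(a <- A) q u a = 1.
Hypothesis q_spread : forall u x y, unit_vec u -> y - x <= exp (- X) ->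
  \big[Rplus/0]_(a <- A | `[< hits u (wd a) x y >]) q u a <= exp (- (theta * X)).

Notation level k := (words_of A k).

(** In the application an element of [T] is a sequence of blocks, [wd] is [flatten], and [theta] is
    one minus the loss in [spread_weights]. *)
Definition tword ts : word := flatten (map wd ts).

Fixpoint tweight u ts : R :=
  if ts is a :: ts' then q u a * tweight (wdir u (wd a)) ts' else 1.

Lemma tword_cat ts ts' : tword (ts ++ ts') = tword ts ++ tword ts'.
Proof. by rewrite /tword map_cat flatten_cat. Qed.

Lemma tweight_bounds k u ts : unit_vec u -> ts \in level k ->
  0 <= tweight u ts <= 2 ^ k * wprod p (tword ts).
Proof.
elim: k u ts => [|k IH] u ts hu; first by rewrite inE => /eqP -> /=; lra.
move=> /mem_words_ofP [a [ts' [-> ha hts]]].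
rewrite /tword /= wprod_cat -/(tword ts').
have := q_bounds hu ha; have := IH _ _ (wdir_unit (wd a) hu) hts.
have := wprod_gt0 (wd a) p_gt0; have := wprod_gt0 (tword ts') p_gt0.
move: (q u a) (tweight _ ts') (wprod p (wd a)) (wprod p (tword ts')) => x y z t ht hz [h1 h2] [h3 h4].
split; first exact: Rmult_le_pos.
by apply: Rle_trans (Rmult_le_compat _ _ _ _ h3 h1 h4 h2) _; lra.
Qed.

Lemma level_ratio k ts : ts \in level k ->
  exp (- (INR k * X)) <= wratio (tword ts) <= exp (- (INR k * (theta * X))).
Proof.
elim: k ts => [|k IH] ts.
  by rewrite inE => /eqP ->; rewrite /wratio /= !Rmult_0_l Ropp_0 exp_0; lra.
move=> /mem_words_ofP [a [ts' [-> ha hts]]].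
rewrite /tword /= wratio_cat -/(tword ts') -/(INR k.+1) S_INR.
have -> : - ((INR k + 1) * X) = - X + - (INR k * X) by lra.
have -> : - ((INR k + 1) * (theta * X)) = - (theta * X) + - (INR k * (theta * X)) by lra.
rewrite !exp_plus.
have := A_ratio ha; have := IH _ hts; have := exp_pos (- X); have := exp_pos (- (INR k * X)).
move: (exp (- X)) (exp (- (INR k * X))) (exp (- (theta * X))) (exp (- (INR k * (theta * X)))).
move=> x y z t h1 h2 [h3 h4] [h5 h6]; split; apply: Rmult_le_compat; lra.
Qed.

Lemma level_prefix k ts ts' : ts \in level k -> ts' \in level k ->
  prefix (tword ts) (tword ts') -> ts = ts'.
Proof.
elim: k ts ts' => [|k IH] ts ts'; first by rewrite !inE => /eqP -> /eqP ->.
move=> /mem_words_ofP [b [cs [-> hb hcs]]] /mem_words_ofP [b' [cs' [-> hb' hcs']]].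
rewrite /tword /= => hp.
have e : b = b'.
  have := prefix_comparable (catl_prefix hp) (prefix_prefix (wd b') (tword cs')).
  by case/orP => h; [|apply: esym]; apply: A_prefix h.
by move: hp; rewrite -e prefix_catr // eqxx /= => /(IH _ _ hcs hcs') ->.
Qed.

(** Inside a cylinder of size at least [exp (- X)] the interval grows by at most [exp X], so the
    estimate of the previous generation applies in the turned direction, and the bounds multiply
    without constants. *)
Lemma level_spread k u x y : unit_vec u -> y - x <= exp (- (INR k * X)) ->
  \big[Rplus/0]_(ts <- level k | `[< hits u (tword ts) x y >]) tweight u ts <=
  exp (- (INR k * (theta * X))).
Proof.
elim: k u x y => [|k IH] u x y hu hxy.
  rewrite big_mkcond big_seq1 Rmult_0_l Ropp_0 exp_0 /=; case: asbool; lra.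
have eX : - (INR k.+1 * X) = - X + - (INR k * X) by rewrite S_INR; lra.
have eX2 : - (INR k.+1 * (theta * X)) = - (theta * X) + - (INR k * (theta * X)) by rewrite S_INR; lra.
rewrite eX2 exp_plus; rewrite eX exp_plus in hxy.
have h1 := exp_pos (- X); have h2 := exp_pos (- (INR k * X)).
have h3 := exp_pos (- (INR k * (theta * X))).
have h4 : exp (- (INR k * X)) <= 1.
  by rewrite -exp_0; apply: exp_le; have := pos_INR k; nra.
rewrite big_mkcond sum_words_ofS.
apply: (Rle_trans _ (\big[Rplus/0]_(a <- A)
    ((if `[< hits u (wd a) x y >] then q u a else 0) * exp (- (INR k * (theta * X)))))).
  apply: sumR_le => a ha _.
  have hqa := q_bounds hu ha.
  case: (asboolP (hits u (wd a) x y)) => hit; last first.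
    rewrite big1 /= => [|ts _]; first by lra.
    by rewrite asboolF // => /hits_prefix.
  have [x' [y' [exy hit']]] := hits_rescale u (wd a) x y.
  have [hr _] := A_ratio ha; have hr0 := wratio_gt0 (wd a).
  have hxy' : y' - x' <= exp (- (INR k * X)).
    rewrite exy; apply: (Rmult_le_reg_r (wratio (wd a))) => //.
    have -> : (y - x) / wratio (wd a) * wratio (wd a) = y - x by field; lra.
    by apply: Rle_trans hxy _; nra.
  have := IH _ _ _ (wdir_unit (wd a) hu) hxy'.
  set s := \big[Rplus/0]_(ts <- _ | _) _ => hs.
  have -> : \big[Rplus/0]_(ts <- level k) (if `[< hits u (tword (a :: ts)) x y >]
      then tweight u (a :: ts) else 0) = q u a * s.
    rewrite /s [in RHS]big_mkcond big_distrr /=; apply: eq_bigr => ts _.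
    rewrite (asbool_equiv_eq (hit' (tword ts))).
    by case: asbool; lra.
  by apply: Rmult_le_compat_l; lra.
rewrite -big_distrl -big_mkcond; apply: Rmult_le_compat_r; first lra.
by apply: q_spread => //; nra.
Qed.

(** Otherwise one interval of length [exp (- X)] would be hit by every first-level cylinder, and the
    total weight 1 would be at most [exp (- (theta * X))]. *)
Lemma att_width u : unit_vec u ->
  exists x y, [/\ att S x, att S y & exp (- X) / 2 <= dot u x - dot u y].
Proof.
move=> hu; apply: contrapT => hno.
have [x0 hx0] := att_nonempty S.
have hX := exp_pos (- X).
have hall : forall x, att S x -> Rabs (dot u x - dot u x0) < exp (- X) / 2.
  move=> x hx; apply: Rnot_le_lt => h; apply: hno.
  case: (Rle_lt_dec 0 (dot u x - dot u x0)) => h0.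
    by exists x, x0; split => //; rewrite Rabs_pos_eq in h.
  by exists x0, x; split => //; rewrite Rabs_left1 in h; lra.
have := @q_spread u (dot u x0 - exp (- X) / 2) (dot u x0 + exp (- X) / 2) hu ltac:(lra).
rewrite big_mkcond /= (_ : \big[Rplus/0]_(a <- A) _ = 1).
  have : exp (- (theta * X)) < 1 by rewrite -exp_0; apply: exp_increasing; nra.
  lra.
rewrite -(q_sum hu); apply: eq_bigr => a _; rewrite asboolT //.
exists x0; split => //.
by have := hall _ (att_wmap (wd a) hx0); split_Rabs; lra.
Qed.

(* Conditional probability, given the prefix [ts], of an event [E] about the
   first [k] steps; by truncated subtraction it is the indicator of [E] once
   [ts] has length at least [k]. *)
Definition cond u (k : nat) (E : pred (seq T)) ts : R :=
  \big[Rplus/0]_(ts' <- level (k - size ts) | E (take k (ts ++ ts')))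
    tweight (wdir u (tword ts)) ts'.

(** The martingale property. Once the prefix has length [k], its children all have the same value
    and [q_sum] suffices. *)
Lemma cond_step u k E ts : unit_vec u ->
  cond u k E ts = \big[Rplus/0]_(a <- A) (q (wdir u (tword ts)) a * cond u k E (rcons ts a)).
Proof.
move=> hu; rewrite /cond; have hu' := wdir_unit (tword ts) hu.
case: (leqP k (size ts)) => hk.
  rewrite (eqP hk) big_mkcond big_seq1 cats0.
  rewrite -[LHS]Rmult_1_l -(q_sum hu') big_distrl /=; apply: eq_bigr => a _; congr Rmult.
  rewrite size_rcons (_ : (k - (size ts).+1)%nat = 0%nat); last by lia.
  by rewrite [RHS]big_mkcond big_seq1 cats0 -cats1 takel_cat.
have e : (k - size ts)%nat = (k - (size ts).+1).+1 by lia.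
rewrite e big_mkcond sum_words_ofS; apply: eq_bigr => a _.
rewrite size_rcons [in RHS]big_mkcond big_distrr /=; apply: eq_bigr => ts' _.
rewrite -cats1 -catA tword_cat wdir_cat /= /tword /= cats0.
by case: ifP => _; lra.
Qed.

Lemma cond_ge0 u k E ts : unit_vec u -> 0 <= cond u k E ts.
Proof.
move=> hu; apply: sumR_ge0 => ts' hts _.
by have [] := tweight_bounds (wdir_unit (tword ts) hu) hts.
Qed.

Lemma cond_sure u k (E : pred (seq T)) ts : size ts = k -> E ts -> cond u k E ts = 1.
Proof.
move=> hs hE; rewrite /cond hs subnn big_mkcond big_seq1 cats0 take_oversize ?hE //.
by rewrite hs.
Qed.

(* The method of conditional expectations: follow a child along which no
   partial sum of the martingales [Psi i] increases beyond [c]. *)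
Lemma good_path u (Psi : nat -> seq T -> R) c : unit_vec u ->
  (forall i ts, 0 <= Psi i ts) ->
  (forall i ts, Psi i ts =
    \big[Rplus/0]_(a <- A) (q (wdir u (tword ts)) a * Psi i (rcons ts a))) ->
  (forall N, \big[Rplus/0]_(i <- iota 0 N) Psi i [::] <= c) ->
  exists pre : nat -> seq T,
    [/\ forall j, pre j \in level j,
        forall j, exists a, pre j.+1 = rcons (pre j) a &
        forall i j, Psi i (pre j) <= c].
Proof.
move=> hu hpos hmart h0.
pose inv ts := forall N, \big[Rplus/0]_(i <- iota 0 N) Psi i ts <= c.
have hmono : forall ts N M, (N <= M)%nat ->
    \big[Rplus/0]_(i <- iota 0 N) Psi i ts <= \big[Rplus/0]_(i <- iota 0 M) Psi i ts.
  move=> ts N M hNM; rewrite -(subnKC hNM) iotaD big_cat /=.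
  have : 0 <= \big[Rplus/0]_(i <- iota (0 + N) (M - N)) Psi i ts by apply: sumR_ge0.
  lra.
have hstep : forall ts, exists a, inv ts -> a \in A /\ inv (rcons ts a).
  move=> ts; case: (EM (inv ts)) => hinv; last first.
    have [a ha] : exists a, a \in A.
      case: (A) (q_sum hu) => [|a A' _]; first by rewrite big_nil; lra.
      by exists a; exact: mem_head.
    by exists a.
  apply: contrapT => hno.
  (* Infinite sums appear through their partial sums. If every child violates the bound at some
     index, then by monotonicity all violate it at the maximal one, against the average over
     children. *)
  have hN : forall a, exists N, a \in A -> c < \big[Rplus/0]_(i <- iota 0 N) Psi i (rcons ts a).
    move=> a; apply: contrapT => hna; apply: hno; exists a => _; split.
      by apply: contrapT => ha; apply: hna; exists 0%nat => /ha.
    move=> N; apply: Rnot_lt_le => hlt; apply: hna; by exists N.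
  have [f hf] := choice hN.
  pose N := (\max_(a <- A) f a)%nat.
  have hu' := wdir_unit (tword ts) hu.
  have hgt : forall a, a \in A -> c < \big[Rplus/0]_(i <- iota 0 N) Psi i (rcons ts a).
    move=> a ha; apply: Rlt_le_trans (hf a ha) (hmono _ _ _ _).
    exact: leq_bigmax_seq.
  have e : \big[Rplus/0]_(i <- iota 0 N) Psi i ts = \big[Rplus/0]_(a <- A)
      (q (wdir u (tword ts)) a * \big[Rplus/0]_(i <- iota 0 N) Psi i (rcons ts a)).
    under eq_bigr => i _ do rewrite hmart.
    by rewrite exchange_big; apply: eq_bigr => a _; rewrite -big_distrr.
  have hle := hinv N; rewrite e in hle.
  (* A child of positive weight makes the inequality between averages strict. *)
  have [a [ha hqa]] : exists a, a \in A /\ 0 < q (wdir u (tword ts)) a.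
    apply: contrapT => hna; have := q_sum hu'.
    suff : \big[Rplus/0]_(a <- A) q (wdir u (tword ts)) a <= 0 by lra.
    apply: (Rle_trans _ (\big[Rplus/0]_(a <- A) 0)); last by rewrite big1 //; lra.
    by apply: sumR_le => a ha _; apply: Rnot_lt_le => hqa; apply: hna; exists a.
  have hsum := sumR_ge_term (F := fun a => q (wdir u (tword ts)) a *
    (\big[Rplus/0]_(i <- iota 0 N) Psi i (rcons ts a) - c)) ha.
  have : \big[Rplus/0]_(a <- A) (q (wdir u (tword ts)) a *
    (\big[Rplus/0]_(i <- iota 0 N) Psi i (rcons ts a) - c)) <= 0.
    under eq_bigr => a' _ do rewrite Rmult_minus_distr_l /Rminus.
    rewrite big_split sumR_opp -big_distrl /= q_sum //; lra.
  move=> hneg; have hga := hgt a ha.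
  have : 0 < q (wdir u (tword ts)) a *
    (\big[Rplus/0]_(i <- iota 0 N) Psi i (rcons ts a) - c) by apply: Rmult_lt_0_compat; lra.
  apply: Rle_not_lt; apply: Rle_trans (hsum _) hneg => a' ha'.
  have [hq0 _] := q_bounds hu' ha'; have := hgt a' ha'.
  by move=> hh; apply: Rmult_le_pos => //; lra.
have [st hst] := choice hstep.
pose pre := fix pre j := if j is j'.+1 then rcons (pre j') (st (pre j')) else [::].
have hinv : forall j, inv (pre j).
  elim=> [|j IH]; first exact: h0.
  by have [] := hst _ IH.
exists pre; split.
- have hrc : forall j ts a, ts \in level j -> a \in A -> rcons ts a \in level j.+1.
    elim=> [|j IH] ts a; first by rewrite inE => /eqP -> ha; rewrite mem_words_ofS ha.
    move=> /mem_words_ofP [b [ts' [-> hb hts]]] ha.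
    by rewrite rcons_cons mem_words_ofS hb; exact: IH.
  elim=> [|j IH]; first exact: mem_head.
  by apply: hrc => //; have [] := hst _ (hinv j).
- by move=> j; exists (st (pre j)).
move=> i j; apply: Rle_trans (hinv j i.+1).
have hmem : i \in iota 0 i.+1 by rewrite mem_iota add0n ltnSn.
by apply: (sumR_ge_term (F := fun i => Psi i (pre j)) hmem).
Qed.

Lemma path_limit (pre : nat -> seq T) : (forall j, pre j \in level j) ->
  (forall j, exists a, pre j.+1 = rcons (pre j) a) ->
  exists z, forall j, exists x, att S x /\ z = wmap (tword (pre j)) x.
Proof.
move=> hmem hext.
have [x0 hx0] := att_nonempty S.
pose x j := wmap (tword (pre j)) x0.
have htail : forall j k, (j <= k)%nat -> exists w, tword (pre k) = tword (pre j) ++ w.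
  move=> j; elim=> [|k IH]; first by rewrite leqn0 => /eqP ->; exists [::]; rewrite cats0.
  rewrite leq_eqVlt => /orP[/eqP ->|]; first by exists [::]; rewrite cats0.
  rewrite ltnS => /IH [w hw]; have [a ha] := hext k.
  by exists (w ++ tword [:: a]); rewrite ha -cats1 tword_cat hw catA.
pose e j := exp (- (INR j * (theta * X))) * diam S.
have hdist : forall j k, (j <= k)%nat -> dist (x j) (x k) <= e j.
  move=> j k /htail [w hw]; rewrite /x hw wmap_cat wmap_dist.
  have [_ h] := level_ratio (hmem j).
  apply: Rmult_le_compat => //; [exact: Rlt_le (wratio_gt0 _) | exact: dist_ge0 |].
  by apply: att_diam => //; exact: att_wmap.
have he : forall eta, 0 < eta -> exists N, forall j, (N <= j)%nat -> e j < eta.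
  move=> eta heta; have hD := diam_ge1 S.
  have htX : 0 < theta * X by nra.
  have [N hN] := INR_unbounded (diam S / eta / (theta * X)).
  exists N => j hj; rewrite /e exp_Ropp.
  have hNj : INR N <= INR j by apply/le_INR/leP.
  have h1 : diam S / eta < INR j * (theta * X).
    have -> : diam S / eta = diam S / eta / (theta * X) * (theta * X) by field; nra.
    by apply: Rmult_lt_compat_r; lra.
  have h2 : INR j * (theta * X) <= exp (INR j * (theta * X)).
    by have := exp_ineq1_le (INR j * (theta * X)); lra.
  have h3 := exp_pos (INR j * (theta * X)).
  apply: (Rmult_lt_reg_l (exp (INR j * (theta * X)))) => //.
  rewrite -Rmult_assoc Rinv_r; last by lra.
  have : diam S = diam S / eta * eta by field; lra.
  nra.
have hcv : forall i, exists l, Un_cv (fun j => x j i) l.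
  move=> i; have [|l hl] := R_complete (fun j => x j i); last by exists l.
  move=> eta heta; have [N hN] := he (eta / 2) ltac:(lra).
  exists N => j k /leP hj /leP hk; rewrite /R_dist.
  have hc : forall j, (N <= j)%nat -> Rabs (x N i - x j i) < eta / 2.
    move=> {}j {}hj; apply: Rle_lt_trans (hN N (leqnn N)).
    apply: Rle_trans (hdist _ _ hj); exact: (coord_le (vsub (x N) (x j)) i).
  by have := hc j hj; have := hc k hk; split_Rabs; lra.
have [z hz] := choice hcv.
have hlim : forall j, dist (z : Point d) (x j) <= INR d * e j.
  move=> j; apply: dist_le_sum => i; apply: Rnot_lt_le => hlt.
  have [N hN] := hz i (Rabs (z i - x j i) - e j) ltac:(lra).
  have := hN (maxn N j) ltac:(lia); rewrite /R_dist.
  have : Rabs (x j i - x (maxn N j) i) <= e j.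
    apply: Rle_trans (hdist j (maxn N j) (leq_maxr _ _)).
    exact: (coord_le (vsub (x j) (x (maxn N j))) i).
  by split_Rabs; lra.
exists z => j; have [y hy] := wmap_onto (tword (pre j)) z.
(* If the preimage [y] were outside the closed attractor, a ball around it would miss the attractor,
   but the approximating points of deeper cylinders pull back into that ball. *)
exists y; split => //; apply: contrapT => hny.
have [eta [heta hball]] := att_closed hny.
have hr := wratio_gt0 (tword (pre j)).
have hd := pos_INR d.
have [N hN] := he (eta * wratio (tword (pre j)) / (INR d + 1)) ltac:(apply: Rdiv_lt_0_compat; nra).
pose k := maxn N j.
have [w hw] := htail j k (leq_maxr _ _).
apply: (hball (wmap w x0)); last exact: att_wmap.
apply: (Rmult_lt_reg_l (wratio (tword (pre j)))) => //.
rewrite -wmap_dist hy -wmap_cat -hw.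
have := hN k (leq_maxl _ _); have := hlim k; rewrite -/(x k) => h1 h2.
apply: Rle_lt_trans h1 _.
have -> : wratio (tword (pre j)) * eta =
  (INR d + 1) * (eta * wratio (tword (pre j)) / (INR d + 1)) by field; lra.
have : 0 < eta * wratio (tword (pre j)) / (INR d + 1) by apply: Rdiv_lt_0_compat; nra.
nra.
Qed.

End Tree.

(** * Multiplicity of fibres *)

Lemma ln_le_ln x y : 0 < x -> x <= y -> ln x <= ln y.
Proof. by move=> hx [/(ln_increasing _ _ hx)|->]; lra. Qed.

Lemma sumR_le_count (I : eqType) (s : seq I) (P : pred I) (F : I -> R) c :
  {in s, forall i, F i <= c} -> \big[Rplus/0]_(i <- s | P i) F i <= INR (count P s) * c.
Proof.
move=> h; rewrite -big_filter -size_filter -sumR_const; apply: sumR_le => i.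
by rewrite mem_filter => /andP[_ hi] _; exact: h.
Qed.

Lemma seq_argmin (I : eqType) (s : seq I) (F : I -> R) i0 : i0 \in s ->
  exists2 i, i \in s & {in s, forall j, F i <= F j}.
Proof.
elim: s i0 => [//|x s IH] i0 _.
case: s IH => [|y s] IH.
  by exists x; [exact: mem_head | move=> j; rewrite inE => /eqP ->; lra].
have [i hi hmin] := IH y (mem_head y s).
case: (Rle_lt_dec (F x) (F i)) => h.
  exists x; first exact: mem_head.
  by move=> j; rewrite inE => /orP[/eqP -> | /hmin]; lra.
exists i; first by rewrite inE hi orbT.
by move=> j; rewrite inE => /orP[/eqP -> | /hmin]; lra.
Qed.

Lemma find_cell (l z : R) M : 0 < l -> 0 <= z <= (INR M + 1) * l ->
  exists2 m, m \in iota 0 M.+1 & INR m * l <= z <= (INR m + 1) * l.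
Proof.
move=> hl; elim: M => [|M IH] hz.
  by exists 0%nat => //; rewrite /= in hz *; lra.
case: (Rle_lt_dec z ((INR M + 1) * l)) => h.
  have [|m hm hmz] := IH; first lra.
  by exists m => //; move: hm; rewrite !mem_iota; lia.
exists M.+1; first by rewrite mem_iota; lia.
rewrite S_INR in hz *; lra.
Qed.

Section Fibres.
Variables (d : nat) (S : self_similar d).
Notation letter := 'I_(alpha S).
Notation word := (seq letter).
Variables (T : eqType) (A : seq T) (wd : T -> word) (p : letter -> R).
Variables (X theta : R) (q : Point d -> T -> R).
Implicit Types (u v : Point d) (ts : seq T).
Hypotheses (X_gt0 : 0 < X) (theta_bounds : 0 < theta <= 1).
Hypothesis p_gt0 : forall i, 0 < p i.
Hypothesis A_uniq : uniq A.
Hypothesis A_prefix : {in A &, forall a a', prefix (wd a) (wd a') -> a = a'}.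
Hypothesis A_ratio : {in A, forall a, exp (- X) <= wratio (wd a) <= exp (- (theta * X))}.
Hypothesis q_bounds : forall u, unit_vec u -> {in A, forall a, 0 <= q u a <= 2 * wprod p (wd a)}.
Hypothesis q_sum : forall u, unit_vec u -> \big[Rplus/0]_(a <- A) q u a = 1.
Hypothesis q_spread : forall u x y, unit_vec u -> y - x <= exp (- X) ->
  \big[Rplus/0]_(a <- A | `[< hits u (wd a) x y >]) q u a <= exp (- (theta * X)).
Variable s : R.
Hypothesis s_gt0 : 0 < s.
Hypothesis p_le : forall i, p i <= Rpower (ratio i) s.
Hypothesis att_interval : forall u y1 y2 t, unit_vec u -> att S y1 -> att S y2 ->
  dot u y1 <= t <= dot u y2 -> exists y, att S y /\ dot u y = t.

Notation level k := (words_of A k).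
Notation tword := (tword wd).
Notation tweight := (tweight wd q).

Definition covers v (w : word) (x : R) := exists y, att S y /\ dot v (wmap w y) = x.

(** Projecting [w] to [v] is an affine copy of projecting the attractor to [wdir v w], where
    [att_interval] applies. *)
Lemma covers_between v w x1 x2 x : unit_vec v -> covers v w x1 -> covers v w x2 ->
  x1 <= x <= x2 -> covers v w x.
Proof.
move=> hv [y1 [hy1 e1]] [y2 [hy2 e2]] hx.
have hr := wratio_gt0 w.
have h2 := dot_wmap v w y2 y1; rewrite e1 e2 in h2.
have hdiv : forall a b, a <= b -> a / wratio w <= b / wratio w.
  by move=> a b hab; apply: Rmult_le_compat_r => //; apply: Rlt_le; exact: Rinv_0_lt_compat.
have [|y [hy ey]] := att_interval (t := dot (wdir v w) y1 + (x - x1) / wratio w) (wdir_unit w hv) hy1 hy2.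
  have := hdiv 0 (x - x1) ltac:(lra); have := hdiv (x - x1) (x2 - x1) ltac:(lra).
  have -> : (x2 - x1) / wratio w = dot (wdir v w) y2 - dot (wdir v w) y1 by rewrite h2; field; lra.
  have -> : 0 / wratio w = 0 by field; lra.
  lra.
exists y; split => //; have := dot_wmap v w y y1; rewrite e1 ey => h.
have : wratio w * (dot (wdir v w) y1 + (x - x1) / wratio w - dot (wdir v w) y1) = x - x1.
  by field; lra.
lra.
Qed.

(** By [att_width] the projected cylinder is an interval at least as long as [a, b], so it cannot
    lie strictly inside. *)
Lemma covers_endpoint v w a b x : unit_vec v -> covers v w x -> a <= x <= b ->
  b - a <= wratio w * (exp (- X) / 2) -> covers v w a \/ covers v w b.
Proof.
move=> hv hx hab hl.
have [y2 [y1 [h2 h1 hw]]] := att_width X_gt0 theta_bounds q_sum q_spread (wdir_unit w hv).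
have hr := wratio_gt0 w.
have e := dot_wmap v w y2 y1.
have c1 : covers v w (dot v (wmap w y1)) by exists y1.
have c2 : covers v w (dot v (wmap w y2)) by exists y2.
have hlen : wratio w * (exp (- X) / 2) <= dot v (wmap w y2) - dot v (wmap w y1) by rewrite e; nra.
case: (Rle_lt_dec (dot v (wmap w y1)) a) => ha; first by left; apply: covers_between c1 hx _ => //; lra.
by right; apply: covers_between hx c2 _ => //; lra.
Qed.

Definition multiplicity v k (x : R) : nat :=
  count (fun ts => `[< covers v (tword ts) x >]) (level k).

(* Cylinders over a short interval contain one of its endpoints; those which
   contain the same endpoint are nested over the interval, so that all of them
   cover the nearest point of low multiplicity. *)
Lemma low_multiplicity_count v k a b m : unit_vec v -> 0 <= m ->
  b - a <= exp (- (INR k * X)) * (exp (- X) / 2) ->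
  INR (count (fun ts => `[< exists x, [/\ a <= x <= b, INR (multiplicity v k x) < m &
    covers v (tword ts) x] >]) (level k)) <= 2 * m.
Proof.
move=> hv hm hab.
set P := (fun ts => _).
have hx : forall ts, exists x, P ts -> [/\ a <= x <= b, INR (multiplicity v k x) < m &
    covers v (tword ts) x].
  by move=> ts; case: (EM (P ts)) => [/asboolP [x hx]|hn]; [exists x | exists 0].
have [xi hxi] := choice hx.
have hside : forall c : R, (c = a \/ c = b) ->
    INR (count (fun ts => P ts && `[< covers v (tword ts) c >]) (level k)) <= m.
  move=> c hc; set Pc := (fun ts => _).
  case: (boolP (has Pc (level k))) => [/hasP [t0 ht0 hP0]|]; last first.
    by rewrite has_count -leqNgt leqn0 => /eqP ->.
  have [t1] := seq_argmin (s := [seq ts <- level k | Pc ts]) (fun ts => Rabs (xi ts - c)) (i0 := t0)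
    ltac:(by rewrite mem_filter hP0).
  rewrite mem_filter => /andP[/andP[hP1 /asboolP hc1] ht1] hmin.
  have [g1 g2 g3] := hxi t1 hP1.
  apply: Rle_trans (Rlt_le _ _ g2); apply/le_INR/leP.
  rewrite /multiplicity -!size_filter; apply: uniq_leq_size.
    by rewrite filter_uniq // uniq_words_of.
  move=> ts hts; have hmt := hmin ts hts.
  move: hts; rewrite !mem_filter => /andP[/andP[hP /asboolP hcov] hts]; rewrite hts andbT.
  have [f1 f2 f3] := hxi ts hP; apply/asboolP.
  case: hc hmt hcov => -> hmt hcov.
    by apply: covers_between hcov f3 _ => //; rewrite !Rabs_pos_eq in hmt; lra.
  by apply: covers_between f3 hcov _ => //; rewrite !Rabs_left1 in hmt; lra.
apply: (Rle_trans _ (INR (count (fun ts => P ts && `[< covers v (tword ts) a >]) (level k)) +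
    INR (count (fun ts => P ts && `[< covers v (tword ts) b >]) (level k)))); last first.
  by have := hside a (or_introl erefl); have := hside b (or_intror erefl); lra.
rewrite -plus_INR; apply/le_INR/leP.
rewrite -[X in (_ <= X)%nat]count_predUI; apply: leq_trans (leq_addr _ _).
rewrite -!size_filter; apply: uniq_leq_size; first by rewrite filter_uniq // uniq_words_of.
move=> ts; rewrite !mem_filter => /andP[hP hts]; rewrite hts andbT /= hP /=.
have [f1 f2 f3] := hxi ts hP.
have [hr _] := level_ratio A_ratio hts.
have hX := exp_pos (- X).
case: (covers_endpoint hv f3 f1 _) => [|hc|hc].
- by apply: Rle_trans hab _; apply: Rmult_le_compat_r; lra.
- by apply/orP; left; apply/asboolP.
- by apply/orP; right; apply/asboolP.
Qed.

Lemma wprod_le_Rpower w : wprod p w <= Rpower (wratio w) s.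
Proof.
elim: w => [|i w IH]; first by rewrite /wratio /= /Rpower ln_1 Rmult_0_r exp_0; lra.
rewrite /wratio /= -/(wratio w) -Rpower_mult_distr; [|by case: (ratio_bounds i)|exact: wratio_gt0].
apply: Rmult_le_compat => //; first exact: Rlt_le.
exact: Rlt_le (wprod_gt0 w p_gt0).
Qed.

Lemma tweight_level v k ts : unit_vec v -> ts \in level k ->
  tweight v ts <= 2 ^ k * exp (- (s * (INR k * (theta * X)))).
Proof.
move=> hv hts; have [_ h] := tweight_bounds p_gt0 q_bounds hv hts.
apply: Rle_trans h _; apply: Rmult_le_compat_l; first by apply: pow_le; lra.
apply: Rle_trans (wprod_le_Rpower _) _.
have [_ hr] := level_ratio A_ratio hts.
rewrite /Rpower; apply: exp_le.
have hr0 := wratio_gt0 (tword ts).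
have : ln (wratio (tword ts)) <= - (INR k * (theta * X)).
  by rewrite -[X in _ <= X]ln_exp; exact: ln_le_ln.
nra.
Qed.

(** The projection of the attractor is divided into about [diam S * exp (INR k.+1 * X)] cells. Each
    meets at most [2 * m] of the cylinders, each of weight at most [tau]. *)
Lemma low_multiplicity_mass v k m : unit_vec v -> 0 <= m ->
  \big[Rplus/0]_(ts <- level k | `[< exists x, INR (multiplicity v k x) < m /\
      covers v (tword ts) x >]) tweight v ts <=
  16 * diam S * exp (INR k.+1 * X) * m * (2 ^ k * exp (- (s * (INR k * (theta * X))))).
Proof.
move=> hv hm.
set tau := 2 ^ k * _.
have htau : 0 <= tau by apply: Rmult_le_pos; [apply: pow_le; lra | exact: Rlt_le (exp_pos _)].
have [x0 hx0] := att_nonempty S; have hD := diam_ge1 S.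
(* The cell length is the width guaranteed by [att_width] in the smallest cylinder of generation
   [k]. *)
pose l := exp (- (INR k.+1 * X)) / 2.
have hX0 : 0 <= INR k.+1 * X by have := pos_INR k.+1; nra.
have hl0 : 0 < l by have := exp_pos (- (INR k.+1 * X)); rewrite /l; lra.
have hl1 : l <= 1.
  have : exp (- (INR k.+1 * X)) <= 1 by rewrite -exp_0; apply: exp_le; lra.
  by rewrite /l; lra.
have el : l = exp (- (INR k * X)) * (exp (- X) / 2).
  by rewrite /l /Rdiv -Rmult_assoc -exp_plus S_INR; congr (exp _ * _); lra.
have eil : / l = 2 * exp (INR k.+1 * X).
  by rewrite /l exp_Ropp; have := exp_pos (INR k.+1 * X) => h; field; lra.
have [M [hM1 hM2]] : exists M : nat, 2 * diam S / l <= INR M + 1 /\ INR M <= 2 * diam S / l.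
  have hpos : 0 <= 2 * diam S / l by apply: Rle_mult_inv_pos; lra.
  exists (Z.to_nat (up (2 * diam S / l) - 1)).
  have [a1 a2] := archimed (2 * diam S / l).
  have hz : (0 <= up (2 * diam S / l) - 1)%Z.
    have : (0 < up (2 * diam S / l))%Z by apply: lt_IZR; lra.
    by lia.
  rewrite INR_IZR_INZ Z2Nat.id // minus_IZR; lra.
pose c := dot v x0 - diam S.
pose G n ts := `[< exists x, [/\ c + INR n * l <= x <= c + (INR n + 1) * l,
  INR (multiplicity v k x) < m & covers v (tword ts) x] >].
have hq0 : forall ts, ts \in level k -> 0 <= tweight v ts.
  by move=> ts hts; have [] := tweight_bounds p_gt0 q_bounds hv hts.
apply: (Rle_trans _ (\big[Rplus/0]_(n <- iota 0 M.+1) \big[Rplus/0]_(ts <- level k | G n ts) tweight v ts)).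
  apply: (Rle_trans _ (\big[Rplus/0]_(ts <- level k) \big[Rplus/0]_(n <- iota 0 M.+1)
      (if G n ts then tweight v ts else 0))); last first.
    rewrite exchange_big; apply: sumR_le => n _ _; rewrite -big_mkcond; exact: Rle_refl.
  rewrite big_mkcond; apply: sumR_le => ts hts _; have h0 := hq0 ts hts.
  case: asboolP => [[x [hx1 hx2]]|_]; last first.
    by apply: sumR_ge0 => n _ _; case: ifP => _; lra.
  have [n hn hxn] : exists2 n, n \in iota 0 M.+1 & INR n * l <= x - c <= (INR n + 1) * l.
    apply: find_cell => //.
    have [y [hy ey]] := hx2.
    have hd := dot_dist v (wmap (tword ts) y) x0.
    have := att_diam (att_wmap (tword ts) hy) hx0; rewrite (nrm_unit hv) in hd => hdd.
    have : 2 * diam S <= (INR M + 1) * l.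
      have -> : 2 * diam S = 2 * diam S / l * l by field; lra.
      by apply: Rmult_le_compat_r; lra.
    by rewrite ey in hd; rewrite /c; split_Rabs; lra.
  have hGn : G n ts by apply/asboolP; exists x; split => //; lra.
  have := sumR_ge_term (F := fun n => if G n ts then tweight v ts else 0) hn.
  rewrite hGn; apply => n' _; case: ifP => _; lra.
apply: (Rle_trans _ (\big[Rplus/0]_(n <- iota 0 M.+1) (2 * m * tau))).
  apply: sumR_le => n _ _.
  apply: Rle_trans (sumR_le_count _ (fun ts hts => tweight_level hv hts)) _.
  apply: Rmult_le_compat_r => //; apply: low_multiplicity_count => //.
  by rewrite -el; lra.
rewrite sumR_const size_iota S_INR.
have hmt : 0 <= 2 * m * tau by apply: Rmult_le_pos; lra.
have hM3 : INR M + 1 <= 8 * diam S * exp (INR k.+1 * X).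
  have e2 : 2 * diam S / l = 4 * diam S * exp (INR k.+1 * X) by rewrite /Rdiv eil; ring.
  have h1 : 1 <= exp (INR k.+1 * X) by rewrite -exp_0; exact: exp_le.
  rewrite e2 in hM2.
  have : 1 <= diam S * exp (INR k.+1 * X) by nra.
  lra.
apply: Rle_trans (Rmult_le_compat_r _ _ _ hmt hM3) _; apply: Req_le; ring.
Qed.

End Fibres.

Lemma size_by_fibres (T : eqType) (L : seq T) (g : T -> nat) (n C : nat) :
  {in L, forall t, (g t < n)%nat} ->
  (forall i, (i < n)%nat -> (count (fun t => g t == i) L <= C)%nat) -> (size L <= n * C)%nat.
Proof.
elim: n L => [|n IH] L hg hc.
  by case: L hg {hc} => // t L /(_ t (mem_head t L)).
rewrite mulSn -(count_predC (fun t => g t == n)); apply: leq_add; first exact: hc.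
rewrite -size_filter; apply: IH => [t|i hi].
  rewrite mem_filter /= => /andP[ht /hg]; rewrite ltnS leq_eqVlt; by rewrite (negbTE ht).
apply: leq_trans (hc i (ltnW hi)); rewrite count_filter; apply: sub_count => t /=.
by case/andP.
Qed.

Lemma size_words_of (T : eqType) (A : seq T) k ts : ts \in words_of A k -> size ts = k.
Proof.
elim: k ts => [|k IH] ts; first by rewrite inE => /eqP ->.
by move=> /mem_words_ofP [a [ts' [-> _ /IH /= ->]]].
Qed.

Lemma cond_nil (d : nat) (S : self_similar d) (T : eqType) (A : seq T)
    (wd : T -> seq 'I_(alpha S)) (q : Point d -> T -> R) u k (E : pred (seq T)) :
  cond A wd q u k E [::] = \big[Rplus/0]_(ts <- words_of A k | E ts) tweight wd q u ts.
Proof.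
rewrite /cond subn0 big_seq_cond [in RHS]big_seq_cond; apply: eq_bigl => ts.
case: (boolP (ts \in words_of A k)) => //= hts.
by rewrite take_oversize // (size_words_of hts).
Qed.

Lemma sum_f_R0_iota F n : sum_f_R0 F n = \big[Rplus/0]_(i <- iota 0 n.+1) F i.
Proof.
elim: n => [|n IH]; first by rewrite big_seq1.
by rewrite [LHS]/= IH -[in RHS]addn1 iotaD big_cat big_seq1.
Qed.

(** * Fibres of large lower box dimension outside a given cover *)

Section FinalStage.
Variables (d : nat) (S : self_similar d).
Notation letter := 'I_(alpha S).
Notation word := (seq letter).
Variables (T : eqType) (A : seq T) (wd : T -> word) (p : letter -> R).
Variables (X theta : R) (q : Point d -> T -> R).
Implicit Types (u v : Point d) (ts : seq T).
Hypotheses (X_gt0 : 0 < X) (theta_bounds : 0 < theta <= 1).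
Hypothesis p_gt0 : forall i, 0 < p i.
Hypothesis A_uniq : uniq A.
Hypothesis A_prefix : {in A &, forall a a', prefix (wd a) (wd a') -> a = a'}.
Hypothesis A_ratio : {in A, forall a, exp (- X) <= wratio (wd a) <= exp (- (theta * X))}.
Hypothesis q_bounds : forall u, unit_vec u -> {in A, forall a, 0 <= q u a <= 2 * wprod p (wd a)}.
Hypothesis q_sum : forall u, unit_vec u -> \big[Rplus/0]_(a <- A) q u a = 1.
Hypothesis q_spread : forall u x y, unit_vec u -> y - x <= exp (- X) ->
  \big[Rplus/0]_(a <- A | `[< hits u (wd a) x y >]) q u a <= exp (- (theta * X)).
Variable s : R.
Hypothesis s_gt0 : 0 < s.
Hypothesis p_le : forall i, p i <= Rpower (ratio i) s.
Hypothesis att_interval : forall u y1 y2 t, unit_vec u -> att S y1 -> att S y2 ->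
  dot u y1 <= t <= dot u y2 -> exists y, att S y /\ dot u y = t.
Variable C : nat.
Hypothesis antichain_bound : forall (rho : R) (L : seq word) (y : word -> Point d),
  0 < rho -> uniq L -> antichain L ->
  {in L, forall w, rho <= wratio w /\ exists x, att S x /\ y w = wmap w x} ->
  {in L &, forall w1 w2, dist (y w1) (y w2) <= 1 * rho} -> (size L <= C)%nat.

Notation level k := (words_of A k).
Notation tword := (tword wd).
Notation tweight := (tweight wd q).
Notation multiplicity := (multiplicity A wd).

Definition fibre v x : Point d -> Prop := fun y => att S y /\ proj v y = scal x v.

(** Each generation-[k] cylinder over [x] has a point in the fibre. A covering set of diameter at
    most [exp (- (INR k * X))] contains such points of at most [C] cylinders, because the cylinders
    form an antichain. *)
Lemma fibre_cover v k x delta n (U : nat -> Point d -> Prop) : delta <= exp (- (INR k * X)) ->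
  (forall i y z, (i < n)%nat -> U i y -> U i z -> dist y z <= delta) ->
  (forall y, fibre v x y -> exists i, (i < n)%nat /\ U i y) ->
  (multiplicity v k x <= n * C)%nat.
Proof.
move=> hdelta hU hcov; rewrite /multiplicity -size_filter.
set L := filter _ _.
have hL : forall ts, exists z, ts \in L -> att S z /\ dot v (wmap (tword ts) z) = x.
  move=> ts; case: (EM (ts \in L)) => [|hn]; last by have [z _] := att_nonempty S; exists z.
  by rewrite mem_filter => /andP[/asboolP [z hz] _]; exists z.
have [z hz] := choice hL.
have hi : forall ts, exists i, ts \in L -> (i < n)%nat /\ U i (wmap (tword ts) (z ts)).
  move=> ts; case: (EM (ts \in L)) => [hts|hn]; last by exists 0%nat.
  have [hz1 hz2] := hz ts hts.
  have [|i hi] := hcov (wmap (tword ts) (z ts)); last by exists i.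
  by split; [exact: att_wmap | rewrite /proj dotC hz2].
have [g hg] := choice hi.
apply: (size_by_fibres (g := g)) => [ts hts|i hin]; first by have [] := hg ts hts.
rewrite -size_filter -(size_map tword).
have hmem : forall ts, ts \in [seq t <- L | g t == i] -> [/\ ts \in L, g ts = i & ts \in level k].
  move=> ts; rewrite mem_filter => /andP[/eqP h1 h2]; split => //.
  by move: h2; rewrite mem_filter => /andP[].
have hinj : {in [seq t <- L | g t == i] &, injective tword}.
  move=> t1 t2 /hmem [_ _ h1] /hmem [_ _ h2] e.
  by apply: (level_prefix A_prefix h1 h2); rewrite e prefix_refl.
(* [antichain_bound] speaks of words, so tree nodes are recovered from their words. *)
have hinv : forall w, exists ts, w \in [seq tword t | t <- L & g t == i] ->
    ts \in [seq t <- L | g t == i] /\ w = tword ts.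
  move=> w; case: (EM (w \in [seq tword t | t <- L & g t == i])) => [/mapP [ts h1 h2]|hn].
    by exists ts.
  by exists [::].
have [inv hinv'] := choice hinv.
apply: (antichain_bound (rho := exp (- (INR k * X))) (y := fun w => wmap w (z (inv w)))).
- exact: exp_pos.
- rewrite map_inj_in_uniq // !filter_uniq //; exact: uniq_words_of.
- move=> w1 w2 /mapP [t1 /hmem [_ _ h1] ->] /mapP [t2 /hmem [_ _ h2] ->] hp.
  by rewrite (level_prefix A_prefix h1 h2 hp).
- move=> w hw; have [/hmem [h1 h2 h3] e] := hinv' w hw; split.
    by rewrite e; have [] := level_ratio A_ratio h3.
  by exists (z (inv w)); split => //; have [] := hz _ h1.
- move=> w1 w2 hw1 hw2; rewrite Rmult_1_l; apply: Rle_trans hdelta.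
  have [/hmem [a1 a2 a3] e1] := hinv' w1 hw1; have [/hmem [b1 b2 b3] e2] := hinv' w2 hw2.
  rewrite {1}e1 {1}e2; apply: (hU i) => //.
    by have [_] := hg _ a1; rewrite a2.
  by have [_] := hg _ b1; rewrite b2.
Qed.

Lemma scale_exact (x : R) : 0 <= x -> exists k : nat, INR k * X <= x < INR k.+1 * X.
Proof.
move=> hx.
have hpos : 0 <= x / X by apply: Rle_mult_inv_pos; lra.
have [a1 a2] := archimed (x / X).
have hz : (0 < up (x / X))%Z by apply: lt_IZR; lra.
have e : x = x / X * X by field; lra.
exists (Z.to_nat (up (x / X) - 1)).
rewrite S_INR INR_IZR_INZ Z2Nat.id; last by lia.
rewrite minus_IZR {2 3}e; nra.
Qed.

(** Every small [delta] lies between [exp (- (INR k.+1 * X))] and [exp (- (INR k * X))]; the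
    exponent at [k.+1] in the hypothesis covers the smaller end. *)
Lemma fibre_lbdim v x k0 t t' : (0 < C)%nat -> t < t' -> 0 <= t' ->
  (forall k, (k0 <= k)%nat -> INR C * exp (INR k.+1 * (t' * X)) <= INR (multiplicity v k x)) ->
  lbdim_gt (fibre v x) t.
Proof.
move=> hC htt ht' hmul.
exists t', (exp (- (INR k0 * X))); split; [done | split; first exact: exp_pos].
move=> delta [h0 hdelta] n U hU hcov.
have hln : ln delta < - (INR k0 * X) by rewrite -[X in _ < X]ln_exp; exact: ln_increasing.
have hk0 := pos_INR k0.
have [k [hk1 hk2]] := scale_exact (x := - ln delta) ltac:(nra).
have hkk : (k0 <= k)%nat.
  rewrite -ltnS; apply/ltP/INR_lt; apply: (Rmult_lt_reg_r X) => //; lra.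
have hd : delta <= exp (- (INR k * X)).
  by rewrite -{1}(exp_ln delta h0); apply: exp_le; lra.
have := fibre_cover hd hU hcov => /leP /le_INR; rewrite mult_INR => hN.
have := hmul k hkk => hm.
have hC0 : 0 < INR C by apply: lt_0_INR; lia.
apply: (Rle_trans _ (exp (INR k.+1 * (t' * X)))).
  by rewrite /Rpower; apply: exp_le; nra.
apply: (Rmult_le_reg_l (INR C)) => //; lra.
Qed.

Lemma geometric_tail c N k0 : 0 <= c ->
  \big[Rplus/0]_(i <- iota 0 N) (c * (/ 2) ^ (k0 + i)) <= 2 * c * (/ 2) ^ k0.
Proof.
move=> hc.
have e : \big[Rplus/0]_(i <- iota 0 N) (c * (/ 2) ^ (k0 + i)) =
    2 * c * (/ 2) ^ k0 * (1 - (/ 2) ^ N).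
  elim: N => [|N IH]; first by rewrite big_nil /=; lra.
  rewrite -addn1 iotaD big_cat IH big_seq1 add0n.
  rewrite !pow_add /=; field.
rewrite e; have h1 : 0 < (/ 2) ^ k0 by apply: pow_lt; lra.
have h2 : 0 < (/ 2) ^ N by apply: pow_lt; lra.
have h3 : 0 <= 2 * c * (/ 2) ^ k0 by apply: Rmult_le_pos; lra.
nra.
Qed.

Lemma fibres_not_null v eps t : unit_vec v -> (0 < C)%nat -> 0 < eps < s - 1 -> theta < 1 ->
  (1 - theta) * (s + 1) <= eps / 4 -> / (1 - theta) <= X -> 0 <= t <= theta ->
  ~ Hnull t (fun x => (exists c, x = scal c v) /\
    lbdim_gt (fun y => att S y /\ proj v y = x) (s - 1 - eps)).
Proof.
move=> hv hC heps hth1 hth hX ht hnull.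
have hln2 : ln 2 <= 1 by rewrite -[X in _ <= X]ln_exp; apply: ln_le_ln; [lra | have := exp_ineq1_le 1; lra].
have hC0 : 1 <= INR C by apply: (le_INR 1); lia.
have hD := diam_ge1 S.
have heX : 1 <= (1 - theta) * X.
  apply: (Rle_trans _ ((1 - theta) * / (1 - theta))); first by rewrite Rinv_r; lra.
  by apply: Rmult_le_compat_l; lra.
(* Half of [eps] separates [t'] from the required dimension; the other half makes the
   low-multiplicity masses summable. *)
pose t' := s - 1 - eps / 2.
pose m k := INR C * exp (INR k.+1 * (t' * X)).
pose B k ts := `[< exists x, INR (multiplicity v k x) < m k /\ covers v (tword ts) x >].
pose K := 16 * diam S * INR C * exp ((t' + 1) * X).
have hK : 0 <= K.
  by rewrite /K; repeat apply: Rmult_le_pos; try lra; exact: Rlt_le (exp_pos _).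
have hB : forall k, \big[Rplus/0]_(ts <- level k | B k ts) tweight v ts <= K * (/ 2) ^ k.
  move=> k; have hm0 : 0 <= m k.
    by apply: Rmult_le_pos; [lra | exact: Rlt_le (exp_pos _)].
  apply: Rle_trans (low_multiplicity_mass X_gt0 theta_bounds p_gt0 A_uniq A_ratio q_bounds q_sum
    q_spread s_gt0 p_le att_interval k hv hm0) _.
  have e2 : 2 ^ k = exp (INR k * ln 2) by rewrite -pow_exp exp_ln //; lra.
  have -> : 16 * diam S * exp (INR k.+1 * X) * m k *
      (2 ^ k * exp (- (s * (INR k * (theta * X))))) =
      K * exp (INR k * ((t' + 1) * X + ln 2 - s * (theta * X))).
    rewrite /m /K e2.
    have -> : exp (INR k * ((t' + 1) * X + ln 2 - s * (theta * X))) =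
      exp (INR k * ((t' + 1) * X)) * exp (INR k * ln 2) * exp (- (s * (INR k * (theta * X)))).
      by rewrite -!exp_plus; congr exp; ring.
    have -> : exp (INR k * ((t' + 1) * X)) = exp (INR k * X) * exp (INR k * (t' * X)).
      by rewrite -exp_plus; congr exp; ring.
    have -> : exp ((t' + 1) * X) = exp X * exp (t' * X) by rewrite -exp_plus; congr exp; ring.
    have -> : exp (INR k.+1 * X) = exp (INR k * X) * exp X.
      by rewrite S_INR -exp_plus; congr exp; ring.
    have -> : exp (INR k.+1 * (t' * X)) = exp (INR k * (t' * X)) * exp (t' * X).
      by rewrite S_INR -exp_plus; congr exp; ring.
    ring.
  apply: Rmult_le_compat_l => //; rewrite half_pow; apply: exp_le.
  rewrite Ropp_mult_distr_r; apply: Rmult_le_compat_l; first exact: pos_INR.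
  (* The 2 in [s + 2] accounts for two terms [ln 2]: the doubling of weights and the decay
     [(/ 2) ^ k]. Each is at most [1 <= (1 - theta) * X]. *)
  have h1 : (1 - theta) * (s + 2) <= eps / 2 by nra.
  have h2 : X * ((1 - theta) * (s + 2)) <= X * (eps / 2) by apply: Rmult_le_compat_l; lra.
  rewrite /t'; lra.
have [k0 hk0] : exists k0 : nat, 2 * K * (/ 2) ^ k0 <= / 4.
  have [N hN] := INR_unbounded (8 * K); exists N.
  have h2 : INR N < 2 ^ N.
    elim: (N) => [|i IH]; first by rewrite /=; lra.
    have := pow_R1_Rle 2 i; rewrite S_INR /=; lra.
  have h3 : 0 < 2 ^ N by apply: pow_lt; lra.
  rewrite pow_inv; apply: (Rmult_le_reg_r (2 ^ N)) => //.
  rewrite Rmult_assoc Rinv_l; lra.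
(* The events of the cover weigh at most [2 * exp X * eta = / 4], and those of low multiplicity
   another [/ 4]. The total stays below 1, the value at which an event would be certain. *)
pose eta := exp (- X) / 8.
have heX0 := exp_pos X; have heX1 := exp_pos (- X).
have heX2 : exp X * exp (- X) = 1 by rewrite -exp_plus Rplus_opp_r exp_0.
have heX3 : exp (- X) <= 1 by rewrite -exp_0; apply: exp_le; lra.
have [U [r [hr0 [hUr [hcov hsum]]]]] := hnull eta ltac:(rewrite /eta; lra).
have hsum' : forall N, \big[Rplus/0]_(i <- iota 0 N) Rpower (r i) t <= eta.
  case=> [|N]; first by rewrite big_nil /eta; lra.
  by rewrite -sum_f_R0_iota.
have hRp : forall i, 0 < Rpower (r i) t by move=> i; exact: exp_pos.
have hr1 : forall j, ln (r j) <= 0.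
  move=> j; apply: Rnot_lt_le => hlt.
  have : Rpower (r j) t <= eta.
    apply: Rle_trans (hsum' j.+1).
    have hmem : j \in iota 0 j.+1 by rewrite mem_iota add0n ltnSn.
    by apply: (sumR_ge_term (F := fun i => Rpower (r i) t) hmem) => i _; exact: Rlt_le.
  have : 1 <= Rpower (r j) t by rewrite -exp_0; apply: exp_le; nra.
  by rewrite /eta; lra.
have hlev : forall j, exists n, INR n * X <= - ln (r j) < INR n.+1 * X.
  by move=> j; apply: scale_exact; have := hr1 j; lra.
have [nj hnj] := choice hlev.
(* A point of the line in the [j]-th covering set; 0 is a dummy for sets that miss the line, and
   [Ev] excludes these. *)
have hc : forall j, exists c, (exists c', U j (scal c' v)) -> U j (scal c v).
  move=> j; case: (EM (exists c', U j (scal c' v))) => [[c' hc']|hn]; first by exists c'.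
  by exists 0.
have [c hcU] := choice hc.
pose Ev j ts := `[< (exists c', U j (scal c' v)) /\ hits v (tword ts) (c j - r j) (c j + r j) >].
have hq0 : forall k ts, ts \in level k -> 0 <= tweight v ts.
  by move=> k ts hts; have [] := tweight_bounds p_gt0 q_bounds hv hts.
have hEv : forall j, \big[Rplus/0]_(ts <- level (nj j) | Ev j ts) tweight v ts <=
    2 * exp X * Rpower (r j) t.
  move=> j; have [n1 n2] := hnj j.
  have hrn : r j <= exp (- (INR (nj j) * X)).
    by rewrite -{1}(exp_ln (r j) (hr0 j)); apply: exp_le; lra.
  have hb : exp (- (INR (nj j) * (theta * X))) <= exp X * Rpower (r j) t.
    rewrite /Rpower -exp_plus; apply: exp_le.
    have := hr1 j; rewrite S_INR in n2 => hl0.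
    have h1 : theta * ln (r j) <= t * ln (r j) by nra.
    have h2 : theta * (- ln (r j)) <= theta * ((INR (nj j) + 1) * X).
      by apply: Rmult_le_compat_l; lra.
    nra.
  (* The interval around [c j] has length [2 * r j], so each half is estimated separately. *)
  have s1 := level_spread X_gt0 A_ratio q_bounds q_spread
    (k := nj j) (x := c j - r j) (y := c j) hv ltac:(lra).
  have s2 := level_spread X_gt0 A_ratio q_bounds q_spread
    (k := nj j) (x := c j) (y := c j + r j) hv ltac:(lra).
  apply: (Rle_trans _ (\big[Rplus/0]_(ts <- level (nj j) | `[< hits v (tword ts) (c j - r j) (c j) >])
      tweight v ts + \big[Rplus/0]_(ts <- level (nj j) | `[< hits v (tword ts) (c j) (c j + r j) >])
      tweight v ts)); last by lra.
  rewrite big_mkcond [X in _ <= X + _]big_mkcond [X in _ <= _ + X]big_mkcond -big_split /=; apply: sumR_le => ts hts _.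
  have h0 := hq0 _ _ hts.
  case: (boolP (Ev j ts)) => [/asboolP [_ [y [hy [y1 y2]]]]|_]; last first.
    by do 2 case: asbool; lra.
  case: (Rle_lt_dec (dot v (wmap (tword ts) y)) (c j)) => hyc.
    rewrite (asboolT (P := hits v (tword ts) (c j - r j) (c j))); last by exists y.
    by case: asbool; lra.
  rewrite (asboolT (P := hits v (tword ts) (c j) (c j + r j))); last by exists y; split => //; lra.
  by case: asbool; lra.
pose Psi i ts := cond A wd q v (k0 + i) (B (k0 + i)%nat) ts + cond A wd q v (nj i) (Ev i) ts.
have hcond0 := fun k E ts => cond_ge0 (A := A) (wd := wd) p_gt0 q_bounds k E ts hv.
have [|||pre [hpre hext hgood]] := @good_path d S T A wd p q q_bounds q_sum v Psi (/ 2) hv.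
- by move=> i ts; have := hcond0 (k0 + i)%nat (B (k0 + i)%nat) ts; have := hcond0 (nj i) (Ev i) ts; rewrite /Psi; lra.
- move=> i ts; rewrite /Psi (cond_step wd q_sum (k0 + i) _ ts hv).
  rewrite (cond_step wd q_sum (nj i) _ ts hv) -big_split.
  by apply: eq_bigr => a _ /=; lra.
- move=> N; rewrite /Psi big_split /=.
  have b1 : \big[Rplus/0]_(i <- iota 0 N) cond A wd q v (k0 + i) (B (k0 + i)%nat) [::] <= / 4.
    apply: Rle_trans hk0; apply: Rle_trans (geometric_tail N k0 hK).
    by apply: sumR_le => i _ _; rewrite cond_nil.
  have b2 : \big[Rplus/0]_(i <- iota 0 N) cond A wd q v (nj i) (Ev i) [::] <= / 4.
    apply: (Rle_trans _ (\big[Rplus/0]_(i <- iota 0 N) (2 * exp X * Rpower (r i) t))).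
      by apply: sumR_le => i _ _; rewrite cond_nil.
    rewrite -big_distrr /=.
    have := hsum' N; rewrite /eta; move: (\big[Rplus/0]_(i <- _) _) => z hz.
    have : 2 * exp X * z <= 2 * exp X * (exp (- X) / 8) by apply: Rmult_le_compat_l; lra.
    nra.
  lra.
have hsize : forall j, size (pre j) = j by move=> j; exact: size_words_of (hpre j).
have [z hz] := path_limit X_gt0 theta_bounds A_ratio hpre hext.
pose x := dot v z.
have hx : lbdim_gt (fibre v x) (s - 1 - eps).
  apply: (@fibre_lbdim v x k0 _ t') => //; try by rewrite /t'; lra.
  (* A low multiplicity would make the event [B k] certain at the node [pre k], against the bound
     [/ 2]. *)
  move=> k hk; apply: Rnot_lt_le => hlow.
  have hBk : B k (pre k).
    by apply/asboolP; exists x; split => //; have [y [hy ey]] := hz k; exists y; rewrite -ey.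
  have := hgood (k - k0)%nat k; rewrite /Psi subnKC //.
  rewrite (cond_sure A wd q v (hsize k) hBk).
  have := hcond0 (nj (k - k0)%nat) (Ev (k - k0)%nat) (pre k); lra.
have [|j hj] := hcov (scal x v); first by split; [exists x | exact: hx].
have hEj : Ev j (pre (nj j)).
  apply/asboolP; split; first by exists x.
  have [y [hy ey]] := hz (nj j); exists y; split => //; rewrite -ey -/x.
  have hcj : U j (scal (c j) v) by apply: hcU; exists x.
  have := hUr j _ _ hj hcj; have := dot_dist v (scal x v) (scal (c j) v).
  rewrite (nrm_unit hv) !dot_scalr (_ : dot v v = 1) // => h1 h2.
  by split_Rabs; lra.
have := hgood j (nj j); rewrite /Psi (cond_sure A wd q v (hsize (nj j)) hEj).
have := hcond0 (k0 + j)%nat (B (k0 + j)%nat) (pre (nj j)); lra.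
Qed.

End FinalStage.

(** * Hausdorff dimension *)

(** [Hnull] wants an infinite sequence with positive radii: the finite cover is padded by empty sets
    whose [s]-th powers of radii form a geometric series. *)
Lemma Hnull_finite (d : nat) (s : R) (A : Point d -> Prop) : 0 < s ->
  (forall eps, 0 < eps -> exists (n : nat) (U : nat -> Point d -> Prop) (r : nat -> R),
    [/\ forall k, (k < n)%nat -> 0 < r k,
        forall k x y, (k < n)%nat -> U k x -> U k y -> dist x y <= r k,
        forall x, A x -> exists2 k, (k < n)%nat & U k x &
        \big[Rplus/0]_(k <- iota 0 n) Rpower (r k) s <= eps]) -> Hnull s A.
Proof.
move=> hs h eps heps.
have [n [U [r [hr hU hcov hsum]]]] := h (eps / 2) ltac:(lra).
pose pad k := eps / 4 * (/ 2) ^ k.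
have hpad : forall k, 0 < pad k by move=> k; apply: Rmult_lt_0_compat; [lra | apply: pow_lt; lra].
exists (fun k x => (k < n)%nat /\ U k x), (fun k => if (k < n)%nat then r k else Rpower (pad k) (/ s)).
split; [|split; [|split]].
- move=> k; case: ifP => [/hr //|_]; exact: exp_pos.
- by move=> k x y [hk hx] [_ hy]; rewrite hk; exact: hU.
- by move=> x /hcov [k hk hx]; exists k.
move=> N; rewrite sum_f_R0_iota.
apply: (Rle_trans _ (\big[Rplus/0]_(k <- iota 0 N.+1) ((if (k < n)%nat then Rpower (r k) s else 0) + pad k))).
  apply: sumR_le => k _ _; have hp := hpad k; case: ifP => _; first by lra.
  rewrite Rpower_mult Rinv_l ?Rpower_1; lra.
rewrite big_split /=.
have h1 : \big[Rplus/0]_(k <- iota 0 N.+1) pad k <= eps / 2.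
  apply: (Rle_trans _ (2 * (eps / 4) * (/ 2) ^ 0)); last by rewrite /=; lra.
  by apply: (@geometric_tail (eps / 4) N.+1 0); lra.
have h2 : \big[Rplus/0]_(k <- iota 0 N.+1) (if (k < n)%nat then Rpower (r k) s else 0) <= eps / 2.
  apply: Rle_trans hsum.
  apply: (Rle_trans _ (\big[Rplus/0]_(k <- iota 0 (n + N.+1)) (if (k < n)%nat then Rpower (r k) s else 0))).
    rewrite addnC [in X in _ <= X]iotaD big_cat /=.
    set y := (X in _ <= Rplus _ X); suff : 0 <= y by lra.
    by apply: sumR_ge0 => k _ _; case: ifP => _; [exact: Rlt_le (exp_pos _) | lra].
  rewrite iotaD big_cat /= (_ : \big[Rplus/0]_(k <- iota (0 + n) N.+1) _ = 0); last first.
    rewrite big_seq big1 // => k; rewrite mem_iota add0n => /andP[hk _].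
    by rewrite ltnNge hk.
  rewrite Rplus_0_r; apply: sumR_le => k; rewrite mem_iota => /andP[_ hk] _.
  by rewrite hk; lra.
apply: (Rle_trans _ _ _ (Rplus_le_compat _ _ _ _ h2 h1)); lra.
Qed.

Section Dimension.
Variables (d : nat) (S : self_similar d).
Notation letter := 'I_(alpha S).
Notation word := (seq letter).

Definition pressure (t : R) := \big[Rplus/0]_(i : letter) Rpower (ratio i) t.

Lemma sum_words_pow (g : letter -> R) k :
  \big[Rplus/0]_(w <- words_of (enum 'I_(alpha S)) k) wprod g w = (\big[Rplus/0]_(i : letter) g i) ^ k.
Proof.
elim: k => [|k IH]; first by rewrite big_seq1.
rewrite sum_words_ofS big_enum /= big_distrl; apply: eq_bigr => i _ /=.
by rewrite -big_distrr IH.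
Qed.

Lemma att_words k y : att S y ->
  exists w, w \in words_of (enum 'I_(alpha S)) k /\ exists x, att S x /\ y = wmap w x.
Proof.
elim: k y => [|k IH] y hy; first by exists [::]; split; [exact: mem_head | exists y].
have [i [z [hz ->]]] := proj1 (att_fixed S y) hy.
have [w [hw [x [hx ->]]]] := IH z hz.
by exists (i :: w); split; [rewrite mem_words_ofS mem_enum hw | exists x].
Qed.

Lemma Rpower_wratio w t : Rpower (wratio w) t = wprod (fun i : letter => Rpower (ratio i) t) w.
Proof.
elim: w => [|i w IH]; first by rewrite /wratio /= /Rpower ln_1 Rmult_0_r exp_0.
rewrite /wratio /= -/(wratio w) -Rpower_mult_distr ?IH //; first by case: (ratio_bounds i).
exact: wratio_gt0.
Qed.

(** The cylinders of generation [k] form a cover of total cost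
    [Rpower (diam S) t * pressure t ^ k]. *)
Lemma att_Hnull t : 0 < t -> pressure t < 1 -> Hnull t (att S).
Proof.
move=> ht hp; apply: Hnull_finite => // eps heps.
have hD := diam_ge1 S.
have hp0 : 0 <= pressure t by apply: sumR_ge0 => i _ _; exact: Rlt_le (exp_pos _).
have hDt : 0 < Rpower (diam S) t := exp_pos _.
have [k hk] := @pow_lt_1_zero (pressure t) ltac:(rewrite Rabs_pos_eq; lra) (eps / Rpower (diam S) t)
  ltac:(apply: Rdiv_lt_0_compat; lra).
have {}hk := hk k (le_n k); rewrite Rabs_pos_eq in hk; last exact: pow_le.
set L := words_of (enum 'I_(alpha S)) k.
exists (size L), (fun j y => exists x, att S x /\ y = wmap (nth [::] L j) x),
  (fun j => wratio (nth [::] L j) * diam S); split.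
- by move=> j _; apply: Rmult_lt_0_compat; [exact: wratio_gt0 | lra].
- move=> j _ _ _ [x [hx ->]] [y [hy ->]]; rewrite wmap_dist.
  by apply: Rmult_le_compat_l; [exact: Rlt_le (wratio_gt0 _) | exact: att_diam].
- move=> y hy; have [w [hw hx]] := att_words k hy.
  exists (index w L); first by rewrite index_mem.
  by rewrite nth_index.
have -> : \big[Rplus/0]_(j <- iota 0 (size L)) Rpower (wratio (nth [::] L j) * diam S) t =
    \big[Rplus/0]_(w <- L) Rpower (wratio w * diam S) t.
  by rewrite [RHS](big_nth [::]) /index_iota subn0.
have -> : \big[Rplus/0]_(w <- L) Rpower (wratio w * diam S) t =
    Rpower (diam S) t * pressure t ^ k.
  rewrite -sum_words_pow big_distrr; apply: eq_bigr => w _ /=.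
  rewrite -Rpower_mult_distr ?Rpower_wratio; [lra | exact: wratio_gt0 | lra].
apply: (Rle_trans _ (Rpower (diam S) t * (eps / Rpower (diam S) t))).
  by apply: Rmult_le_compat_l; lra.
by apply: Req_le; field; lra.
Qed.

(** If the pressure at [s] were below 1, it would be so slightly below [s] too, and [att_Hnull]
    would push the dimension under [s]. *)
Lemma pressure_ge1 s : 0 < s -> hdim (att S) s -> 1 <= pressure s.
Proof.
move=> hs [_ [hlow _]]; apply: Rnot_lt_le => hlt.
have h0 := rmin_gt0 S; have h1 := rmin_lt1 S.
have [x0 /att_fixed [i0 _]] := att_nonempty S.
have hp0 : 0 < pressure s.
  by apply: (sumR_pos (mem_index_enum i0)) => i _; exact: exp_pos.
have hrho : ln (rmin S) < 0 by rewrite -ln_1; apply: ln_increasing.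
have hlp : ln (pressure s) < 0 by rewrite -ln_1; apply: ln_increasing.
(* Lowering the exponent by [h] multiplies each term by at most [Rpower (rmin S) (- h)]. *)
have [h [hh0 hhs hhp]] : exists h, [/\ 0 < h, h < s & ln (pressure s) < h * ln (rmin S)].
  exists (Rmin (s / 2) (ln (pressure s) / (2 * ln (rmin S)))).
  have hpos : 0 < ln (pressure s) / (2 * ln (rmin S)).
    have -> : ln (pressure s) / (2 * ln (rmin S)) = (- ln (pressure s)) / (2 * - ln (rmin S)) by field; lra.
    by apply: Rdiv_lt_0_compat; lra.
  have m1 := Rmin_l (s / 2) (ln (pressure s) / (2 * ln (rmin S))).
  have m2 := Rmin_r (s / 2) (ln (pressure s) / (2 * ln (rmin S))).
  split; [by apply: Rmin_glb_lt; lra | lra |].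
  have : ln (pressure s) / 2 <= Rmin (s / 2) (ln (pressure s) / (2 * ln (rmin S))) * ln (rmin S).
    have -> : ln (pressure s) / 2 = ln (pressure s) / (2 * ln (rmin S)) * ln (rmin S) by field; lra.
    nra.
  lra.
suff : s <= s - h by lra.
apply: hlow; split; first lra.
apply: att_Hnull; first lra.
apply: (Rle_lt_trans _ (pressure s * exp (- (h * ln (rmin S))))).
  rewrite /pressure big_distrl; apply: sumR_le => i _ _ /=.
  rewrite /Rpower -exp_plus; apply: exp_le.
  have : ln (rmin S) <= ln (ratio i) by apply: ln_le_ln => //; exact: rmin_le.
  nra.
rewrite -{1}(exp_ln (pressure s)) // -exp_plus -exp_0; apply: exp_increasing; lra.
Qed.

End Dimension.

Lemma line_Hnull (d : nat) (v : Point d) (A : Point d -> Prop) c D t : unit_vec v -> 0 < D -> 1 < t ->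
  (forall x, A x -> exists z, x = scal z v /\ Rabs (z - c) <= D) -> Hnull t A.
Proof.
move=> hv hD ht hA; apply: Hnull_finite => [|eps heps]; first lra.
(* [N] pieces of length [2 * D / N] cost [N * (2 * D / N) ^ t], at most [eps] for this [N]. *)
have [N hN] := INR_unbounded (exp ((t * ln (2 * D) - ln eps) / (t - 1))).
have hN0 : 0 < INR N by have := exp_pos ((t * ln (2 * D) - ln eps) / (t - 1)); lra.
have hlnN : t * ln (2 * D) - ln eps <= (t - 1) * ln (INR N).
  have h : (t * ln (2 * D) - ln eps) / (t - 1) <= ln (INR N).
    by rewrite -[X in X <= _]ln_exp; apply: ln_le_ln; [exact: exp_pos | lra].
  have -> : t * ln (2 * D) - ln eps = (t - 1) * ((t * ln (2 * D) - ln eps) / (t - 1)) by field; lra.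
  by apply: Rmult_le_compat_l; lra.
pose l := 2 * D / INR N.
have hl : 0 < l by apply: Rdiv_lt_0_compat; lra.
have hlN : INR N * l = 2 * D by rewrite /l; field; lra.
exists N, (fun k x => exists z, x = scal z v /\ INR k * l <= z - (c - D) <= (INR k + 1) * l), (fun=> l).
split => //.
- move=> k _ _ _ [x [-> hx]] [y [-> hy]].
  have -> : dist (scal x v) (scal y v) = Rabs (x - y).
    rewrite dist_nrm /nrm.
    have -> : vsub (scal x v) (scal y v) = scal (x - y) v.
      by apply: functional_extensionality => i; rewrite /vsub /scal; lra.
    rewrite dot_scalr dot_scall (_ : dot v v = 1) // Rmult_1_r.
    exact: sqrt_Rsqr_abs.
  by split_Rabs; lra.
- move=> x /hA [z [ez hz]].
  have hN1 : (0 < N)%nat by apply/ltP/INR_lt.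
  have [|k hk hkz] := @find_cell l (z - (c - D)) N.-1 hl.
    by rewrite -S_INR prednK // hlN; split_Rabs; lra.
  by exists k; [move: hk; rewrite mem_iota; lia | exists z].
rewrite sumR_const size_iota /Rpower -{1}(exp_ln (INR N)) // -exp_plus.
rewrite -[X in _ <= X](exp_ln eps) //; apply: exp_le.
have -> : ln l = ln (2 * D) - ln (INR N).
  by rewrite /l /Rdiv ln_mult ?ln_Rinv; [lra | lra | lra | exact: Rinv_0_lt_compat].
lra.
Qed.

(** The segment from [y1] to [y2] lies in the convex hull and projects onto the interval between
    their projections. *)
Lemma hull_projection_interval (d : nat) (K : Point d -> Prop) u y1 y2 t : unit_vec u ->
  (forall x, conv_hull K x -> exists2 y, K y & proj u y = proj u x) ->
  K y1 -> K y2 -> dot u y1 <= t <= dot u y2 -> exists y, K y /\ dot u y = t.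
Proof.
move=> hu hproj h1 h2 ht.
case: (Req_dec (dot u y1) (dot u y2)) => he; first by exists y1; split => //; lra.
pose c := (t - dot u y1) / (dot u y2 - dot u y1).
have hlt : dot u y1 < dot u y2 by lra.
have hc : 0 <= c <= 1.
  split; first by apply: Rle_mult_inv_pos; lra.
  by apply: (Rmult_le_reg_r (dot u y2 - dot u y1)); rewrite /c /Rdiv ?Rmult_assoc ?Rinv_l; lra.
pose z : Point d := fun j => (1 - c) * y1 j + c * y2 j.
have hz : dot u z = t.
  have -> : dot u z = (1 - c) * dot u y1 + c * dot u y2.
    by rewrite /dot !big_distrr -big_split; apply: eq_bigr => i _ /=; rewrite /z; lra.
  by rewrite /c; field; lra.
have [|y hy ey] := hproj z.
  exists 1%nat, (fun k => if k is 0%nat then y1 else y2), (fun k => if k is 0%nat then 1 - c else c).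
  split; [by case=> [|k] _; split => //; lra | split => [|j] /=; [lra | by []]].
exists y; split => //.
have := congr1 (dot u) ey; rewrite /proj !dot_scalr (_ : dot u u = 1) // !(dotC _ u) hz; lra.
Qed.

Theorem theorem3p2 (d m : nat) (r : nat -> R) (Rot : nat -> Mat d)
  (a : nat -> Point d) (K : Point d -> Prop) (s : R) :
  (2 <= m)%nat ->
  (forall i, (i < m)%nat -> 0 < r i < 1 /\ SOd (Rot i)) ->
  dense_rotations m Rot ->
  OSC m (sim r Rot a) ->
  is_attractor m (sim r Rot a) K ->
  hdim K s -> 1 < s ->
  (forall v : Point d, unit_vec v ->
     forall p, (exists x, K x /\ proj v x = p) <->
               (exists x, conv_hull K x /\ proj v x = p)) ->
  forall v : Point d, unit_vec v ->
  forall eps, 0 < eps < s - 1 ->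
    hdim (fun x => (exists t, x = scal t v) /\
                   lbdim_gt (fun y => K y /\ proj v y = x) (s - 1 - eps)) 1.
Proof.
move=> hm hr hdense hosc hatt hdim_s hs hproj v hv eps heps.
have hr' : forall i : 'I_m, 0 < r i < 1 by move=> i; case: (hr i (ltn_ord i)).
have hO : forall i : 'I_m, orth (Rot i) by move=> i; case: (hr i (ltn_ord i)) => _ [].
have [c1 [hc1 hc1r]] := fin_pos_lower_bound (fun i : 'I_m => proj1 (hr' i)).
have hr'' : forall i : 'I_m, 0 < 1 - r i by move=> i; have := hr' i; lra.
have [c2 [hc2 hc2r]] := fin_pos_lower_bound hr''.
case: hatt => hKne [[hKcl [D hD]] hKfix].
have hfix : forall y, K y <-> exists i : 'I_m, exists x, K x /\
    y = (fun j => r i * mat_apply (Rot i) x j + a i j).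
  move=> y; split => [/hKfix [i [hi [x [hx ->]]]]|[i [x [hx ->]]]].
    by exists (Ordinal hi), x.
  by apply/hKfix; exists (val i); split; [exact: ltn_ord | exists x].
pose S := @SelfSimilar d m (fun i => r i) (fun i => Rot i) (fun i => a i) K c1 (1 - c2) (Rmax 1 D)
  (proj1 hc1) hc1r (fun i => ltac:(have := hc2r i; lra)) ltac:(lra) hO (Rmax_l 1 D) hKne hKcl
  (fun x y hx hy => Rle_trans _ _ _ (hD x y hx hy) (Rmax_r 1 D)) hfix.
have hd : (0 < d)%nat.
  rewrite lt0n; apply/eqP => hd0; move: hv; rewrite /unit_vec /dot big1; first lra.
  by move=> i; have := ltn_ord i; move: (nat_of_ord i) => k; rewrite hd0.
have hoscS : open_set_condition S.
  have [U [hU0 [hUo [hUf hUd]]]] := hosc; exists U; split => //; split => //; split.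
    by move=> i x hx; exact: (hUf i x (ltn_ord i) hx).
  move=> i j x y hij hx hy; apply: (hUd i j x y (ltn_ord i) (ltn_ord j)) => // hij'.
  by apply: hij; exact: val_inj.
have hwords : dense_words S by apply: (@dense_rotations_words d S Rot).
have hinterval : forall u y1 y2 t, unit_vec u -> att S y1 -> att S y2 ->
    dot u y1 <= t <= dot u y2 -> exists y, att S y /\ dot u y = t.
  move=> u y1 y2 t hu; apply: hull_projection_interval => // x hx.
  have [|y [hy ey]] := proj2 (hproj u hu (proj u x)); first by exists x.
  by exists y.
have hpress := @pressure_ge1 d S s ltac:(lra) hdim_s.
(* Normalised by the pressure; as this is at least 1, [p i] remains below [Rpower (r i) s], and
   below [r i] since s > 1. *)
pose p (i : 'I_m) := Rpower (r i) s / pressure S s.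
have p_gt0 : forall i, 0 < p i by move=> i; apply: Rdiv_lt_0_compat; [exact: exp_pos | lra].
have p_sum : \big[Rplus/0]_(i : 'I_m) p i = 1.
  rewrite /p /Rdiv -big_distrl; apply: Rinv_r; change (pressure S s <> 0); lra.
have p_le : forall i, p i <= Rpower (r i) s.
  move=> i; have h0 : 0 < Rpower (r i) s := exp_pos _.
  apply: (Rmult_le_reg_r (pressure S s)); first lra.
  by rewrite /p /Rdiv Rmult_assoc Rinv_l; nra.
have p_le1 : forall i, p i <= r i.
  move=> i; apply: Rle_trans (p_le i) _; have [h0 h1] := hr' i.
  rewrite -[X in _ <= X](Rpower_1 (r i)) // /Rpower; apply: exp_le.
  have : ln (r i) < 0 by rewrite -ln_1; exact: ln_increasing.
  nra.
have [C hC] := osc_antichain_bound hoscS (H := 1) ltac:(lra).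
set E := fun x : Point d => _.
have hnot : forall t, 0 <= t < 1 -> ~ Hnull t E.
  move=> t ht.
  (* With [theta = 1 - e]: the second bound gives [t <= theta], the third
     [(1 - theta) * (s + 1) <= eps / 4]. *)
  pose e := Rmin (/ 2) (Rmin (1 - t) (eps / (4 * (s + 1)))).
  have he4 : 0 < eps / (4 * (s + 1)) by apply: Rdiv_lt_0_compat; lra.
  have he : [/\ 0 < e, e <= / 2, e <= 1 - t & e <= eps / (4 * (s + 1))].
    rewrite /e; have m1 := Rmin_l (/ 2) (Rmin (1 - t) (eps / (4 * (s + 1)))).
    have m2 := Rmin_r (/ 2) (Rmin (1 - t) (eps / (4 * (s + 1)))).
    have m3 := Rmin_l (1 - t) (eps / (4 * (s + 1))).
    have m4 := Rmin_r (1 - t) (eps / (4 * (s + 1))).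
    by split; try lra; apply: Rmin_glb_lt; [lra | apply: Rmin_glb_lt; lra].
  have [e0 e2 et es] := he.
  have [X [A [q [hX hA1 hA2 hA3 hq]]]] := spread_weights (S := S) p_gt0 p_sum p_le1 hd hoscS hwords
    (eps := e) ltac:(lra).
  have hX0 : 0 < X by have := Rinv_0_lt_compat _ e0; lra.
  (* [C.+1] in place of [C] provides a positive bound. *)
  apply: (@fibres_not_null d S _ A flatten p X (1 - e) q hX0 _ p_gt0 hA1 hA2 hA3 _ _ _ s _ p_le hinterval C.+1) => //.
  - lra.
  - by move=> u hu; have [] := hq u hu.
  - by move=> u hu; have [] := hq u hu.
  - by move=> u x y hu; have [_ _] := hq u hu; apply.
  - lra.
  - by move=> rho L y h1 h2 h3 h4 h5; apply: leqW; exact: (hC rho L y).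
  - lra.
  - have -> : eps / 4 = eps / (4 * (s + 1)) * (s + 1) by field; lra.
    by apply: Rmult_le_compat_r; lra.
  - by have -> : 1 - (1 - e) = e by lra.
  - lra.
have hup : forall t, 1 < t -> Hnull t E.
  move=> t ht; have [x0 hx0] := hKne.
  apply: (@line_Hnull d v _ (dot v x0) (Rmax 1 D)) => //.
    by have := Rmax_l 1 D; lra.
  move=> x [_ [t' [delta0 [ht' [hdelta0 hbox]]]]].
  (* An empty fibre would be covered by 0 sets, against the positive lower bound for covering
     numbers. *)
  have [y [hy ey]] : exists y, K y /\ proj v y = x.
    apply: contrapT => hno.
    have := hbox (delta0 / 2) ltac:(lra) 0%nat (fun _ _ => False).
    have hp : 0 < Rpower (delta0 / 2) (- t') := exp_pos _.
    rewrite /= => h; suff : Rpower (delta0 / 2) (- t') <= 0 by lra.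
    apply: h => [//|z hz]; by case: hno; exists z.
  exists (dot v y); split; first by rewrite -ey /proj dotC.
  apply: Rle_trans (dot_dist _ _ _) _; rewrite (nrm_unit hv) Rmult_1_l.
  by apply: Rle_trans (hD y x0 hy hx0) (Rmax_r 1 D).
split; last split.
(* An empty set would be null in dimension [/ 2]. *)
- apply: contrapT => hno; apply: (hnot (/ 2)); first lra.
  apply: Hnull_finite => [|eta heta]; first lra.
  exists 0%nat, (fun _ _ => False), (fun=> 1); split => //; last by rewrite big_nil; lra.
  by move=> x hx; case: hno; exists x.
- by move=> t [ht0 ht]; apply: Rnot_lt_le => hlt; exact: (hnot t).
move=> b hb; apply: Rnot_lt_le => hlt.
have := hb ((1 + b) / 2) (conj _ (hup _ _)); lra.
Qed.
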